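(* Let $\mathbb{F}$ be an algebraically closed field of prime characteristic $p$ and let $G$ be a finite group. Let $P_\alpha$ be a pointed $p$-group on $\mathbb{F}G$, and let $P{\uparrow}Q_\phi$ be the substantive generalized piece of $\mathbb{F}G$ corresponding to $P_\alpha$. Then $m(P_\alpha)=m(P{\uparrow}Q_\phi)$.
   Context: Modules are finitely generated left modules. For a finite group $L$, $\mathrm{Irr}(\mathbb{F}L)$ is the set of irreducible Brauer characters of $\mathbb{F}L$; for $\xi\in\mathrm{Irr}(\mathbb{F}L)$, $V(\xi)$ is a simple $\mathbb{F}L$-module with Brauer character $\xi$ and $E(\xi)$ is its projective cover. For $\mathbb{F}L$-modules $X$ and $M$ with $X$ indecomposable, $m(X,M)$ is the multiplicity of $X$ as a direct summand of $M$. Pointed groups. A pointed group on $\mathbb{F}G$ is a pair $U_\mu$ where $U\le G$ and $\mu$ is a point of $U$, i.e. a conjugacy class, under the unit group of $(\mathbb{F}G)^U$, of primitive idempotents of $(\mathbb{F}G)^U$. It is a pointed $p$-group if $U$ is a $p$-group. Its absolute multiplicity $m(U_\mu)$ is the maximal size of a set of mutually orthogonal elements of $\mu$. Write $W_\omega\le U_\mu$ if $W\le U$ and for some (equivalently every) $i\in\mu$ there is $j\in\omega$ with $ij=ji=j$. For a $p$-subgroup $P$, $\mathrm{br}_P:(\mathbb{F}G)^P\to\mathbb{F}C_G(P)$ is the Brauer map (truncation of the support to $C_G(P)$); a pointed $p$-group $P_\gamma$ is local if $\mathrm{br}_P(i)\ne 0$ for $i\in\gamma$. A maximal local pointed subgroup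 of $P_\alpha$ is a maximal element among the local pointed groups $Q_\delta\le P_\alpha$. Pieces. A piece of $\mathbb{F}G$ is a pair $P_\theta$ with $P$ a $p$-subgroup of $G$ and $\theta\in\mathrm{Irr}(\mathbb{F}C_G(P))$. By a theorem of Puig there is a bijection between local pointed groups $P_\gamma$ on $\mathbb{F}G$ and pieces $P_\theta$, with $P_\gamma\leftrightarrow P_\theta$ if and only if $E(\theta)\cong\mathbb{F}C_G(P)\,\mathrm{br}_P(i)$ for $i\in\gamma$. A generalized piece $P{\uparrow}Q_\phi$ of $\mathbb{F}G$ is the equivalence class of a pair $(P,Q_\phi)$, where $P$ is a $p$-subgroup of $G$ and $Q_\phi$ is a piece of $\mathbb{F}G$ with $Q\le P$; pairs $(P,Q_\phi)$ and $(P',Q'_{\phi'})$ are equivalent if $P=P'$ and $Q_\phi,Q'_{\phi'}$ are $P$-conjugate. Multiplicity and substantivity. If a finite $p$-group $S$ acts by automorphisms on a finite group $K$ and $\eta\in\mathrm{Irr}(\mathbb{F}K)$, then $\eta_{\rtimes S}$ denotes the unique irreducible Brauer character of $\mathbb{F}(K\rtimes S)$ such that $E(\eta_{\rtimes S})\cong\mathrm{Ind}_K^{K\rtimes S}(E(\eta))$. For a generalized piece $P{\uparrow}Q_\phi$, put $\overline{P}=N_P(Q)/Q$, acting on $C_G(Q)$ by conjugation. The absolute multiplicity $m(P{\uparrow}Q_\phi)$ is the multiplicity of the regular module $\mathbb{F}\overline{P}$ as a direct summand of the restriction to $\overline{P}$ of the simple $\mathbb{F}(C_G(Q)\rtimes\overline{P})$-module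 $V(\phi_{\rtimes\overline{P}})$; it is independent of the choice of $Q_\phi$. $P{\uparrow}Q_\phi$ is substantive if $m(P{\uparrow}Q_\phi)\neq 0$, i.e. if that restriction has a nonzero free direct summand. Correspondence. There is a $G$-equivariant bijection between pointed $p$-groups $P_\alpha$ on $\mathbb{F}G$ and substantive generalized pieces $P{\uparrow}Q_\phi$ of $\mathbb{F}G$ (with the same $P$), characterized as follows: $P_\alpha\leftrightarrow P{\uparrow}Q_\phi$ if and only if the local pointed group $Q_\delta$ corresponding to the piece $Q_\phi$ is a maximal local pointed subgroup of $P_\alpha$. This is the meaning of ''corresponding'' in the claim. *)

(* Defs.v *)
From HB Require Import structures.
From mathcomp Require Import boolp classical_sets.
From mathcomp Require Import all_boot all_order all_algebra.
From mathcomp Require Import all_fingroup all_solvable all_field all_character.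

Set Implicit Arguments.
Unset Strict Implicit.
Unset Printing Implicit Defensive.

Import GRing.Theory.
Local Open Scope group_scope.
Local Open Scope ring_scope.

(* Conventions.  A finitely generated left FL-module is a representation      *)
(* rV : mx_representation F L n, with x in L acting on column vectors by      *)
(* v |-> rV x *m v; isomorphism is mx_rsim.  The group algebra FG is the      *)
(* matrix algebra group_ring F G in 'M[F]_#|G|, in which x \in G is           *)
(* regular_repr F G x and the product is *m.  "The ... such that" is rendered *)
(* by classical choice (xget).                                                *)

(* The greatest element of a bounded nonempty set of natural numbers. *)
Definition nat_max (S : set nat) : nat :=
  xget 0%N (fun m => S m /\ forall k, S k -> (k <= m)%N).

Section Modules.

Variables (F : fieldType) (gT : finGroupType).
Implicit Types L K : {group gT}.

Definition mx_hom L n m (rV : mx_representation F L n)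
    (rW : mx_representation F L m) (B : 'M[F]_(m, n)) : Prop :=
  {in L, forall x, B *m rV x = rW x *m B}.

(* v |-> B *m v is surjective iff the rows of B are independent. *)
Definition mx_epi L n m (rV : mx_representation F L n)
    (rW : mx_representation F L m) (B : 'M[F]_(m, n)) : Prop :=
  mx_hom rV rW B /\ row_free B.

Definition mx_projective L n (rP : mx_representation F L n) : Prop :=
  forall m1 m2 (rV : mx_representation F L m1) (rW : mx_representation F L m2)
    (B : 'M[F]_(m2, m1)) (C : 'M[F]_(m2, n)),
  mx_epi rV rW B -> mx_hom rP rW C ->
  exists2 D : 'M[F]_(m1, n), mx_hom rP rV D & B *m D = C.

Definition essential_epi L n m (rP : mx_representation F L n)
    (rV : mx_representation F L m) (B : 'M[F]_(m, n)) : Prop :=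
  mx_epi rP rV B /\
  forall k (rX : mx_representation F L k) (D : 'M[F]_(n, k)),
    mx_hom rX rP D -> row_free (B *m D) -> row_free D.

Definition proj_cover L n m (rP : mx_representation F L n)
    (rV : mx_representation F L m) : Prop :=
  mx_projective rP /\ exists B, essential_epi rP rV B.

(* m(X, M), for X indecomposable: the largest k such that the direct sum of   *)
(* k copies of X is isomorphic to a direct summand of M.                      *)
Definition summand_mult L (X M : representation F L) : nat :=
  nat_max (fun k =>
    exists Y : representation F L, mx_rsim M (dadd_grepr (muln_grepr X k) Y)).

Section Induction.

Variables (L K : {group gT}).
Hypothesis sKL : K \subset L.
Variables (n : nat) (rN : mx_representation F K n).

Definition ind_rep (i : 'I_#|lcosets K L|) : gT := repr (enum_val i).

(* FL (x)_FK N, cut along the decomposition into the subspaces t_i (x) N: g   *)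
(* maps t_j (x) v to t_i (x) (t_i^-1 g t_j) v, for the i with g t_j in t_i K. *)
Definition ind_mx (g : gT) : 'M[F]_(\sum_(i < #|lcosets K L|) n) :=
  \mxblock_(i, j) (if ((ind_rep i)^-1 * g * ind_rep j)%g \in K
                   then rN ((ind_rep i)^-1 * g * ind_rep j)%g else 0).

Lemma ind_rep_lcoset i : (ind_rep i *: K)%g = enum_val i.
Proof.
have /lcosetsP[x _ def_i] := enum_valP i.
rewrite /ind_rep def_i; apply/lcoset_eqP.
by apply: mem_repr (lcoset_refl K x).
Qed.

Lemma ind_rep_in i : ind_rep i \in L.
Proof.
have /lcosetsP[x Lx def_i] := enum_valP i.
have: ind_rep i \in (x *: K)%g by rewrite -def_i -ind_rep_lcoset lcoset_refl.
by case/lcosetP=> y Ky ->; rewrite groupM // (subsetP sKL).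
Qed.

Lemma ind_rep_eq i x :
  (((ind_rep i)^-1 * x)%g \in K) = ((x *: K)%g == enum_val i).
Proof.
rewrite -mem_lcoset -ind_rep_lcoset.
by apply/lcoset_eqP/eqP.
Qed.

Lemma ind_mx_is_repr : mx_repr L ind_mx.
Proof.
split=> [|g h Lg Lh].
  apply/mxblockP=> i j; rewrite mxblockK mulg1 ind_rep_eq ind_rep_lcoset.
  rewrite (inj_eq enum_val_inj); apply/matrixP=> a b.
  rewrite [RHS]mxE [RHS]mxE -[(_ == _) in RHS]val_eqE tagnat.eq_Rank eq_sym.
  case: eqVneq => [ij|_] /=; last by rewrite mxE.
  by case: _ / ij in b *; rewrite mulVg repr_mx1 mxE.
rewrite /ind_mx mul_mxblock; apply: eq_mxblock => i k.
have hk_coset: (h * ind_rep k *: K)%g \in lcosets K L.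
  by apply/lcosetsP; exists (h * ind_rep k)%g; rewrite // groupM ?ind_rep_in.
pose j0 := enum_rank_in hk_coset (h * ind_rep k *: K)%g.
have j0E j: (((ind_rep j)^-1 * h * ind_rep k)%g \in K) = (j == j0).
  rewrite -mulgA ind_rep_eq -(inj_eq enum_val_inj) eq_sym.
  by rewrite enum_rankK_in.
rewrite (bigD1 j0) //= big1 => [|j /negPf nj]; last by rewrite j0E nj mulmx0.
have Kj0: ((ind_rep j0)^-1 * h * ind_rep k)%g \in K by rewrite j0E.
rewrite addr0 Kj0.
have ->: ((ind_rep i)^-1 * (g * h) * ind_rep k =
   (ind_rep i)^-1 * g * ind_rep j0 * ((ind_rep j0)^-1 * h * ind_rep k))%g.
  by rewrite !mulgA mulgK.
rewrite groupMr //; case: ifP => Ki; last by rewrite mul0mx.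
by rewrite repr_mxM.
Qed.
Definition ind_repr := MxRepresentation ind_mx_is_repr.

End Induction.

Section Transport.

Variables (hT : finGroupType) (K : {group gT}) (f : {morphism K >-> hT}).
Hypothesis injf : ('injm f)%g.
Variables (n : nat) (rN : mx_representation F K n).

Lemma isom_mx_is_repr : mx_repr (f @* K)%g (fun y => rN (invm injf y)).
Proof.
have imK y: y \in (f @* K)%g -> invm injf y \in K.
  by move=> fKy; rewrite -(im_invm injf) mem_morphim.
split=> [|y z fKy fKz]; first by rewrite morph1 repr_mx1.
by rewrite morphM // repr_mxM ?imK.
Qed.
Definition isom_repr : mx_representation F (f @* K)%g n :=
  MxRepresentation isom_mx_is_repr.

End Transport.
End Modules.

(* Brauer characters are formed with respect to an embedding into the complex *)
(* numbers of the group of roots of unity of F.                               *)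
Record root_lift (F : fieldType) := RootLift {
  lift_root :> F -> algC;
  lift_root1 : lift_root 1 = 1;
  lift_rootM : forall m x y, (0 < m)%N -> x ^+ m = 1 -> y ^+ m = 1 ->
    lift_root (x * y) = lift_root x * lift_root y;
  lift_root_inj : forall m x y, (0 < m)%N -> x ^+ m = 1 -> y ^+ m = 1 ->
    lift_root x = lift_root y -> x = y }.

Section BrauerCharacters.

Variables (F : closedFieldType) (p : nat) (lam : root_lift F).

Section OneGroup.

Variables (gT : finGroupType) (L : {group gT}).

(* With algebraic multiplicity. *)
Definition eigenvalues n (A : 'M[F]_n) : seq F :=
  sval (closed_field_poly_normal (char_poly A)).

(* A function on the p-regular elements of L, extended by 0 to gT. *)
Definition brauer_char n (rV : mx_representation F L n) : {ffun gT -> algC} :=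
  [ffun x => if (x \in L) && p^'.-elt x
             then \sum_(z <- eigenvalues (rV x)) lam z else 0].

Definition irr_brauer (xi : {ffun gT -> algC}) : Prop :=
  exists V : representation F L, mx_irreducible V /\ brauer_char V = xi.

Definition simple_module (xi : {ffun gT -> algC}) : representation F L :=
  xget (grepr0 : {classic representation F L})
    (fun V : representation F L => mx_irreducible V /\ brauer_char V = xi).

Definition proj_module (xi : {ffun gT -> algC}) : representation F L :=
  xget (grepr0 : {classic representation F L})
    (fun E : representation F L => proj_cover E (simple_module xi)).

End OneGroup.

(* The external semidirect product of K by S acting through to is the total   *)
(* group of sdprod_by to; K sits in it as the image of sdpair1 to and S as    *)
(* that of sdpair2 to.                                                        *)
Section SemidirectProduct.

Variables (sT kT : finGroupType) (S : {group sT}) (K : {group kT}).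
Variable to : groupAction S K.

Definition sdprod_group : {group sdprod_by to} := [set: sdprod_by to]%G.

Definition sdprod_ind n (rN : mx_representation F K n) :=
  ind_repr (subsetT (sdpair1 to @* K)%g) (isom_repr (injm_sdpair1 to) rN).

Definition sdprod_brauer (eta : {ffun kT -> algC}) :
    {ffun sdprod_by to -> algC} :=
  xget [ffun=> 0] (fun xi => irr_brauer sdprod_group xi /\
    mx_rsim (proj_module sdprod_group xi) (sdprod_ind (proj_module K eta))).

Definition sdprod_res n (rV : mx_representation F sdprod_group n) :
    mx_representation F S n :=
  morphim_repr (subg_repr rV (subsetT (sdpair2 to @* S)%g)) (subxx S).

End SemidirectProduct.
End BrauerCharacters.

Section PointedGroups.

Variables (F : fieldType) (p : nat) (gT : finGroupType) (G : {group gT}).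
Local Notation FG := (group_ring F G).
Local Notation aG := (regular_repr F G).
Implicit Types (A B e i j : 'M[F]_#|G|) (U W P Q : {group gT}).
Implicit Types mu omega : set 'M[F]_#|G|.

Definition fixed_elt U A : Prop :=
  (A \in FG)%MS /\ {in U, forall x, aG x *m A *m aG x^-1%g = A}.

Definition fixed_idem U e : Prop := fixed_elt U e /\ e *m e = e.

Definition primitive_idem U e : Prop :=
  [/\ fixed_idem U e, e != 0 &
      forall e1 e2, fixed_idem U e1 -> fixed_idem U e2 ->
        e1 *m e2 = 0 -> e2 *m e1 = 0 -> e = e1 + e2 -> e1 = 0 \/ e2 = 0].

Definition fixed_conj U e e' : Prop :=
  exists A B, [/\ fixed_elt U A, fixed_elt U B, A *m B = 1%:M, B *m A = 1%:M &
                  e' = A *m e *m B].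

Definition is_point U mu : Prop :=
  exists2 i, primitive_idem U i & mu = fixed_conj U i.

Definition pointed_group U mu : Prop := U \subset G /\ is_point U mu.

Definition pointed_pgroup U mu : Prop := pointed_group U mu /\ p.-group U.

Definition point_mult mu : nat :=
  nat_max (fun k => exists s : seq 'M[F]_#|G|,
    [/\ uniq s, size s = k, {in s, forall i, mu i} &
        {in s &, forall i j, i != j -> i *m j = 0}]).

Definition pointed_le W omega U mu : Prop :=
  W \subset U /\
  exists i j, [/\ mu i, omega j, i *m j = j & j *m i = j].

Definition brauer_map P A : 'M[F]_#|G| :=
  \sum_(x in 'C_G(P)) gring_row A 0 (gring_index G x) *: aG x.

Definition local_pointed_group P gamma : Prop :=
  pointed_pgroup P gamma /\ forall i, gamma i -> brauer_map P i != 0.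

Definition maximal_local_below Q delta P alpha : Prop :=
  [/\ local_pointed_group Q delta, pointed_le Q delta P alpha &
      forall R epsilon, local_pointed_group R epsilon ->
        pointed_le R epsilon P alpha -> pointed_le Q delta R epsilon ->
        R = Q /\ epsilon = delta].

(* FC as a subalgebra of FG. *)
Definition sub_group_ring (C : {group gT}) (sCG : C \subset G) :=
  enveloping_algebra_mx (subg_repr aG sCG).

(* The module rE is isomorphic to the left ideal FC e of FC. *)
Definition left_ideal_rsim (C : {group gT}) (sCG : C \subset G)
    n (rE : mx_representation F C n) e : Prop :=
  exists f : {linear 'cV[F]_n -> 'M[F]_#|G|},
    [/\ injective f,
        {in C, forall x v, f (rE x *m v) = aG x *m f v} &
        forall A, (exists v, f v = A) <->
          (exists2 B, (B \in sub_group_ring sCG)%MS & A = B *m e)].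

End PointedGroups.

Section Pieces.

Variables (F : closedFieldType) (p : nat) (lam : root_lift F).
Variables (gT : finGroupType) (G : {group gT}).

Record piece := Piece {
  piece_group : {group gT};
  piece_char : {ffun gT -> algC};
  piece_sub : piece_group \subset G;
  piece_pgroup : p.-group piece_group;
  piece_irr : irr_brauer p lam 'C_G(piece_group)%G piece_char }.

(* Puig's bijection between local pointed groups and pieces. *)
Definition piece_of_local (P : {group gT}) (gamma : set 'M[F]_#|G|)
    (T : piece) : Prop :=
  [/\ local_pointed_group p P gamma, piece_group T = P &
      forall i, gamma i ->
        left_ideal_rsim (subsetIl G 'C(piece_group T))
          (proj_module p lam 'C_G(piece_group T)%G (piece_char T))
          (brauer_map (piece_group T) i)].

Definition conj_char (phi : {ffun gT -> algC}) (x : gT) : {ffun gT -> algC} :=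
  [ffun c => phi (c ^ x^-1)%g].

(* The pairs (P, Q_phi) whose classes are the generalized pieces. *)
Record piece_pair := PiecePair {
  pair_group : {group gT};
  pair_piece : piece;
  pair_sub : pair_group \subset G;
  pair_pgroup : p.-group pair_group;
  pair_le : piece_group pair_piece \subset pair_group }.

Definition piece_pair_equiv (r r' : piece_pair) : Prop :=
  pair_group r = pair_group r' /\
  exists x, [/\ x \in pair_group r,
    piece_group (pair_piece r') :=: (piece_group (pair_piece r) :^ x)%g &
    piece_char (pair_piece r') = conj_char (piece_char (pair_piece r)) x].

Record gen_piece := GenPiece {
  gp_pairs : set piece_pair;
  gp_class : exists r, gp_pairs = piece_pair_equiv r }.

Section PairMultiplicity.

Variable r : piece_pair.
Local Notation P := (pair_group r).
Local Notation Q := (piece_group (pair_piece r)).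
Local Notation Pbar := ('N_P(Q) / Q)%G.

Lemma acts_Pbar : {acts 'N_P(Q) / Q, on group 'C_G(Q) | 'J %% Q}%act.
Proof.
split; last by rewrite gacentJ subsetIr.
rewrite astabs_mod; last by rewrite astabJ centsC subsetIr.
rewrite quotientS // astabsJ normsI ?norms_cent ?subsetIr //.
by rewrite subIset // (subset_trans (pair_sub r)) ?normG.
Qed.

Definition Pbar_act : groupAction Pbar 'C_G(Q) := (<[acts_Pbar]>)%gact.

Definition pair_mult : nat :=
  summand_mult (Representation (regular_repr F Pbar))
    (Representation (sdprod_res
       (simple_module p lam (sdprod_group Pbar_act)
          (sdprod_brauer p lam Pbar_act (piece_char (pair_piece r)))))).

End PairMultiplicity.

(* The common value of pair_mult on the class. *)
Definition gp_mult (X : gen_piece) : nat :=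
  xget 0%N (fun m => exists2 r, gp_pairs X r & pair_mult r = m).

Definition substantive (X : gen_piece) : Prop := gp_mult X != 0%N.

Definition corresponding (P : {group gT}) (alpha : set 'M[F]_#|G|)
    (X : gen_piece) : Prop :=
  exists r delta, [/\ gp_pairs X r, pair_group r = P,
    piece_of_local (piece_group (pair_piece r)) delta (pair_piece r) &
    maximal_local_below p (piece_group (pair_piece r)) delta P alpha].

End Pieces.

(* Main.v *)
(* Put Pbar = N_P(Q)/Q, let V be the simple module of phi extended by Pbar, and
   N the sum of the elements of Pbar acting on V.  The free summands of V over
   the p-group Pbar are split off one at a time, so their number is the rank of
   N, i.e. the dimension of NV.  The algebra (FG)^P acts on NV through the Brauer
   map at Q, which sends the relative trace of a from Q to P to the sum of the
   Pbar-conjugates of br(a); on a vector w of NV this sum acts as N br(a), and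
   FC_G(Q) w = V since w is fixed by Pbar and V is simple.  Hence NV is a simple
   (FG)^P-module, and its dimension is the multiplicity of the point acting
   nontrivially on it.  That point is alpha: maximality of Q_delta makes i in
   alpha a relative trace from Q (the vertex argument), so a Pbar-fixed vector
   in the row space of br(i) is a multiple of N.

   The generalized piece may be represented by another pair than the one giving
   the correspondence; its simple modules are then identified through their
   Brauer characters, which determine all traces, hence the simple module. *)

(* The simple modules, projective covers and extended characters of the definitions are classical
   choices with zero defaults, so their existence must be extracted from the hypotheses. The
   correspondence yields a cover of V(phi), since it identifies E(phi) with a left ideal generated
   by br(j) <> 0 for j in delta; substantivity yields the simple module of the semidirect product,
   since the zero module has multiplicity 0.

   The correspondence speaks of E(phi) over FC_G(Q), the multiplicity of a simple module V(xi) over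
   the semidirect product. The link is Ind E(phi) = E(xi): reciprocity gives a nonzero map E(phi) ->
   V(xi), whose kernel lies in that of E(phi) -> V(phi), so br(i) is nonzero on V(xi) once it is
   nonzero on V(phi).

   Radicals are replaced by nilpotence. Fitting's lemma makes each element of the corner of a
   primitive idempotent nilpotent or invertible, and simplicity of a module is exploited by
   producing an element that fixes a nonzero vector and so is not nilpotent. *)
From HB Require Import structures.
Require Import Defs.
From mathcomp Require Import boolp classical_sets.
From mathcomp Require Import all_boot all_order all_algebra.
From mathcomp Require Import all_fingroup all_solvable all_field all_character.

Set Implicit Arguments.
Unset Strict Implicit.
Unset Printing Implicit Defensive.

Import GRing.Theory.
Local Open Scope group_scope.
Local Open Scope ring_scope.

(** * Idempotents of matrix subalgebras *)

Section MatrixSubalgebras.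

Variables (F : fieldType) (n : nat).
Implicit Types (D : 'M[F]_n -> Prop) (x y e i : 'M[F]_n).

(** Subalgebras are [Prop] predicates because [fixed_elt U] is one: at [D := fixed_elt U], the
    notions [sub_idem], [sub_primitive] and [sub_conj] are convertible to [fixed_idem],
    [primitive_idem] and [fixed_conj]. *)
Record mx_subalg D : Prop := MxSubalg {
  subalg1 : D 1;
  subalgL : forall a x y, D x -> D y -> D (a *: x + y);
  subalgM : forall x y, D x -> D y -> D (x * y) }.

Definition sub_idem D e : Prop := D e /\ e * e = e.

Definition sub_primitive D e : Prop :=
  [/\ sub_idem D e, e != 0 &
      forall e1 e2, sub_idem D e1 -> sub_idem D e2 ->
        e1 * e2 = 0 -> e2 * e1 = 0 -> e = e1 + e2 -> e1 = 0 \/ e2 = 0].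

Definition sub_conj D e e' : Prop :=
  exists A B, [/\ D A, D B, A * B = 1, B * A = 1 & e' = A * e * B].

Definition sub_corner D i x : Prop := [/\ D x, i * x = x & x * i = x].

Definition mx_nilp x : Prop := exists k, x ^+ k.+1 = 0.

Section Closure.

Variable D : 'M[F]_n -> Prop.
Hypothesis algD : mx_subalg D.

Lemma subalg0 : D 0.
Proof.
have := subalgL algD (-1) (subalg1 algD) (subalg1 algD).
by rewrite scaleN1r addNr.
Qed.

Lemma subalgZ a x : D x -> D (a *: x).
Proof. by move=> Dx; rewrite -[_ *: _]addr0; apply: subalgL algD _ _ _ Dx subalg0. Qed.

Lemma subalgD x y : D x -> D y -> D (x + y).
Proof. by move=> Dx Dy; rewrite -[x]scale1r; apply: subalgL. Qed.

Lemma subalgN x : D x -> D (- x).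
Proof. by move=> Dx; rewrite -scaleN1r; apply: subalgZ. Qed.

Lemma subalgB x y : D x -> D y -> D (x - y).
Proof. by move=> Dx Dy; apply: subalgD => //; apply: subalgN. Qed.

Lemma subalgX x k : D x -> D (x ^+ k).
Proof.
move=> Dx; elim: k => [|k IHk]; first by rewrite expr0; apply: subalg1.
by rewrite exprS; apply: subalgM.
Qed.

Lemma subalg_sum (I : Type) (r : seq I) (P : pred I) (E : I -> 'M[F]_n) :
  (forall k, P k -> D (E k)) -> D (\sum_(k <- r | P k) E k).
Proof. by move=> DE; apply: (big_ind D); [apply: subalg0 | apply: subalgD | ]. Qed.

Lemma sub_corner_mul i x y : sub_corner D i x -> sub_corner D i y ->
  sub_corner D i (x * y).
Proof.
move=> [Dx ix xi] [Dy iy yi]; split; first exact: subalgM.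
  by rewrite mulrA ix.
by rewrite -mulrA yi.
Qed.

Lemma sub_corner_add i x y : sub_corner D i x -> sub_corner D i y ->
  sub_corner D i (x + y).
Proof.
move=> [Dx ix xi] [Dy iy yi]; split; first exact: subalgD.
  by rewrite mulrDr ix iy.
by rewrite mulrDl xi yi.
Qed.

Lemma sub_corner_sandwich i x : sub_idem D i -> D x -> sub_corner D i (i * x * i).
Proof.
move=> [Di ii] Dx; split; first by do !apply: subalgM.
  by rewrite !mulrA ii.
by rewrite -!mulrA ii.
Qed.

End Closure.
End MatrixSubalgebras.

(* Cayley-Hamilton reads x^m q(x) = 0 with q(0) <> 0, and g is -(q - q(0))/(q(0) X) at x. *)
Lemma subalg_fitting (F : fieldType) n (D : 'M[F]_n -> Prop) (x : 'M[F]_n) :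
  mx_subalg D -> D x -> exists k g, [/\ D g, forall y, x * y = y * x -> g * y = y * g &
    x ^+ k.+1 = x ^+ k.+2 * g].
Proof.
case: n D x => [|n'] D x algD Dx.
  exists 0, 0; split; first exact: subalg0.
    by move=> y _; rewrite mulr0 mul0r.
  by apply/matrixP => -[].
have p_nz := monic_neq0 (char_poly_monic x).
have [m [q q0 def_p]] := multiplicity_XsubC (char_poly x) 0.
rewrite p_nz /= in q0; rewrite subr0 in def_p.
have hD (f : {poly F}) : D (horner_mx x f).
  elim/poly_ind: f => [|f c IHf]; first by rewrite rmorph0; apply: subalg0.
  rewrite rmorphD rmorphM /= horner_mx_X horner_mx_C.
  apply: subalgD => //; first exact: subalgM.
  by rewrite -scalemx1; apply: subalgZ => //; apply: subalg1.
have hC (f : {poly F}) y : x * y = y * x -> horner_mx x f * y = y * horner_mx x f.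
  move=> xy; elim/poly_ind: f => [|f c IHf]; first by rewrite rmorph0 mul0r mulr0.
  rewrite rmorphD rmorphM /= horner_mx_X horner_mx_C mulrDl mulrDr -mulrA xy.
  rewrite !mulrA IHf; congr (_ + _).
  by rewrite -!mulmxE scalar_mxC.
have [g [c [c0 def_q]]]: exists g c, c != 0 /\ q = g * 'X + c%:P.
  elim/poly_ind: q q0 {def_p} => [|g c _]; first by rewrite root0.
  rewrite rootE hornerD hornerM hornerX mulr0 add0r hornerC => c0.
  by exists g, c.
exists m, (horner_mx x (- c^-1 *: g)); split=> //; first exact: hC.
have := Cayley_Hamilton x; rewrite def_p def_q rmorphM rmorphD rmorphM /=.
rewrite rmorphXn /= horner_mx_X horner_mx_C linearZ /= scaleNr.
set h := horner_mx x g; have xh : h * x = x * h by apply: hC.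
have hX k : h * x ^+ k = x ^+ k * h by apply/commrX.
rewrite mulrDl -mulrA -exprS hX -[_%:M * _]/(_%:M *m _) mul_scalar_mx => /eqP.
rewrite addrC addr_eq0 => /eqP e0; apply: (scalerI c0).
rewrite mulrN -scalerAr scalerN scalerA divff // scale1r.
by rewrite exprS scalerAr e0 mulrN mulrA -exprS.
Qed.

(** * Corners of primitive idempotents are local *)

Section PrimitiveIdempotents.

Variables (F : fieldType) (n : nat) (D : 'M[F]_n -> Prop).
Hypothesis algD : mx_subalg D.
Implicit Types (x y z e i j s t : 'M[F]_n).

Lemma primitive_sub_eq i e : sub_primitive D i -> sub_corner D i e ->
  e * e = e -> e = 0 \/ e = i.
Proof.
move=> [[Di ii] _ prim_i] [De ie ei] ee.
suffices [|/eqP] : e = 0 \/ i - e = 0; first by left.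
  by rewrite subr_eq0 => /eqP; right.
apply: prim_i; first by [].
- split; first exact: subalgB.
  by rewrite mulrBl !mulrBr ii ie ei ee subrr subr0.
- by rewrite mulrBr ei ee subrr.
- by rewrite mulrBl ie ee subrr.
by rewrite addrC subrK.
Qed.

(** With g from Fitting's lemma and y = x g, the power y^(k+1) is an idempotent of the corner, hence
    0 or i. In the first case x^(k+1) = 0; in the second, i g y^k is inverse to x. *)
Lemma primitive_local i x : sub_primitive D i -> sub_corner D i x ->
  mx_nilp x \/ exists2 y, sub_corner D i y & x * y = i /\ y * x = i.
Proof.
move=> prim_i [Dx ix xi]; have [[Di ii] _ _] := prim_i.
have [k [g [Dg cg def_x]]] := subalg_fitting algD Dx.
have xg : g * x = x * g by apply: cg.
have gi : g * i = i * g by apply: cg; rewrite ix xi.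
pose y := x * g; pose E := y ^+ k.+1.
have xE : x ^+ k.+1 * y = x ^+ k.+1 by rewrite mulrA -exprSr -def_x.
have xEj l : x ^+ k.+1 * y ^+ l = x ^+ k.+1.
  by elim: l => [|l IHl]; rewrite ?mulr1 // (exprSr y) mulrA IHl.
have defE : E = g ^+ k.+1 * x ^+ k.+1 by rewrite /E /y -xg exprMn_comm //.
have EE : E * E = E by rewrite {1}defE -mulrA xEj -defE.
have yi : y * i = y by rewrite -mulrA gi mulrA xi.
have iy : i * y = y by rewrite mulrA ix.
have iE : i * E = E by rewrite /E exprS mulrA iy.
have Ei : E * i = E by rewrite /E exprSr -mulrA yi.
have DE : D E by apply: subalgX => //; apply: subalgM.
have [E0|Ei'] := primitive_sub_eq prim_i (And3 DE iE Ei) EE.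
  by left; exists k; rewrite -(xEj k.+1) -/E E0 mulr0.
have xy : x * y = y * x by rewrite /y -[RHS]mulrA xg.
right; exists (i * (g * y ^+ k)); last split.
- have yki : y ^+ k * i = i * y ^+ k.
    by apply/commr_sym/commrX; rewrite /GRing.comm iy yi.
  split; first by do !apply: subalgM => //; apply: subalgX => //; apply: subalgM.
    by rewrite mulrA ii.
  by rewrite -!mulrA yki [g * _]mulrA gi !mulrA ii.
- by rewrite mulrA xi mulrA -exprS -Ei'.
rewrite -[RHS]Ei' -mulrA -iE; congr (_ * _); rewrite -mulrA.
have -> : y ^+ k * x = x * y ^+ k by apply/commr_sym/commrX.
by rewrite mulrA xg -exprS.
Qed.

Lemma idem_nilpF e : e * e = e -> mx_nilp e -> e = 0.
Proof.
move=> ee [k]; have -> : e ^+ k.+1 = e by elim: k => [|k IHk]; rewrite ?expr1 // exprS IHk.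
by [].
Qed.

Lemma nilp_rinvF i x y : x * i = x -> i != 0 ->
  x * y = i -> ~ mx_nilp x.
Proof.
move=> xi i0 xy [k]; elim: k => [|k IHk].
  by rewrite expr1 => x0; case/eqP: i0; rewrite -xy x0 mul0r.
move=> xk0; apply: IHk.
have -> : x ^+ k.+1 = x ^+ k.+2 * y.
  by rewrite (exprSr x k.+1) -mulrA xy (exprSr x k) -mulrA xi.
by rewrite xk0 mul0r.
Qed.

Lemma nilp_linvF i x y : i * x = x -> i != 0 -> y * x = i -> ~ mx_nilp x.
Proof.
move=> ix i0 yx [k]; elim: k => [|k IHk].
  by rewrite expr1 => x0; case/eqP: i0; rewrite -yx x0 mulr0.
move=> xk0; apply: IHk; have -> : x ^+ k.+1 = y * x ^+ k.+2.
  by rewrite (exprS x k.+1) mulrA yx (exprS x k) mulrA ix.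
by rewrite xk0 mulr0.
Qed.

End PrimitiveIdempotents.

Section PrimitiveDecompositions.

Variables (F : fieldType) (n : nat) (D : 'M[F]_n -> Prop).
Hypothesis algD : mx_subalg D.
Implicit Types (x y z e i j s t : 'M[F]_n).

(** If x + y had an inverse z in the corner, then a = x z and i - a = y z would both be nilpotent,
    which is impossible for commuting elements with nonzero idempotent sum. *)
Lemma primitive_nilp_add i x y : sub_primitive D i ->
  sub_corner D i x -> sub_corner D i y -> mx_nilp x -> mx_nilp y ->
  mx_nilp (x + y).
Proof.
move=> prim_i cx cy nx ny.
have [[Di ii] i0 _] := prim_i.
have nilpR u z : sub_corner D i u -> sub_corner D i z -> mx_nilp u -> mx_nilp (u * z).
  move=> cu cz nu; have [] // := primitive_local algD prim_i (sub_corner_mul algD cu cz).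
  case=> w _ [uzw _]; have [_ _ ui] := cu.
  by rewrite -mulrA in uzw; case: (nilp_rinvF ui i0 uzw nu).
have [//|[z cz [xyz _]]] :=
  primitive_local algD prim_i (sub_corner_add algD cx cy).
have [k] := nilpR _ _ cx cz nx; have := nilpR _ _ cy cz ny.
rewrite mulrDl in xyz; have [_ _ xzi] := sub_corner_mul algD cx cz.
move: (x * z) (y * z) xyz xzi => a b /eqP; rewrite addrC eq_sym -subr_eq.
move/eqP=> <- ai [m bm] ak; case/eqP: i0.
(* Descent on the exponent: if a^(k+2) = 0 then a^(k+1) (i - a) = a^(k+1), and iterating up to the
   vanishing power of i - a gives a^(k+1) = 0. At a = 0 the idempotent i itself is nilpotent. *)
elim: k ak => [|k IHk] ak.
  by apply: idem_nilpF => //; exists m; move: ak bm; rewrite expr1 => ->; rewrite subr0.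
apply: IHk; rewrite -(mulr0 (a ^+ k.+1)) -bm.
elim: m.+1 => [|l IHl]; first by rewrite mulr1.
by rewrite (exprS (i - a)) mulrA mulrBr -exprSr ak subr0 exprSr -(mulrA _ a i) ai -exprSr.
Qed.

(** This plays the role of Rosenberg's lemma: the nilpotent elements of a local corner are closed
    under sums. *)
Lemma primitive_sum_nilp i (I : Type) (r : seq I) (P : pred I) (E : I -> 'M[F]_n) :
    sub_primitive D i -> (forall k, P k -> sub_corner D i (E k)) ->
    ~ mx_nilp (\sum_(k <- r | P k) E k) ->
  exists2 k, P k & ~ mx_nilp (E k).
Proof.
move=> prim_i cE nnE; apply: contrapT => noE; apply: nnE.
have nE k : P k -> mx_nilp (E k).
  by move=> Pk; apply: contrapT => nEk; apply: noE; exists k.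
suffices: sub_corner D i (\sum_(k <- r | P k) E k) /\ mx_nilp (\sum_(k <- r | P k) E k).
  by case.
apply: (big_ind (fun x => sub_corner D i x /\ mx_nilp x)).
- split; first by split; rewrite ?mulr0 ?mul0r //; apply: subalg0.
  by exists 0%N; rewrite expr1.
- move=> x y [cx nx] [cy ny]; split; first exact: sub_corner_add.
  exact: primitive_nilp_add prim_i _ _ _ _.
- by move=> k Pk; split; [apply: cE | apply: nE].
Qed.

Definition orthogonal_seq (s : seq 'M[F]_n) : Prop :=
  uniq s /\ {in s &, forall x y, x != y -> x * y = 0}.

(** Induction on the rank of e. It drops strictly at both terms of a nontrivial splitting e = f1 +
    f2: equal row spaces would give e = z f1, hence f2 = e f2 = 0. *)
Lemma primitive_decomposition e : sub_idem D e ->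
  exists s : seq 'M[F]_n, [/\ orthogonal_seq s, {in s, forall x, sub_primitive D x},
    {in s, forall x, e * x = x /\ x * e = x} & e = \sum_(x <- s) x].
Proof.
have [m] := ubnP (\rank e); elim: m e => // m IHm e le_e_m [De ee].
have [->|e0] := eqVneq e 0; first by exists [::]; rewrite big_nil.
have [prim_e|] := pselect (sub_primitive D e).
  exists [:: e]; rewrite big_seq1; split=> // [|x|x]; last 2 first.
  - by rewrite mem_seq1 => /eqP->.
  - by rewrite mem_seq1 => /eqP->.
  by split=> // x y; rewrite !mem_seq1 => /eqP-> /eqP->; rewrite eqxx.
move=> not_prim.
have [e1 [e2 [ie1 ie2 e12 e21 [def_e nz1 nz2]]]]: exists e1 e2, [/\ sub_idem D e1,
    sub_idem D e2, e1 * e2 = 0, e2 * e1 = 0 & [/\ e = e1 + e2, e1 <> 0 & e2 <> 0]].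
  apply: contrapT => no12; apply: not_prim; split=> // e1 e2 i1 i2 o12 o21 def_e.
  apply: contrapT => /not_orP[nz1 nz2]; apply: no12.
  by exists e1, e2.
have ltr f1 f2 : sub_idem D f1 -> sub_idem D f2 -> f1 * f2 = 0 -> f2 * f1 = 0 ->
    e = f1 + f2 -> f2 <> 0 -> (\rank f1 < m)%N.
  move=> [_ i1] [_ i2] f12 f21 def_e' nz; rewrite ltnS in le_e_m.
  apply: leq_trans _ le_e_m.
  have sf1e : (f1 <= e)%MS.
    by apply/submxP; exists f1; rewrite -[_ *m _]/(_ * _) def_e' mulrDr i1 f12 addr0.
  rewrite ltn_neqAle mxrankS // andbT; apply/eqP=> eqr.
  have: (e <= f1)%MS by rewrite -(geq_leqif (mxrank_leqif_sup sf1e)) eqr.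
  case/submxP=> z; rewrite -[_ *m _]/(_ * _) => def_z; apply: nz.
  have : e * f2 = 0 by rewrite def_z -mulrA f12 mulr0.
  by rewrite def_e' mulrDl f12 add0r i2.
have [s1 [[u1 o1] p1 c1 d1]] := IHm e1 (ltr _ _ ie1 ie2 e12 e21 def_e nz2) ie1.
rewrite addrC in def_e.
have [s2 [[u2 o2] p2 c2 d2]] := IHm e2 (ltr _ _ ie2 ie1 e21 e12 def_e nz1) ie2.
have o12 x y : x \in s1 -> y \in s2 -> x * y = 0 /\ y * x = 0.
  move=> /c1[x1 x2] /c2[y1 y2]; split.
    by rewrite -x2 -y1 mulrA -(mulrA x) e12 mulr0 mul0r.
  by rewrite -y2 -x1 mulrA -(mulrA y) e21 mulr0 mul0r.
exists (s1 ++ s2); split; last by rewrite big_cat /= -d1 -d2 addrC.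
- split.
    rewrite cat_uniq u1 u2 andbT /=; apply/hasPn=> x s2x; apply/negP=> s1x.
    have [xx _] := o12 _ _ s1x s2x; have [[_ x2] /eqP x0 _] := p1 _ s1x.
    by apply: x0; rewrite -x2.
  move=> x y; rewrite !mem_cat => /orP[] sx /orP[] sy; first exact: o1.
  - by have [] := o12 _ _ sx sy.
  - by have [] := o12 _ _ sy sx.
  - exact: o2.
- by move=> x; rewrite mem_cat => /orP[/p1|/p2].
move=> x; rewrite mem_cat def_e mulrDl mulrDr => /orP[sx|sx].
  have [x1 x2] := c1 _ sx; have -> : e2 * x = 0 by rewrite -x1 mulrA e21 mul0r.
  have -> : x * e2 = 0 by rewrite -x2 -mulrA e12 mulr0.
  by rewrite !add0r.
have [x1 x2] := c2 _ sx; have -> : e1 * x = 0 by rewrite -x1 mulrA e12 mul0r.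
have -> : x * e1 = 0 by rewrite -x2 -mulrA e21 mulr0.
by rewrite !addr0.
Qed.

End PrimitiveDecompositions.

(** * Equivalence and conjugacy of primitive idempotents *)

Section ConjugateIdempotents.

Variables (F : fieldType) (n : nat) (D : 'M[F]_n -> Prop).
Hypothesis algD : mx_subalg D.
Implicit Types (x y z e i j s t : 'M[F]_n).

Lemma mx_nilp_mulC x y : mx_nilp (x * y) -> mx_nilp (y * x).
Proof.
case=> k xyk; exists k.+1.
have yxk l : (y * x) ^+ l.+1 = y * (x * y) ^+ l * x.
  elim: l => [|l IHl]; first by rewrite expr1 mulr1.
  by rewrite exprSr IHl exprSr !mulrA.
by rewrite yxk xyk mulr0 mul0r.
Qed.

Lemma sub_conj_trans e1 e2 e3 : sub_conj D e1 e2 -> sub_conj D e2 e3 ->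
  sub_conj D e1 e3.
Proof.
move=> [A [B [DA DB AB BA ->]]] [A' [B' [DA' DB' AB' BA' ->]]].
exists (A' * A), (B * B'); split; try exact: subalgM.
- by rewrite mulrA -(mulrA A') AB mulr1.
- by rewrite mulrA -(mulrA B) BA' mulr1.
by rewrite !mulrA.
Qed.

(** Fitting's lemma gives u^(k+1) (1 - u g) = 0 with g in D; cancelling the powers of u makes g the
    inverse, which therefore stays in the subalgebra. *)
Lemma subalg_inverse u : D u -> (forall m : 'M[F]_n, u * m = 0 -> m = 0) ->
  exists v, [/\ D v, u * v = 1 & v * u = 1].
Proof.
move=> Du inj_u; have [k [g [Dg cg def_u]]] := subalg_fitting algD Du.
exists g; have ug : u * g = 1.
  apply/esym/subr0_eq; have: u ^+ k.+1 * (1 - u * g) = 0.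
    by rewrite mulrBr mulr1 mulrA -exprSr -def_u subrr.
  elim: k.+1 => [|l IHl]; first by rewrite mul1r.
  by rewrite exprS -mulrA => /inj_u.
by split=> //; rewrite cg.
Qed.

(** The idempotents i = s t and t s are equivalent, and x |-> s x t carries a splitting of t s to
    one of i, with x |-> t x s as the way back. *)
Lemma equiv_primitive i s t : sub_primitive D i -> D s -> D t ->
  i * s = s -> t * i = t -> s * t = i -> sub_primitive D (t * s).
Proof.
move=> [[Di ii] i0 prim_i] Ds Dt si ti st.
split.
- by split; [apply: subalgM | rewrite mulrA -(mulrA t s) st ti].
- apply: contra_neq i0 => ts0.
  by rewrite -ii -st mulrA -(mulrA s) ts0 mulr0 mul0r.
move=> e1 e2 [De1 i1] [De2 i2] e12 e21 def_e.
have e1E : e1 = t * (s * e1 * t) * s.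
  transitivity (t * s * e1 * (t * s)); last by rewrite !mulrA.
  by rewrite def_e mulrDl i1 e21 addr0 mulrDr i1 e12 addr0.
have e2E : e2 = t * (s * e2 * t) * s.
  transitivity (t * s * e2 * (t * s)); last by rewrite !mulrA.
  by rewrite def_e mulrDl i2 e12 add0r mulrDr i2 e21 add0r.
have mulE f1 f2 : s * f1 * t * (s * f2 * t) = s * (f1 * (t * s) * f2) * t.
  by rewrite !mulrA.
suffices [z0|z0] : s * e1 * t = 0 \/ s * e2 * t = 0.
- by left; rewrite e1E z0 mulr0 mul0r.
- by right; rewrite e2E z0 mulr0 mul0r.
apply: prim_i.
- split; first by do !apply: subalgM => //.
  by rewrite mulE def_e mulrDr i1 e12 addr0 i1.
- split; first by do !apply: subalgM => //.
  by rewrite mulE def_e mulrDr i2 e21 add0r i2.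
- by rewrite mulE def_e mulrDr i1 e12 addr0 e12 mulr0 mul0r.
- by rewrite mulE def_e mulrDr i2 e21 add0r e21 mulr0 mul0r.
by rewrite -mulrDl -mulrDr -def_e mulrA st -mulrA st ii.
Qed.

(** The conjugating element is u = e i + (1 - e)(1 - i), for which e u = e i = u i. It is injective
    because i e i and e i e, not being nilpotent, are invertible in their local corners. *)
Lemma primitive_conj_overlap i e : sub_primitive D i -> sub_primitive D e ->
  ~ mx_nilp (i * e * i) -> sub_conj D i e.
Proof.
move=> prim_i prim_e nn_iei.
have [[[Di ii] _ _] [[De ee] _ _]] := (prim_i, prim_e).
have nn_eie : ~ mx_nilp (e * i * e).
  move=> n_eie; apply: nn_iei; rewrite -ee mulrA -mulrA; apply: mx_nilp_mulC.
  by rewrite mulrA -(mulrA e) ii.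
have [//|[z cz [_ ziei]]] :=
  primitive_local algD prim_i (sub_corner_sandwich algD (conj Di ii) De).
have [//|[z' cz' [_ zeie]]] :=
  primitive_local algD prim_e (sub_corner_sandwich algD (conj De ee) Di).
pose u := e * i + (1 - e) * (1 - i).
have Du : D u.
  apply: subalgD => //; first exact: subalgM.
  by apply: subalgM => //; apply: subalgB => //; apply: subalg1.
have eu : e * u = e * i.
  by rewrite mulrDr !mulrA ee (mulrBr e) mulr1 ee subrr mul0r addr0.
have ui : u * i = e * i.
  by rewrite mulrDl -!mulrA ii (mulrBl i) mul1r ii subrr mulr0 addr0.
have [m um0|v [Dv uv vu]] := subalg_inverse Du; last first.
  by exists u, v; split=> //; rewrite ui -eu -mulrA uv mulr1.
have eim : e * i * m = 0 by rewrite -eu -mulrA um0 mulr0.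
have im : i * m = 0.
  by rewrite -ziei -!mulrA (mulrA e) eim !mulr0.
have em : m = e * m.
  apply/subr0_eq; rewrite -{1}[m]mul1r -mulrBl.
  have im' : (1 - i) * m = m by rewrite mulrBl mul1r im subr0.
  by move: um0; rewrite /u mulrDl eim add0r -mulrA im'.
by rewrite em -zeie -mulrA -(mulrA (e * i)) -em eim mulr0.
Qed.

(** For orthogonal equivalent idempotents, w = a + b + (1 - i - e) is an involution that swaps i and
    e and fixes the complement. *)
Lemma orthogonal_equiv_conj i e a b : D i -> D e -> D a -> D b ->
  i * e = 0 -> e * i = 0 -> i * a = a -> a * e = a -> e * b = b -> b * i = b ->
  a * b = i -> b * a = e -> sub_conj D i e.
Proof.
move=> Di De Da Db ie ei ia ae eb bi ab ba.
pose w := a + b + (1 - i - e).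
have Dw : D w.
  apply: subalgD; rewrite //; first exact: subalgD.
  by do !apply: subalgB => //; apply: subalg1.
have aa : a * a = 0 by rewrite -{1}ae -ia -mulrA (mulrA e) ei mul0r mulr0.
have bb : b * b = 0 by rewrite -{1}bi -eb -mulrA (mulrA i) ie mul0r mulr0.
have ai : a * i = 0 by rewrite -ae -mulrA ei mulr0.
have be : b * e = 0 by rewrite -bi -mulrA ie mulr0.
have ea : e * a = 0 by rewrite -ia mulrA ei mul0r.
have ib : i * b = 0 by rewrite -eb mulrA ie mul0r.
have ii : i * i = i by rewrite -{1}ab -mulrA bi ab.
have ee : e * e = e by rewrite -{1}ba -mulrA ae ba.
have wi : w * i = b.
  by rewrite !mulrDl !mulNr mul1r ai bi ii ei subrr add0r subr0 addr0.
have ew : e * w = b.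
  by rewrite !mulrDr !mulrN mulr1 ea eb ei ee subr0 subrr add0r addr0.
have ww : w * w = 1.
  rewrite {2}/w !mulrDr !mulrN mulr1 wi.
  have -> : w * e = a by rewrite !mulrDl !mulNr mul1r ae be ie ee subr0 subrr !addr0.
  have -> : w * a = e by rewrite !mulrDl !mulNr mul1r aa ba ia ea subrr subr0 add0r addr0.
  have -> : w * b = i by rewrite !mulrDl !mulNr mul1r ab bb ib eb subr0 subrr !addr0.
  have -> : w - b - a = 1 - i - e.
    by rewrite /w -(addrA _ (- b)) -opprD (addrC b) (addrC _ (1 - i - e)) addrK.
  by rewrite [LHS]addrC addrA subrK subrK.
by exists w, w; split=> //; rewrite wi -ew -mulrA ww mulr1.
Qed.

(** If i e i is nilpotent, locality makes i (1 - e) i invertible in the corner of i. This produces a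
    primitive idempotent t' s' below 1 - e that is equivalent to i and overlaps it. It is thus
    conjugate to i, and, being orthogonal and equivalent to e, it is conjugate to e by a swap. *)
Lemma equiv_conj i s t : sub_primitive D i -> D s -> D t ->
  i * s = s -> t * i = t -> s * t = i -> sub_conj D i (t * s).
Proof.
move=> prim_i Ds Dt si ti st; set e := t * s.
have [[Di ii] _ _] := prim_i.
have prim_e : sub_primitive D e := equiv_primitive prim_i Ds Dt si ti st.
have [[De ee] _ _] := prim_e.
have [n_iei|] := pselect (mx_nilp (i * e * i)); last exact: primitive_conj_overlap.
have De' : D (1 - e) by apply: subalgB => //; apply: subalg1.
have ee' : (1 - e) * (1 - e) = 1 - e.
  by rewrite mulrBr mulr1 mulrBl mul1r ee subrr subr0.
have e'e : (1 - e) * e = 0 by rewrite mulrBl mul1r ee subrr.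
have ee'0 : e * (1 - e) = 0 by rewrite mulrBr mulr1 ee subrr.
have c_ie'i : sub_corner D i (i * (1 - e) * i) by apply: sub_corner_sandwich.
have [n_ie'i|[z [Dz iz zi] [iz1 _]]] := primitive_local algD prim_i c_ie'i.
  have := primitive_nilp_add algD prim_i (sub_corner_sandwich algD (conj Di ii) De)
    c_ie'i n_iei n_ie'i.
  rewrite -mulrDl -mulrDr addrC subrK mulr1 ii => /(idem_nilpF ii) i0.
  by case: prim_i => _; rewrite i0 eqxx.
pose s' := i * (1 - e); pose t' := (1 - e) * z.
have Ds' : D s' by apply: subalgM.
have Dt' : D t' by apply: subalgM.
have si' : i * s' = s' by rewrite mulrA ii.
have ti' : t' * i = t' by rewrite -mulrA zi.
have st' : s' * t' = i by rewrite mulrA -(mulrA i) ee' -{1}iz mulrA iz1.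
have prim_i' := equiv_primitive prim_i Ds' Dt' si' ti' st'.
have ii' : sub_conj D i (t' * s').
  apply: primitive_conj_overlap => //.
  have -> : i * (t' * s') * i = i * (1 - e) * i.
    transitivity (i * (1 - e) * i * z * (i * (1 - e)) * i).
      by rewrite /s' /t' -[in LHS]iz !mulrA.
    by rewrite iz1 mulrA ii.
  move=> n_ie'i; case: (nilp_rinvF _ _ iz1 n_ie'i); last by case: prim_i.
  by rewrite -mulrA ii.
apply: sub_conj_trans ii' _; apply: (@orthogonal_equiv_conj _ _ (t' * s) (t * s')).
- by case: prim_i' => [[]].
- by [].
- exact: subalgM.
- exact: subalgM.
- by rewrite /s' -!mulrA e'e !mulr0.
- by rewrite /t' !mulrA ee'0 !mul0r.
- by rewrite mulrA -(mulrA t') st' ti'.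
- by rewrite -mulrA /e (mulrA s) st si.
- by rewrite mulrA /e -(mulrA t) st ti.
- by rewrite -mulrA (mulrA s') st' si'.
- by rewrite mulrA -(mulrA t') st ti'.
by rewrite mulrA -(mulrA t) st' ti.
Qed.

End ConjugateIdempotents.

(** A non-nilpotent i a e b i is invertible in the corner of i, so i factors through e. Composing
    the two factors in the other order gives an idempotent below e that is equivalent to i. *)
Lemma sub_conj_below (F : fieldType) n (D : 'M[F]_n -> Prop) (i e a b : 'M[F]_n) :
    mx_subalg D -> sub_primitive D i -> sub_idem D e -> D a -> D b ->
    ~ mx_nilp (i * a * e * b * i) ->
  exists j, [/\ sub_conj D i j, e * j = j & j * e = j].
Proof.
move=> algD prim_i [De ee] Da Db; have [[Di ii] _ _] := prim_i.
rewrite -!(mulrA i) => nn; have Dx : D (a * (e * b)) by do !apply: subalgM.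
rewrite mulrA in nn; rewrite -(mulrA a) in nn.
have [//|[y [Dy iy yi] [xy _]]] :=
  primitive_local algD prim_i (sub_corner_sandwich algD (conj Di ii) Dx).
exists ((e * b * i * y) * (i * a * e)); split.
- apply: equiv_conj => //; try by do !apply: subalgM.
  + by rewrite !mulrA ii.
  + by rewrite -mulrA yi.
  by rewrite -[RHS]xy -(mulrA (i * a)) !mulrA -(mulrA (i * a) e e) ee.
- by rewrite !mulrA ee.
by rewrite -mulrA -(mulrA (i * a)) ee.
Qed.

(** Replacing N by (1 - E x) N lowers the rank, since E x N <> 0, and leaves E y N unchanged for the
    remaining y. The index type [T] serves to let [E] be a representation applied to orthogonal
    idempotents. *)
Lemma orthogonal_rank (F : fieldType) m (T : eqType) (s : seq T) (E : T -> 'M[F]_m)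
    (N : 'M[F]_m) :
    uniq s -> {in s &, forall x y, x != y -> E x * E y = 0} ->
    {in s, forall x, [/\ E x * E x = E x, E x * N = N * E x & E x * N != 0]} ->
  (size s <= \rank N)%N.
Proof.
elim: s N => //= x s IHs N /andP[s'x Us] orth idE.
have ne y : y \in s -> x != y by move=> sy; apply: contraNneq s'x => ->.
have [xx xN xN0] := idE x (mem_head _ _).
have s_in y : y \in s -> y \in x :: s by rewrite inE orbC => ->.
pose N' := (1 - E x) * N.
have NE : N' = N * (1 - E x) by rewrite /N' mulrBl mulrBr mul1r mulr1 xN.
have sN'N : (N' <= N)%MS by apply/submxP; exists (1 - E x).
have ltr : (\rank N' < \rank N)%N.
  rewrite ltn_neqAle mxrankS // andbT; apply/eqP=> eqr.
  have: (N <= N')%MS by rewrite -(geq_leqif (mxrank_leqif_sup sN'N)) eqr.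
  case/submxP=> z; rewrite -[_ *m _]/(_ * _) => def_N; case/eqP: xN0.
  by rewrite xN def_N NE -!mulrA mulrBl mul1r xx subrr !mulr0.
apply: leq_ltn_trans ltr; apply: IHs => //.
  by move=> y z sy sz; apply: orth; apply: s_in.
move=> y sy; have [yy yN yN0] := idE y (s_in y sy).
have Ey : E y * (1 - E x) = E y.
  by rewrite mulrBr mulr1 (orth _ _ (s_in y sy) (mem_head _ _)) ?subr0 // eq_sym ne.
have yE : (1 - E x) * E y = E y.
  by rewrite mulrBl mul1r (orth _ _ (mem_head _ _) (s_in y sy)) ?subr0 // ne.
split=> //; last by rewrite mulrA Ey.
by rewrite mulrA Ey NE -mulrA yE.
Qed.

(** If no a - c e were nilpotent, all of them would be invertible in the corner, and so would e
    times the product of the a - z over the roots z of the characteristic polynomial. By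
    Cayley-Hamilton that product is 0. *)
Lemma primitive_corner_eigen (F : closedFieldType) n (D : 'M[F]_n -> Prop)
    (e a : 'M[F]_n) : mx_subalg D -> sub_primitive D e -> sub_corner D e a ->
  exists c, mx_nilp (a - c *: e).
Proof.
case: n D e a => [|n'] D e a algD prim_e ca.
  by case: prim_e => _; rewrite [e]flatmx0 eqxx.
have [[De ee] e0 _] := prim_e; have [Da ea ae] := ca.
apply: contrapT => no_c; case/eqP: e0.
have [rs def_p] := closed_field_poly_normal (char_poly a).
have := Cayley_Hamilton a; rewrite def_p (monicP (char_poly_monic a)) scale1r.
have [b _ <-] : exists2 b, True & horner_mx a (\prod_(z <- rs) ('X - z%:P)) * e * b = e.
  elim: rs {def_p} => [|z rs [b _ IHb]].
    by exists 1; rewrite // big_nil rmorph1 mul1r mulr1.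
  have cz : sub_corner D e (a - z *: e).
    split; first by apply: subalgB => //; apply: subalgZ.
      by rewrite mulrBr ea -scalerAr ee.
    by rewrite mulrBl ae -scalerAl ee.
  have [nz|[y [Dy ey ye] [xy _]]] := primitive_local algD prim_e cz.
    by case: no_c; exists z.
  exists (y * b) => //; rewrite big_cons mulrC rmorphM rmorphB /= horner_mx_X horner_mx_C.
  have ze : (a - z%:M) * e = e * (a - z *: e).
    by rewrite mulrBl mulrBr ae ea -scalerAr ee -[_ * e]/(_ *m _) mul_scalar_mx.
  by rewrite -(mulrA _ _ e) ze !mulrA -(mulrA _ _ y) xy -(mulrA _ e e) ee.
by move=> ->; rewrite !mul0r.
Qed.

(** * The multiplicity of a point read off a simple module *)

Section SimpleImage.

Variables (F : closedFieldType) (n : nat) (D : 'M[F]_n -> Prop).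
Hypothesis algD : mx_subalg D.
Variables (m : nat) (rho : {linear 'M[F]_n -> 'M[F]_m}) (N : 'M[F]_m).
Hypotheses (rho1 : rho 1 = 1).
Hypothesis rhoM : forall x y, D x -> D y -> rho (x * y) = rho x * rho y.
Hypothesis rhoN : forall x, D x -> rho x * N = N * rho x.
(* The image of N is a simple module. *)
Hypothesis simpleN : forall w u : 'cV[F]_m, N *m w != 0 ->
  exists2 x, D x & rho x *m (N *m w) = N *m u.
Implicit Types (x y z e i j s t : 'M[F]_n).

Lemma rho_nilpF x k (w : 'cV[F]_m) : D x -> rho x *m w = w -> w != 0 ->
  x ^+ k != 0.
Proof.
move=> Dx xw; apply: contra_neq => xk0.
have: rho (x ^+ k) *m w = w.
  elim: k {xk0} => [|k IHk]; first by rewrite expr0 rho1 mul1mx.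
  by rewrite exprS rhoM //; [rewrite -mulmxA IHk | apply: subalgX].
by rewrite xk0 linear0 mul0mx.
Qed.

Lemma mulmx_colP p q (A : 'M[F]_(p, q)) :
  (forall w : 'cV[F]_q, A *m w = 0) -> A = 0.
Proof.
move=> A0; apply/matrixP=> a b; have /matrixP/(_ a 0) := A0 (delta_mx b 0).
by rewrite -colE !mxE.
Qed.

Lemma mulmx_colPn p q (A : 'M[F]_(p, q)) : A != 0 ->
  exists w : 'cV[F]_q, A *m w != 0.
Proof.
move=> A0; apply: contrapT => noW; case/eqP: A0; apply: mulmx_colP => w.
by apply/eqP; apply: contrapT => /negP Aw; apply: noW; exists w.
Qed.

Lemma rhoNw x (w : 'cV[F]_m) : D x -> rho x *m (N *m w) = N *m (rho x *m w).
Proof. by move=> Dx; rewrite !mulmxA [_ *m N]rhoN. Qed.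

(** Fix w1 <> 0 in e NV. Any vector of e NV is a w1 for some a in the corner of e, and b = a - c e
    is nilpotent for some scalar c. If b w1 <> 0, simplicity gives y with y b w1 = w1, so e y b
    fixes w1 and is invertible in the corner; this gives b a left inverse and contradicts its
    nilpotence. Hence a w1 = c w1. *)
Lemma primitive_rank_le1 e : sub_primitive D e -> (\rank (rho e * N)%R <= 1)%N.
Proof.
move=> prim_e; have [[De ee] e0 _] := prim_e.
have [->|nz] := eqVneq (rho e * N) 0; first by rewrite mxrank0.
have [w nw] := mulmx_colPn nz; set w1 := _ *m w in nw.
have w1N : w1 = N *m (rho e *m w) by rewrite -rhoNw // mulmxA.
suffices: forall u : 'cV_m, exists c : F, (rho e * N) *m u = c *: w1.
  case/boolp.choice=> c cP.
  have -> : rho e * N = w1 *m (\row_b c (delta_mx b 0)).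
    apply/matrixP=> a b; rewrite !mxE big_ord1 !mxE.
    have /matrixP/(_ a 0) := cP (delta_mx b 0).
    by rewrite -colE !mxE mulrC.
  by rewrite (leq_trans (mxrankM_maxr _ _)) ?rank_leq_row.
move=> u; have nw' : N *m (rho e *m w) != 0 by rewrite -w1N.
have [x Dx xw] := simpleN u nw'.
pose a := e * x * e.
have [Da ea ae] : sub_corner D e a by apply: sub_corner_sandwich.
have ew1 : rho e *m w1 = w1.
  by rewrite /w1 mulmxA [rho e *m _]mulrA -rhoM // ee.
have aw : rho a *m w1 = (rho e * N) *m u.
  rewrite /a !rhoM //; last exact: subalgM.
  by rewrite -!mulmxA ew1 {1}w1N xw.
have [c [k bk]] := primitive_corner_eigen algD prim_e (And3 Da ea ae).
set b := a - c *: e in bk.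
have Db : D b by apply: subalgB => //; apply: subalgZ.
exists c; apply/eqP; rewrite -subr_eq0 -aw; apply: contrapT => /negP nw2.
have bw : rho b *m w1 = rho a *m w1 - c *: w1.
  by rewrite /b linearB linearZ /= mulmxBl -scalemxAl ew1.
have rhow2 : rho a *m w1 - c *: w1 = N *m (rho b *m (rho e *m w)).
  by rewrite -bw w1N rhoNw.
rewrite rhow2 in nw2; have [y Dy yw] := simpleN (rho e *m w) nw2.
rewrite -rhow2 -bw -w1N in yw.
have [eb be] : e * b = b /\ b * e = b.
  split; first by rewrite mulrBr ea -mulmxE -scalemxAr mulmxE ee.
  by rewrite mulrBl ae -mulmxE -scalemxAl mulmxE ee.
have ceyb : sub_corner D e (e * y * b).
  by split; [do !apply: subalgM | rewrite !mulrA ee | rewrite -(mulrA _ b e) be].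
have eybw : rho (e * y * b) *m w1 = w1.
  by rewrite !rhoM //; [rewrite -!mulmxA yw ew1 | apply: subalgM].
have [Deyb _ _] := ceyb.
have [[l xl]|[z _ [_ zeyb]]] := primitive_local algD prim_e ceyb.
  by have := rho_nilpF l.+1 Deyb eybw nw; rewrite xl eqxx.
rewrite mulrA in zeyb; have nb : mx_nilp b by exists k.
by case: (nilp_linvF eb e0 zeyb nb).
Qed.

(** Simplicity moves a nonzero vector of i NV into e NV by x and back by y, so i y e x i fixes it
    and is not nilpotent. A conjugate of i then lies below e, and primitivity of e makes the two
    equal. *)
Lemma simple_image_conj i e : sub_primitive D i -> sub_primitive D e ->
  rho i * N != 0 -> rho e * N != 0 -> sub_conj D i e.
Proof.
move=> prim_i prim_e nzi nze.
have [[[Di ii] i0 _] [[De ee] _ _]] := (prim_i, prim_e).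
have [w nw] := mulmx_colPn nzi; have [u nu] := mulmx_colPn nze.
have {}nw : N *m (rho i *m w) != 0 by rewrite -rhoNw // mulmxA.
have {}nu : N *m (rho e *m u) != 0 by rewrite -rhoNw // mulmxA.
have [x Dx xw] := simpleN (rho e *m u) nw.
have [y Dy yu] := simpleN (rho i *m w) nu.
have iv : rho i *m (N *m (rho i *m w)) = N *m (rho i *m w).
  by rewrite rhoNw // (mulmxA (rho i)) mulmxE -rhoM // ii.
have ev : rho e *m (N *m (rho e *m u)) = N *m (rho e *m u).
  by rewrite rhoNw // (mulmxA (rho e)) mulmxE -rhoM // ee.
have Dz : D (i * y * e * x * i) by do !apply: subalgM.
have zv : rho (i * y * e * x * i) *m (N *m (rho i *m w)) = N *m (rho i *m w).
  rewrite !rhoM //; try by do !apply: subalgM.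
  by rewrite -!mulmxE -!mulmxA iv xw ev yu iv.
have [[k zk0]|j [conj_ij ej je]] := sub_conj_below algD prim_i (conj De ee) Dy Dx.
  by have := rho_nilpF k.+1 Dz zv nw; rewrite zk0 eqxx.
suffices <- : j = e by [].
have [A [B [DA DB AB BA def_j]]] := conj_ij.
have Dj : D j by rewrite def_j; do !apply: subalgM.
have jj : j * j = j by rewrite def_j !mulrA -(mulrA _ B A) BA mulr1 -(mulrA A i i) ii.
have [j0|//] := primitive_sub_eq algD prim_e (And3 Dj ej je) jj.
case/eqP: i0; rewrite -[i]mul1r -[1 * i]mulr1 -BA.
by rewrite mulrA -(mulrA B) -(mulrA B) -def_j j0 mulr0 mul0r.
Qed.

(** For the lower bound, decompose 1 into primitive idempotents: those acting nontrivially on NV are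
    all conjugate to i, and each contributes at most 1 to the rank of N. *)
Lemma simple_image_multP i : sub_primitive D i -> rho i * N != 0 ->
  (forall s : seq _, orthogonal_seq s -> {in s, forall x, sub_conj D i x} ->
     (size s <= \rank N)%N) /\
  exists s : seq _, [/\ orthogonal_seq s, {in s, forall x, sub_conj D i x} &
    size s = \rank N].
Proof.
move=> prim_i nzi; have [[Di ii] i0 _] := prim_i.
have le_rank (s : seq _) : orthogonal_seq s -> {in s, forall x, sub_conj D i x} ->
    (size s <= \rank N)%N.
  move=> [Us orth] conj_s.
  have D_s x : x \in s -> D x.
    by case/conj_s=> A [B [DA DB _ _ ->]]; do !apply: subalgM.
  apply: (orthogonal_rank (E := rho)) Us _ _ => [x y sx sy xy|x sx].
    have -> : rho x * rho y = rho (x * y) by rewrite rhoM; [|apply: D_s|apply: D_s].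
    by rewrite (orth x y sx sy xy) linear0.
  have [A [B [DA DB AB BA def_x]]] := conj_s x sx; split; last 2 first.
  - exact/rhoN/D_s.
  - apply: contra_neq nzi => x0; have -> : i = B * x * A.
      by rewrite def_x !mulrA BA mul1r -mulrA BA mulr1.
    have Dx := D_s x sx; rewrite (rhoM (subalgM algD DB Dx) DA) (rhoM DB Dx).
    by rewrite -mulrA rhoN // mulrA -(mulrA (rho B)) x0 mulr0 mul0r.
  rewrite -(rhoM (D_s x sx) (D_s x sx)) def_x; congr (rho _).
  by rewrite !mulrA -(mulrA _ B A) BA mulr1 -(mulrA A i i) ii.
split=> //.
have [s [[Us orth] prim_s comm_s def1]] :=
  primitive_decomposition (@conj (D 1) _ (subalg1 algD) (mulr1 1)).
pose s1 := [seq x <- s | rho x * N != 0].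
have sub_s x : x \in s1 -> x \in s /\ rho x * N != 0 by rewrite mem_filter => /andP[].
exists s1; have orth1 : orthogonal_seq s1.
  split; first exact: filter_uniq.
  by move=> x y /sub_s[sx _] /sub_s[sy _]; apply: orth.
have conj1 : {in s1, forall x, sub_conj D i x}.
  by move=> x /sub_s[/prim_s px nx]; apply: simple_image_conj.
split=> //; apply/eqP; rewrite eqn_leq le_rank //=.
have -> : N = \sum_(x <- s1) rho x * N.
  rewrite -[LHS]mul1r -rho1 def1 linear_sum big_distrl /= big_filter.
  by rewrite [RHS]big_mkcond; apply: eq_bigr => x _; case: eqP => //= ->.
have prim1 x : x \in s1 -> sub_primitive D x by move=> /sub_s[/prim_s].
elim: {sub_s orth1 conj1} s1 prim1 => [|x r IHr] prim_r.
  by rewrite big_nil mxrank0.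
rewrite big_cons (leq_trans (mxrank_add _ _)) // -[(size _)]add1n leq_add //.
  exact/primitive_rank_le1/prim_r/mem_head.
by apply: IHr => y ry; apply: prim_r; rewrite inE ry orbT.
Qed.

End SimpleImage.

(** * Coefficients, the Brauer map and relative traces *)

Section GroupRingCoefficients.

Variables (F : fieldType) (gT : finGroupType) (G : {group gT}).
Local Notation aG := (regular_repr F G).
Local Notation FG := (group_ring F G).
Implicit Types (A B : 'M[F]_#|G|) (x y z : gT).

Definition gcoef A x : F := gring_row A 0 (gring_index G x).

Lemma gcoef_is_linear x : linear (gcoef^~ x : 'M[F]_#|G| -> F^o).
Proof. by move=> a A B; rewrite /gcoef linearP !mxE. Qed.

Lemma gcoefD A B x : gcoef (A + B) x = gcoef A x + gcoef B x.
Proof. by have := gcoef_is_linear x 1 A B; rewrite !scale1r. Qed.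

Lemma gcoefZ a A x : gcoef (a *: A) x = a * gcoef A x.
Proof.
by have := gcoef_is_linear x a A 0; rewrite /gcoef /= linear0 !mxE !addr0.
Qed.

Lemma gcoef0 x : gcoef 0 x = 0.
Proof. by rewrite -(scale0r (0 : 'M[F]_#|G|)) gcoefZ mul0r. Qed.

Lemma gcoef_sum (I : Type) (r : seq I) (P : pred I) (E : I -> 'M[F]_#|G|) x :
  gcoef (\sum_(k <- r | P k) E k) x = \sum_(k <- r | P k) gcoef (E k) x.
Proof. by apply: (big_morph (gcoef^~ x)) => [A B|]; rewrite (gcoefD, gcoef0). Qed.

Lemma gcoefG x y : x \in G -> y \in G -> gcoef (aG x) y = (x == y)%:R.
Proof.
move=> Gx Gy; rewrite /gcoef /gring_row rowK gring_indexK // mul1g mxE eqxx /=.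
by rewrite -(inj_eq (can_inj (@gring_valK _ G))) !gring_indexK // eq_sym.
Qed.

Lemma gcoef_comb (a : gT -> F) y : y \in G ->
  gcoef (\sum_(x in G) a x *: aG x) y = a y.
Proof.
move=> Gy; rewrite gcoef_sum (bigD1 y) //= gcoefZ gcoefG // eqxx mulr1.
rewrite big1 ?addr0 // => x /andP[Gx /negPf nxy].
by rewrite gcoefZ gcoefG // nxy mulr0.
Qed.

Lemma gcoefE A : (A \in FG)%MS -> A = \sum_(x in G) gcoef A x *: aG x.
Proof.
case/envelop_mxP=> a ->; apply: eq_bigr => x Gx.
by rewrite gcoef_comb.
Qed.

Lemma gcoefM A B z : (A \in FG)%MS -> (B \in FG)%MS -> z \in G ->
  gcoef (A *m B) z = \sum_(x in G) gcoef A x * gcoef B (x^-1 * z)%g.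
Proof.
move=> FA FB Gz; rewrite [A in LHS]gcoefE // mulmx_suml gcoef_sum.
apply: eq_bigr => x Gx; rewrite [B in LHS]gcoefE // mulmx_sumr gcoef_sum.
rewrite (bigD1 (x^-1 * z)%g) ?groupM ?groupV //= -scalemxAl gcoefZ -scalemxAr gcoefZ.
rewrite -repr_mxM ?groupM ?groupV // mulKVg gcoefG // eqxx mulr1 big1 ?addr0 //.
move=> y /andP[Gy ny]; rewrite -scalemxAl gcoefZ -scalemxAr gcoefZ.
rewrite -repr_mxM // gcoefG ?groupM // -(inj_eq (mulgI x^-1%g)) mulKg (negPf ny).
by rewrite !mulr0.
Qed.

Lemma group_ring1 : ((1%:M : 'M[F]_#|G|) \in FG)%MS.
Proof. exact: envelop_mx1. Qed.

Lemma group_ringM A B : (A \in FG -> B \in FG -> A *m B \in FG)%MS.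
Proof. exact: envelop_mxM. Qed.

Lemma group_ringG x : x \in G -> (aG x \in FG)%MS.
Proof. exact: envelop_mx_id. Qed.

(* A ^ x = x^-1 A x, matching the right actions of the library. *)
Definition gconj x A : 'M[F]_#|G| := aG x^-1%g *m A *m aG x.

Lemma gconj_is_linear x : linear (gconj x).
Proof. by move=> a A B; rewrite /gconj !linearP /= mulmxDl -scalemxAl. Qed.
HB.instance Definition _ x :=
  GRing.isLinear.Build F 'M[F]_#|G| 'M[F]_#|G| _ (gconj x) (gconj_is_linear x).

Lemma gconjZ x a A : gconj x (a *: A) = a *: gconj x A.
Proof. exact: linearZ. Qed.

Lemma gconjM x A B : x \in G -> gconj x (A *m B) = gconj x A *m gconj x B.
Proof. by move=> Gx; rewrite /gconj !mulmxA repr_mxK. Qed.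

Lemma gconj_comp x y A : x \in G -> y \in G -> gconj y (gconj x A) = gconj (x * y)%g A.
Proof.
by move=> Gx Gy; rewrite /gconj invMg !repr_mxM ?groupV // !mulmxA.
Qed.

Lemma gconj1 A : gconj 1%g A = A.
Proof. by rewrite /gconj invg1 !repr_mx1 mulmx1 mul1mx. Qed.

Lemma gconj_one x : x \in G -> gconj x 1%:M = 1%:M.
Proof. by move=> Gx; rewrite /gconj mulmx1 -repr_mxM ?groupV // mulVg repr_mx1. Qed.

Lemma group_ring_conj x A : x \in G -> (A \in FG)%MS -> (gconj x A \in FG)%MS.
Proof. by move=> Gx FA; rewrite !group_ringM ?group_ringG ?groupV. Qed.

Lemma gconjG x y : x \in G -> y \in G -> gconj x (aG y) = aG (y ^ x)%g.
Proof. by move=> Gx Gy; rewrite /gconj -!repr_mxM ?groupM ?groupV // conjgE mulgA. Qed.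

Lemma gcoef_conj A x y : (A \in FG)%MS -> x \in G -> y \in G ->
  gcoef (gconj x A) y = gcoef A (y ^ x^-1)%g.
Proof.
move=> FA Gx Gy; rewrite [in LHS](gcoefE FA) linear_sum gcoef_sum.
have conjZ z : z \in G ->
    gcoef (gconj x (gcoef A z *: aG z)) y = gcoef A z * (z == y ^ x^-1)%g%:R.
  move=> Gz; rewrite gconjZ gcoefZ gconjG // gcoefG ?groupJ //.
  by rewrite (can2_eq (conjgK x) (conjgKV x)).
rewrite (bigD1 (y ^ x^-1)%g) ?groupJ ?groupV // conjZ ?groupJ ?groupV //.
rewrite eqxx mulr1 big1 /= ?addr0 // => z /andP[Gz /negPf nz].
by rewrite conjZ // nz mulr0.
Qed.

Lemma fixed_eltP (U : {group gT}) A : U \subset G ->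
  fixed_elt U A <-> (A \in FG)%MS /\ {in U, forall x, gconj x A = A}.
Proof.
move=> sUG; split=> -[FA fixA]; split=> // x Ux.
  by rewrite /gconj -{2}(invgK x) fixA ?groupV.
by rewrite -{1}(invgK x) -/(gconj x^-1%g A) fixA ?groupV.
Qed.

Lemma fixed_elt_subalg (U : {group gT}) : U \subset G ->
  mx_subalg (@fixed_elt F gT G U).
Proof.
move=> sUG; split.
- apply/fixed_eltP=> //; split; first exact: group_ring1.
  by move=> x Ux; rewrite gconj_one ?(subsetP sUG).
- move=> a A B /fixed_eltP[] // FA fA /fixed_eltP[] // FB fB.
  apply/fixed_eltP=> //; split.
    by rewrite linearP /= addmx_sub ?scalemx_sub.
  by move=> x Ux; rewrite linearP /= fA ?fB.
move=> A B /fixed_eltP[] // FA fA /fixed_eltP[] // FB fB.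
apply/fixed_eltP=> //; split; first exact: group_ringM.
by move=> x Ux; rewrite -[A * B]/(A *m B) gconjM ?(subsetP sUG) // fA ?fB.
Qed.

Lemma fixed_eltS (U W : {group gT}) A : U \subset W -> fixed_elt W A -> fixed_elt U A.
Proof. by move=> sUW [FA fA]; split=> // x Ux; apply: fA (subsetP sUW _ Ux). Qed.

Lemma fixed_elt_conj (U : {group gT}) A x : U \subset G -> x \in G ->
  fixed_elt U A -> fixed_elt (U :^ x)%G (gconj x A).
Proof.
move=> sUG Gx /fixed_eltP[] // FA fA; apply/fixed_eltP.
  by rewrite conj_subG.
split; first exact: group_ring_conj.
move=> _ /imsetP[u Uu ->]; have Gu := subsetP sUG u Uu.
rewrite gconj_comp ?groupJ //.
have -> : (x * u ^ x)%g = (u * x)%g by rewrite conjgE mulKVg.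
by rewrite -gconj_comp // fA.
Qed.

Lemma gcoef_fixed (U : {group gT}) A u y : U \subset G -> fixed_elt U A ->
  u \in U -> y \in G -> gcoef A (y ^ u)%g = gcoef A y.
Proof.
move=> sUG /fixed_eltP[] // FA fA Uu Gy; have Gu := subsetP sUG u Uu.
by rewrite -{1}(fA u Uu) gcoef_conj ?groupJ // conjgK.
Qed.

End GroupRingCoefficients.

(** * Orbit sums in characteristic p and sums over cosets *)

Section OrbitSums.

Variables (F : fieldType) (p : nat) (V : lmodType F).
Hypothesis charF : p \in [pchar F].

(** A nontrivial orbit of a p-group has size a positive power of p, so it contributes 0. *)
Lemma sum_orbit_fix (aT : finGroupType) (D : {group aT}) (T : finType)
    (to : action D T) (Q : {group aT}) (S : {set T}) (f : T -> V) :
    p.-group Q -> Q \subset D -> [acts Q, on S | to] ->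
    {in Q & S, forall a x, f (to x a) = f x} ->
  \sum_(x in S) f x = \sum_(x in 'Fix_(S | to)(Q)) f x.
Proof.
move=> pQ sQD actQ fQ.
rewrite (set_partition_big _ (orbit_partition actQ)) /=.
rewrite (bigID (fun B : {set T} => #|B| == 1%N)) /= addrC big1 ?add0r; last first.
  move=> _ /andP[/imsetP[x Sx ->] cB].
  have -> : \sum_(y in orbit to Q x) f y = f x *+ #|orbit to Q x|.
    rewrite -sumr_const; apply: eq_bigr => _ /imsetP[a Qa ->].
    by rewrite fQ.
  have [k ck] : exists k, #|orbit to Q x| = (p ^ k)%N.
    suffices /p_natP[k ->] : p.-nat #|orbit to Q x| by exists k.
    apply: pnat_dvd (pQ).
    by rewrite -(card_orbit_in_stab to x sQD) dvdn_mulr.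
  case: k ck cB => [->|k ck _] //.
  by rewrite ck expnS mulrnA -(scaler_nat p) (pcharf0 charF) scale0r mul0rn.
rewrite (eq_bigl [in [set [set x] | x in 'Fix_(S | to)(Q)]]); last first.
  move=> B; apply/andP/imsetP=> [[/imsetP[x Sx ->]] /cards1P[y def_y]|[x]].
    have xy : x = y by apply/set1P; rewrite -def_y orbit_refl.
    exists x; last by rewrite def_y xy.
    by rewrite inE Sx; apply/orbit1P; rewrite // def_y xy.
  rewrite inE => /andP[Sx /orbit1P ox] ->; rewrite cards1 eqxx; split=> //.
  by apply/imsetP; exists x.
rewrite big_imset /=; last by move=> x y _ _ /set1_inj.
by apply: eq_bigr => x _; rewrite big_set1.
Qed.

End OrbitSums.

Section CosetSums.

Variables (gT : finGroupType) (V : nmodType).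
Implicit Types (R S P : {group gT}) (f : gT -> V).

Lemma coset_fun_repr R (P : {set gT}) f x :
    {in R & P, forall r y, f (r * y)%g = f y} -> x \in P ->
  f (repr (R :* x)) = f x.
Proof. by move=> fR Px; case: (repr_rcosetP R x) => r Rr; apply: fR. Qed.

Lemma sum_rcosets_shift R P f u : {in R & P, forall r y, f (r * y)%g = f y} ->
  u \in P ->
  \sum_(B in rcosets R P) f (repr B) = \sum_(B in rcosets R P) f (repr B * u)%g.
Proof.
move=> fR Pu; rewrite (reindex_acts 'Rs (actsRs_rcosets R P) Pu).
apply: eq_bigr => _ /rcosetsP[x Px ->] /=; rewrite rcosetE -rcosetM.
rewrite (coset_fun_repr fR) ?groupM //; case: (repr_rcosetP R x) => r Rr.
by rewrite -mulgA (fR r) ?groupM.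
Qed.

Lemma sum_rcosets_trans S R P f : S \subset R -> R \subset P ->
    {in S & P, forall s y, f (s * y)%g = f y} ->
  \sum_(B in rcosets S P) f (repr B) =
  \sum_(D in rcosets R P) \sum_(E in rcosets S R) f (repr E * repr D)%g.
Proof.
move=> sSR sRP fS.
rewrite (partition_big (fun B => R :* repr B) [in rcosets R P]) /=; last first.
  move=> _ /rcosetsP[x Px ->]; apply/rcosetsP; exists (repr (S :* x)) => //.
  by case: repr_rcosetP => s Ss; rewrite groupM // (subsetP sRP) ?(subsetP sSR).
apply: eq_bigr => _ /rcosetsP[x Px ->]; set d := repr (R :* x).
have Pd : d \in P.
  by rewrite /d; case: repr_rcosetP => r Rr; rewrite groupM // (subsetP sRP).
(* The cosets of S inside R d are the right translates by d of the cosets of S in R. *)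
rewrite (reindex_onto (fun E : {set gT} => E :* d) (fun B : {set gT} => B :* d^-1%g)) /=; last first.
  by move=> B _; rewrite -rcosetM mulVg rcoset1.
apply: eq_big => [E|E]; last first.
  rewrite -rcosetM mulgV rcoset1 eqxx andbT => /andP[/rcosetsP[y Py defE] _].
  have {}defE : E = S :* (y * d^-1)%g by rewrite rcosetM -defE -rcosetM mulgV rcoset1.
  rewrite defE -rcosetM mulgKV (coset_fun_repr fS) //.
  by case: repr_rcosetP => s Ss; rewrite -mulgA (fS s) ?mulgKV // groupM ?groupV.
rewrite -rcosetM mulgV rcoset1 eqxx andbT.
apply/andP/idP=> [[/rcosetsP[y Py defE] /eqP defR]|/rcosetsP[r Rr ->]].
  have {}defE : E = S :* (y * d^-1)%g by rewrite rcosetM -defE -rcosetM mulgV rcoset1.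
  rewrite defE; apply/rcosetsP; exists (y * d^-1)%g => //.
  rewrite -mem_rcoset /d rcoset_repr -defR defE -rcosetM mulgKV.
  case: repr_rcosetP => s Ss; rewrite rcosetM rcoset_id ?rcoset_refl //.
  exact: (subsetP sSR).
split; first by apply/rcosetsP; exists (r * d)%g; [rewrite groupM ?(subsetP sRP r) | rewrite rcosetM].
rewrite -rcosetM; case: repr_rcosetP => s Ss; rewrite rcosetM rcoset_id ?(subsetP sSR) //.
by rewrite rcosetM (rcoset_id Rr) /d rcoset_repr.
Qed.

Lemma sum_rcosets_conj R P f g : {in R & P, forall r y, f (r * y)%g = f y} ->
  g \in P ->
  \sum_(B in rcosets R P) f (repr B) = \sum_(B in rcosets (R :^ g) P) f (g * repr B)%g.
Proof.
move=> fR Pg.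
rewrite (reindex_onto (fun B : {set gT} => (g *: B)%g) (fun B : {set gT} => (g^-1 *: B)%g)) /=; last first.
  by move=> B _; rewrite -lcosetM mulgV lcoset1.
have gB y : (g *: (R :^ g :* y) = R :* (g * y))%g.
  by rewrite conjsgE rcosetM -!mulgA -lcosetM mulgV lcoset1.
have Pg' : g^-1%g \in P by rewrite groupV.
have fRg : {in (R :^ g)%G & P, forall r y, f (g * (r * y))%g = f (g * y)%g}.
  move=> _ y /imsetP[s Ss ->] Py; have -> : (g * (s ^ g * y))%g = (s * (g * y))%g.
    by rewrite conjgE !mulgA mulgV mul1g.
  by apply: fR; rewrite ?groupM.
apply: eq_big => [B|B]; rewrite -lcosetM mulVg lcoset1 eqxx andbT.
  apply/rcosetsP/rcosetsP=> -[y Py defB]; last by exists (g * y)%g; [rewrite groupM | rewrite defB gB].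
  exists (g^-1 * y)%g; first by rewrite groupM.
  by rewrite -[B]lcoset1 -(mulVg g) lcosetM defB -{1}(mulKVg g y) -gB -lcosetM mulVg lcoset1.
case/rcosetsP=> y Py defB.
have {}defB : B = (R :^ g)%G :* (g^-1 * y)%g.
  by rewrite -[B]lcoset1 -(mulVg g) lcosetM defB -{1}(mulKVg g y) -gB -lcosetM mulVg lcoset1.
rewrite defB gB mulKVg (coset_fun_repr fR) //.
by rewrite (coset_fun_repr fRg) ?mulKVg // groupM.
Qed.

End CosetSums.

(** * The Brauer map and relative traces *)

Section BrauerMap.

Variables (F : fieldType) (p : nat) (charF : p \in [pchar F]).
Variables (gT : finGroupType) (G : {group gT}).
Local Notation aG := (regular_repr F G).
Local Notation FG := (group_ring F G).
Implicit Types (A B : 'M[F]_#|G|) (Q R S P : {group gT}).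

(* The Brauer map at Q followed by the linear extension of h : 'C_G(Q) -> 'M_n. *)
Definition brauer_op Q n (h : gT -> 'M[F]_n) A : 'M[F]_n :=
  \sum_(x in 'C_G(Q)) gcoef A x *: h x.

Lemma brauer_op_is_linear Q n (h : gT -> 'M[F]_n) : linear (brauer_op Q h).
Proof.
move=> a A B; rewrite /brauer_op scaler_sumr -big_split /=.
by apply: eq_bigr => x _; rewrite gcoefD gcoefZ scalerDl scalerA.
Qed.
HB.instance Definition _ Q n (h : gT -> 'M[F]_n) :=
  GRing.isLinear.Build F 'M[F]_#|G| 'M[F]_n _ (brauer_op Q h) (brauer_op_is_linear Q h).

Lemma brauer_mapE Q A : brauer_map Q A = brauer_op Q aG A.
Proof. by []. Qed.

(** Since z centralizes Q, conjugation by Q permutes the factorizations z = x (x^-1 z) and preserves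
    their contributions, so only the x centralized by Q survive. This is what makes the Brauer map
    multiplicative. *)
Lemma gcoefM_fixed Q A B z : p.-group Q -> Q \subset G ->
    fixed_elt Q A -> fixed_elt Q B -> z \in 'C_G(Q) ->
  gcoef (A *m B) z = \sum_(x in 'C_G(Q)) gcoef A x * gcoef B (x^-1 * z)%g.
Proof.
move=> pQ sQG fA fB /setIP[Gz Cz]; have [[FA _] [FB _]] := (fA, fB).
rewrite gcoefM //.
have actQ : [acts Q, on G | 'J] by rewrite astabsJ (subset_trans sQG) ?normG.
rewrite (sum_orbit_fix charF (V := F^o) pQ _ actQ) ?subsetT //.
  by apply: eq_bigl => x; rewrite afixJ.
move=> u x Qu Gx /=; have Gu := subsetP sQG u Qu.
rewrite (gcoef_fixed sQG fA) //; congr (_ * _).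
have zu : (z ^ u = z)%g by rewrite conjgE (centP Cz u Qu) mulKg.
by rewrite -{1}zu -conjVg -conjMg (gcoef_fixed sQG fB) // groupM ?groupV.
Qed.

Lemma brauer_opM Q n (h : gT -> 'M[F]_n) A B : p.-group Q -> Q \subset G ->
    {in 'C_G(Q) &, {morph h : x y / (x * y)%g >-> x *m y}} ->
    fixed_elt Q A -> fixed_elt Q B ->
  brauer_op Q h (A *m B) = brauer_op Q h A *m brauer_op Q h B.
Proof.
move=> pQ sQG hM fA fB; rewrite /brauer_op mulmx_suml.
under eq_bigr => z Cz do rewrite (gcoefM_fixed pQ sQG fA fB Cz) scaler_suml.
rewrite exchange_big; apply: eq_bigr => x Cx /=.
have Cx' : x^-1%g \in 'C_G(Q) by rewrite groupV.
rewrite (reindex_onto (mulg x) (mulg x^-1%g)) /=; last by move=> z _; rewrite mulKVg.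
rewrite mulmx_sumr; apply: eq_big => [y|y]; first by rewrite mulKg eqxx andbT groupMl.
rewrite mulKg eqxx andbT groupMl // => Cy.
by rewrite hM // -scalemxAl -scalemxAr scalerA.
Qed.

Lemma brauer_op1 Q n (h : gT -> 'M[F]_n) : h 1%g = 1%:M -> brauer_op Q h 1%:M = 1%:M.
Proof.
move=> h1; rewrite /brauer_op (bigD1 1%g) ?group1 //= -(repr_mx1 aG).
rewrite gcoefG // eqxx scale1r h1 big1 ?addr0 // => x /andP[/setIP[Gx _] nx].
by rewrite gcoefG // eq_sym (negPf nx) scale0r.
Qed.

Lemma brauer_op_conj Q n (h : gT -> 'M[F]_n) A x : x \in G -> (A \in FG)%MS ->
  brauer_op (Q :^ x)%G h (gconj x A) = brauer_op Q (fun y => h (y ^ x)%g) A.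
Proof.
move=> Gx FA; rewrite /brauer_op /= (reindex_inj (conjg_inj x)) /=.
apply: eq_big => [y|y /setIP[Gy _]]; last by rewrite gcoef_conj // conjgK.
by rewrite !inE groupJr // centJ memJ_conjg.
Qed.

Lemma brauer_op_gconj Q n (h : gT -> 'M[F]_n) A u : Q \subset G -> u \in Q ->
  (A \in FG)%MS -> brauer_op Q h (gconj u A) = brauer_op Q h A.
Proof.
move=> sQG Qu FA; apply: eq_bigr => z /setIP[Gz Cz].
rewrite gcoef_conj ?(subsetP sQG u) //; congr (gcoef A _ *: _).
by rewrite conjgE invgK (centP Cz _ (groupVr Qu)) mulKVg.
Qed.

(** Right cosets go with the right action [gconj]; the choice of representatives is immaterial once
    A is fixed by R. *)
Definition gtrace R P A := \sum_(B in rcosets R P) gconj (repr B) A.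

Lemma gconj_coset R A r y : R \subset G -> fixed_elt R A -> r \in R ->
  y \in G -> gconj (r * y)%g A = gconj y A.
Proof.
move=> sRG /fixed_eltP[] // FA fA Rr Gy.
by rewrite -gconj_comp ?(subsetP sRG r) // fA.
Qed.

Lemma gtrace_fun R P A : R \subset P -> P \subset G -> fixed_elt R A ->
  {in R & P, forall r y, gconj (r * y)%g A = gconj y A}.
Proof.
move=> sRP sPG fA r y Rr Py.
by rewrite (gconj_coset (subset_trans sRP sPG)) ?(subsetP sPG).
Qed.

Lemma gtrace_sub_ring R P A : P \subset G -> R \subset P -> (A \in FG)%MS ->
  (gtrace R P A \in FG)%MS.
Proof.
move=> sPG sRP FA; rewrite /gtrace linear_sum summx_sub // => _ /rcosetsP[x Px ->].
apply: group_ring_conj => //; case: repr_rcosetP => r Rr.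
by rewrite groupM ?(subsetP sPG) // (subsetP sRP).
Qed.

Lemma repr_rcosets_in R P (B : {set gT}) : R \subset P -> B \in rcosets R P -> repr B \in P.
Proof.
move=> sRP /rcosetsP[x Px ->]; case: repr_rcosetP => r Rr.
by rewrite groupM // (subsetP sRP).
Qed.

Lemma gtrace_fixed R P A : R \subset P -> P \subset G -> fixed_elt R A ->
  fixed_elt P (gtrace R P A).
Proof.
move=> sRP sPG fA; apply/fixed_eltP=> //; split.
  by apply: gtrace_sub_ring => //; case: fA.
move=> u Pu; rewrite /gtrace linear_sum.
rewrite [RHS](sum_rcosets_shift (gtrace_fun sRP sPG fA) Pu).
apply: eq_bigr => B /(repr_rcosets_in sRP) PB.
by rewrite /= gconj_comp ?(subsetP sPG).
Qed.

Lemma gtraceMl R P A X : R \subset P -> P \subset G -> fixed_elt P X ->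
  X *m gtrace R P A = gtrace R P (X *m A).
Proof.
move=> sRP sPG /fixed_eltP[] // FX fX; rewrite /gtrace mulmx_sumr.
apply: eq_bigr => B /(repr_rcosets_in sRP) PB.
by rewrite gconjM ?(subsetP sPG) // fX.
Qed.

Lemma gtraceMr R P A X : R \subset P -> P \subset G -> fixed_elt P X ->
  gtrace R P A *m X = gtrace R P (A *m X).
Proof.
move=> sRP sPG /fixed_eltP[] // FX fX; rewrite /gtrace mulmx_suml.
apply: eq_bigr => B /(repr_rcosets_in sRP) PB.
by rewrite gconjM ?(subsetP sPG) // fX.
Qed.

Lemma gtrace_sum R P (I : Type) (r : seq I) (Pr : pred I) (E : I -> 'M[F]_#|G|) :
  gtrace R P (\sum_(k <- r | Pr k) E k) = \sum_(k <- r | Pr k) gtrace R P (E k).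
Proof.
rewrite /gtrace exchange_big; apply: eq_bigr => B _ /=.
by rewrite linear_sum.
Qed.

Lemma gtrace_trans S R P A : S \subset R -> R \subset P -> P \subset G ->
  fixed_elt S A -> gtrace R P (gtrace S R A) = gtrace S P A.
Proof.
move=> sSR sRP sPG fA.
rewrite [RHS](sum_rcosets_trans sSR sRP (gtrace_fun (subset_trans sSR sRP) sPG fA)).
apply: eq_bigr => D /(repr_rcosets_in sRP) PD; rewrite linear_sum.
apply: eq_bigr => E /(repr_rcosets_in sSR) RE.
by rewrite /= gconj_comp ?(subsetP sPG) // (subsetP sRP).
Qed.

Lemma gtrace_id P A : P \subset G -> fixed_elt P A -> gtrace P P A = A.
Proof.
move=> sPG /fixed_eltP[] // FA fA; rewrite /gtrace rcosets_id big_set1 fA //.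
exact: mem_repr (group1 P).
Qed.

Lemma gtrace_conj R P A g : R \subset P -> P \subset G -> fixed_elt R A -> g \in P ->
  gtrace (R :^ g)%G P (gconj g A) = gtrace R P A.
Proof.
move=> sRP sPG fA Pg; rewrite [RHS](sum_rcosets_conj (gtrace_fun sRP sPG fA) Pg).
apply: eq_bigr => B RB; have PB : repr B \in P.
  by apply: (repr_rcosets_in (R := (R :^ g)%G)) RB; rewrite conj_subG.
by rewrite gconj_comp ?(subsetP sPG).
Qed.

(* Only the cosets fixed by Q contribute, the other Q-orbits having size divisible by p. *)
Lemma brauer_op_gtrace Q R P n (h : gT -> 'M[F]_n) A :
    p.-group Q -> Q \subset P -> R \subset P -> P \subset G -> fixed_elt R A ->
  brauer_op Q h (gtrace R P A) =
  \sum_(B in rcosets R P | Q \subset (R :^ repr B)%g) brauer_op Q h (gconj (repr B) A).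
Proof.
move=> pQ sQP sRP sPG fA; rewrite /gtrace linear_sum /=.
have actQ : [acts Q, on rcosets R P | 'Rs].
  exact: subset_trans sQP (actsRs_rcosets R P).
rewrite (sum_orbit_fix charF pQ _ actQ) ?subsetT //; last first.
  move=> u B Qu RB; have [FA _] := fA; have Pu := subsetP sQP u Qu.
  have [x Px ->] := rcosetsP RB; rewrite /= rcosetE -rcosetM.
  rewrite !(coset_fun_repr (gtrace_fun sRP sPG fA)) ?groupM //.
  rewrite -gconj_comp ?(subsetP sPG) // brauer_op_gconj //.
    exact: subset_trans sQP sPG.
  by rewrite group_ring_conj ?(subsetP sPG).
apply: eq_bigl => B; rewrite inE; apply: andb_id2l => /rcosetsP[x Px ->].
rewrite sub_afixRs_norms; case: repr_rcosetP => r Rr.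
by rewrite conjsgM (conjGid Rr).
Qed.

End BrauerMap.

Lemma sub_conj_refl (F : fieldType) n (D : 'M[F]_n -> Prop) e : mx_subalg D -> sub_conj D e e.
Proof.
move=> algD; exists 1, 1; rewrite !mul1r !mulr1.
by split=> //; apply: subalg1.
Qed.

Lemma sub_conj_sym (F : fieldType) n (D : 'M[F]_n -> Prop) e e' :
  sub_conj D e e' -> sub_conj D e' e.
Proof.
move=> [A [B [DA DB AB BA ->]]]; exists B, A; split=> //.
by rewrite !mulrA BA mul1r -mulrA BA mulr1.
Qed.

Lemma sub_conj_primitive (F : fieldType) n (D : 'M[F]_n -> Prop) (e e' : 'M[F]_n) :
  mx_subalg D -> sub_primitive D e -> sub_conj D e e' -> sub_primitive D e'.
Proof.
move=> algD prim_e [A [B [DA DB AB BA ->]]]; have [[De ee] _ _] := prim_e.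
have -> : A * e * B = (A * e) * (e * B) by rewrite mulrA -(mulrA A e e) ee.
apply: (equiv_primitive algD prim_e); try exact: subalgM.
- by rewrite mulrA ee.
- by rewrite -mulrA ee.
by rewrite mulrA -(mulrA e B A) BA mulr1 ee.
Qed.

(** * Vertices of primitive idempotents *)

Section VertexTheory.

Variables (F : fieldType) (p : nat) (charF : p \in [pchar F]).
Variables (gT : finGroupType) (G : {group gT}).
Local Notation aG := (regular_repr F G).
Local Notation FG := (group_ring F G).
Local Notation fixed := (@fixed_elt F gT G).
Implicit Types (A B a b c e i j : 'M[F]_#|G|) (Q R S P : {group gT}).

Lemma primitive_idem_conj P i x : P \subset G -> x \in G ->
  sub_primitive (fixed P) i -> sub_primitive (fixed (P :^ x)%G) (gconj x i).
Proof.
move=> sPG Gx [[fi ii] i0 prim_i].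
have gK e : gconj x^-1%g (gconj x e) = e.
  by rewrite gconj_comp ?groupV // mulgV gconj1.
have gM y e f : y \in G -> gconj y (e * f) = gconj y e * gconj y f.
  exact: gconjM.
have sPxG : P :^ x \subset G by rewrite conj_subG.
have idemV e : sub_idem (fixed (P :^ x)%G) e -> sub_idem (fixed P) (gconj x^-1%g e).
  move=> [fe ee]; split; last by rewrite -gM ?groupV // ee.
  have -> : P = ((P :^ x) :^ x^-1)%G by apply: val_inj; rewrite /= conjsgK.
  by apply: fixed_elt_conj; rewrite ?groupV.
split.
- split; first exact: fixed_elt_conj.
  by rewrite -gM // ii.
- by apply: contra_neq i0 => xi0; rewrite -(gK i) xi0 linear0.
move=> e1 e2 ie1 ie2 e12 e21 def_e.
have gVK e : gconj x (gconj x^-1%g e) = e.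
  by rewrite gconj_comp ?groupV // mulVg gconj1.
have eq0 e : gconj x^-1%g e = 0 -> e = 0 by move=> e0; rewrite -(gVK e) e0 linear0.
suffices [/eq0|/eq0] : gconj x^-1%g e1 = 0 \/ gconj x^-1%g e2 = 0 by [left | right].
apply: prim_i; rewrite -?gM ?groupV ?e12 ?e21 ?linear0 //; try exact: idemV.
by rewrite -linearD -def_e /= gK.
Qed.

(** An R-fixed element is a combination of sums over R-conjugacy orbits, and the orbit sum of x is
    the trace of x from C_R(x). *)
Lemma brauer_kernel R e : R \subset G -> fixed R e -> brauer_map R e = 0 ->
  exists (I : finType) (K : pred I) (S : I -> {group gT}) (a : I -> 'M[F]_#|G|),
    (forall k, K k -> S k \proper R /\ fixed (S k) (a k)) /\
    e = \sum_(k | K k) gtrace (S k) R (a k).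
Proof.
move=> sRG fe bre0; have [FGe _] := fe.
have c0 x : x \in 'C_G(R) -> gcoef e x = 0.
  move=> CRx; have /setIP[Gx _] := CRx.
  have := congr1 (fun A => gcoef A x) bre0; rewrite gcoef0 => <-.
  rewrite brauer_mapE /brauer_op gcoef_sum (bigD1 x) //= gcoefZ gcoefG // eqxx mulr1.
  rewrite big1 ?addr0 // => y /andP[/setIP[Gy _] /negPf nyx].
  by rewrite gcoefZ gcoefG // nyx mulr0.
have actR : [acts R, on G | 'J] by rewrite astabsJ (subset_trans sRG) ?normG.
(* Orbits with coefficient 0 are left out: they include those of the x centralized by R, for which
   C_R(x) is not a proper subgroup. *)
exists {set gT}, (fun O => (O \in orbit 'J R @: G) && (gcoef e (repr O) != 0)).
exists (fun O => 'C_R[repr O]%G), (fun O => gcoef e (repr O) *: aG (repr O)).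
have reprO O : O \in orbit 'J R @: G -> [/\ repr O \in G & O = orbit 'J R (repr O)].
  case/imsetP=> x Gx ->; have ox : repr (orbit 'J R x) \in orbit 'J R x.
    exact: mem_repr (orbit_refl _ _ _).
  split; last exact/esym/orbit_eqP.
  by case/imsetP: ox => r Rr ->; rewrite /= groupJ ?(subsetP sRG r).
split=> [O /andP[/reprO[Gx defO] cx]|].
  set x := repr O in Gx defO cx *; split.
    rewrite properEneq subsetIl andbT; apply: contra_neqN cx => /eqP cR.
    apply: c0; rewrite inE Gx -sub_cent1 -cR subsetIr //.
  apply/fixed_eltP; first by rewrite subIset ?sRG.
  split; first by rewrite linearZ scalemx_sub ?group_ringG.
  move=> u /setIP[Ru /cent1P cxu]; have Gu := subsetP sRG u Ru.
  by rewrite gconjZ gconjG // conjgE -cxu mulKg.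
rewrite [LHS](gcoefE FGe) (set_partition_big _ (orbit_partition actR)) /=.
rewrite [RHS]big_mkcondr; apply: eq_bigr => O /reprO[Gx defO].
set x := repr O in Gx defO *; rewrite {1}defO orbit_stabilizer ?subsetT //.
rewrite big_imset /=; last exact: can_in_inj (act_reprK (subsetT _)).
rewrite astab1J; have sCR : 'C_R[x] \subset R := subsetIl _ _.
have [cx0|_] := eqVneq (gcoef e x) 0; last first.
  apply: eq_bigr => B /(repr_rcosets_in sCR) RB; have GB := subsetP sRG _ RB.
  by rewrite gconjZ gconjG // (gcoef_fixed sRG fe).
rewrite big1 // => B /(repr_rcosets_in sCR) RB.
by rewrite (gcoef_fixed sRG fe) // cx0 scale0r.
Qed.

(** R has least order among the subgroups from which i is a trace, and e is a term of a primitive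
    decomposition of i over R whose trace contribution is invertible in the corner. If br_R(e) = 0,
    then e is a sum of traces from proper subgroups of R, one of which again yields i as a trace,
    against minimality. *)
Lemma primitive_vertex P i : p.-group P -> P \subset G -> sub_primitive (fixed P) i ->
  exists R e a b, [/\ R \subset P, sub_primitive (fixed R) e /\ brauer_map R e != 0,
    i * e = e /\ e * i = e, fixed R a /\ fixed R b & i = gtrace R P (a * e * b)].
Proof.
move=> pP sPG prim_i; have [[fi ii] i0 _] := prim_i.
pose rel R := R \subset P /\ exists c, fixed R c /\ i = gtrace R P c.
have ex_rel : exists m, `[< exists R, #|R| = m /\ rel R >].
  exists #|P|; apply/asboolP; exists P; split=> //; split=> //.
  by exists i; rewrite gtrace_id.
have [m /asboolP[R [cR [sRP [c [fc def_i]]]]] minR] := ex_minnP ex_rel.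
have {}minR S : S \proper R -> ~ rel S.
  move=> ltSR relS; have := proper_card ltSR; rewrite cR ltnNge minR //.
  by apply/asboolP; exists S.
have sRG := subset_trans sRP sPG.
have algP : mx_subalg (fixed P) := fixed_elt_subalg F sPG.
have algR : mx_subalg (fixed R) := fixed_elt_subalg F sRG.
have PR A : fixed P A -> fixed R A := fixed_eltS sRP.
have fiR := PR _ fi.
have nni : ~ mx_nilp i.
  by move=> ni; case/eqP: i0; apply: idem_nilpF.
(* The corner of i is local, so when i is a sum of traces one of them is
   invertible in the corner. *)
have corner_tr S A : S \subset P -> fixed S A -> i * A = A -> A * i = A ->
    sub_corner (fixed P) i (gtrace S P A).
  move=> sSP fA iA Ai; split; first exact: gtrace_fixed.
    by rewrite -[_ * _]/(_ *m _) gtraceMl // [_ *m _]iA.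
  by rewrite -[_ * _]/(_ *m _) gtraceMr // [_ *m _]Ai.
have unit_tr S A : S \subset P -> fixed S A -> i * A = A -> A * i = A ->
    ~ mx_nilp (gtrace S P A) ->
    exists y, [/\ fixed P y, y * i = y & i = gtrace S P (A * y)].
  move=> sSP fA iA Ai nn.
  have [//|[y [fy _ yi] [yE _]]] := primitive_local algP prim_i (corner_tr S A sSP fA iA Ai).
  by exists y; split=> //; rewrite -yE -[_ * _]/(_ *m _) gtraceMr.
have [s [_ prim_s comm_s def_s]] := primitive_decomposition (conj fiR ii).
have [x sx nnx] : exists2 x, x \in s & ~ mx_nilp (gtrace R P (i * c * x)).
  apply: (primitive_sum_nilp (r := s) algP prim_i).
    move=> x sx; have [ix xi] := comm_s x sx; have [[fx _] _ _] := prim_s x sx.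
    apply: corner_tr => //; first by do !apply: subalgM.
      by rewrite !mulrA ii.
    by rewrite -mulrA xi.
  rewrite -big_seq -gtrace_sum -mulr_sumr -def_s.
  suffices -> : gtrace R P (i * c * i) = i by [].
  rewrite -[_ * i]/(_ *m i) -gtraceMr // -[i * c]/(i *m c) -gtraceMl // -def_i.
  by rewrite -[i *m i *m i]/(i * i * i) !ii.
have [ix xi] := comm_s x sx; have prim_x := prim_s x sx; have [[fx xx] _ _] := prim_x.
have ficx : fixed R (i * c * x) by do !apply: subalgM.
have icx : i * (i * c * x) = i * c * x by rewrite !mulrA ii.
have cxi : i * c * x * i = i * c * x by rewrite -mulrA xi.
have [y [fy yi def_i']] := unit_tr R _ sRP ficx icx cxi nnx.
exists R, x, (i * c), y; split=> //; last by split; [apply: subalgM | apply: PR].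
split=> //; apply/eqP=> brx0.
have [I [K [S [a [HS def_x]]]]] := brauer_kernel sRG fx brx0.
have fSa k : K k -> fixed (S k) (i * (c * a k * y)).
  move=> /HS[/proper_sub sSR fa]; have sSG := subset_trans sSR sRG.
  have algS := fixed_elt_subalg F sSG; have RS A := @fixed_eltS F gT G (S k) R A sSR.
  by do !apply: subalgM => //; apply: RS => //; apply: PR.
have [k Kk nnk] : exists2 k, K k & ~ mx_nilp (gtrace (S k) P (i * (c * a k * y))).
  apply: (primitive_sum_nilp (r := index_enum I) algP prim_i).
    move=> k Kk; have [/proper_sub sSR _] := HS k Kk.
    apply: corner_tr; rewrite ?(subset_trans sSR) //; first exact: fSa.
      by rewrite mulrA ii.
    by rewrite -!mulrA yi.
  suffices -> : \sum_(k | K k) gtrace (S k) P (i * (c * a k * y)) = i by [].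
  rewrite [RHS]def_i' def_x mulr_sumr mulr_suml gtrace_sum.
  apply: eq_bigr => k Kk; have [/proper_sub sSR fa] := HS k Kk.
  have trMl X A : fixed R X -> X * gtrace (S k) R A = gtrace (S k) R (X * A).
    exact: gtraceMl.
  have trMr X A : fixed R X -> gtrace (S k) R A * X = gtrace (S k) R (A * X).
    exact: gtraceMr.
  rewrite trMl; last exact: subalgM.
  rewrite trMr; last exact: PR.
  have -> : i * c * a k * y = i * (c * a k * y) by rewrite !mulrA.
  by rewrite gtrace_trans //; apply: fSa.
have [/[dup] ltSR /proper_sub sSR _] := HS k Kk.
have sSP := subset_trans sSR sRP.
have iSa : i * (i * (c * a k * y)) = i * (c * a k * y) by rewrite mulrA ii.
have Sai : i * (c * a k * y) * i = i * (c * a k * y) by rewrite -!mulrA yi.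
have [z [fz zi def_iS]] := unit_tr (S k) _ sSP (fSa k Kk) iSa Sai nnk.
apply: (minR _ ltSR); split=> //; exists (i * (c * a k * y) * z); split=> //.
apply: subalgM; [exact: fixed_elt_subalg (subset_trans sSP sPG) | exact: fSa |].
exact: fixed_eltS fz.
Qed.

End VertexTheory.

(** * Maximal local pointed subgroups and vertices *)

Section MaximalLocal.

Variables (F : fieldType) (p : nat) (charF : p \in [pchar F]).
Variables (gT : finGroupType) (G : {group gT}).
Local Notation aG := (regular_repr F G).
Local Notation FG := (group_ring F G).
Local Notation fixed := (@fixed_elt F gT G).
Implicit Types (A B a b c e i j : 'M[F]_#|G|) (Q R S P : {group gT}).

Lemma regular_reprM Q : {in 'C_G(Q) &, {morph aG : x y / (x * y)%g >-> x *m y}}.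
Proof. by move=> x y /setIP[Gx _] /setIP[Gy _]; rewrite repr_mxM. Qed.

Lemma brauer_mapM Q A B : p.-group Q -> Q \subset G -> fixed Q A -> fixed Q B ->
  brauer_map Q (A *m B) = brauer_map Q A *m brauer_map Q B.
Proof. by move=> pQ sQG fA fB; apply: (brauer_opM charF) => //; apply: regular_reprM. Qed.

Lemma brauer_map_gconj R e x : x \in G -> (e \in FG)%MS ->
  brauer_map (R :^ x)%G (gconj x e) = gconj x (brauer_map R e).
Proof.
move=> Gx Fe; rewrite !brauer_mapE brauer_op_conj // /brauer_op linear_sum.
by apply: eq_bigr => y /setIP[Gy _]; rewrite -gconjG // -gconjZ.
Qed.

Lemma gconj_eq0 x A : x \in G -> (gconj x A == 0) = (A == 0).
Proof.
move=> Gx; apply/eqP/eqP=> [xA0|->]; last exact: linear0.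
by rewrite -[A]gconj1 -(mulgV x) -gconj_comp ?groupV // xA0 linear0.
Qed.

Lemma local_point_gconj R e x : R \subset G -> p.-group R -> x \in G ->
    sub_primitive (fixed R) e -> brauer_map R e != 0 ->
  local_pointed_group p (R :^ x)%G (fixed_conj (R :^ x)%G (gconj x e)).
Proof.
move=> sRG pR Gx prim_e bre; have sRxG : (R :^ x)%G \subset G by rewrite conj_subG.
have [[fe ee] _ _] := prim_e.
have fxe : fixed (R :^ x)%G (gconj x e) by apply: fixed_elt_conj.
have pRx : p.-group (R :^ x)%G by rewrite /= pgroupJ.
have algRx := fixed_elt_subalg F sRxG.
split; first split; first split=> //.
- by exists (gconj x e) => //; apply: primitive_idem_conj.
- by [].
move=> i conj_i; have {}conj_i : sub_conj (fixed (R :^ x)%G) (gconj x e) i := conj_i.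
have [A [B [fA fB _ _ def_e]]] := sub_conj_sym conj_i.
have fi : fixed (R :^ x)%G i.
  have [A1 [B1 [fA1 fB1 _ _ ->]]] := conj_i.
  by apply: (subalgM algRx) => //; apply: (subalgM algRx).
apply: contra_neq bre => bri0.
apply/eqP; rewrite -(gconj_eq0 _ Gx) -brauer_map_gconj //; last by case: fe.
rewrite def_e -[A * i * B]/(A *m i *m B) brauer_mapM //; last exact: (subalgM algRx).
by rewrite brauer_mapM // bri0 mulmx0 mul0mx.
Qed.

(** Let R, e be a vertex of an element of alpha lying above j in delta. Since br_Q(j) <> 0, some g
    in P has Q inside R^g and a conjugate of j below e^g. So Q_delta lies below the local point of
    e^g, itself below P_alpha; maximality gives R^g = Q, and the trace from R becomes a trace from
    Q. *)
Lemma maximal_local_relative_trace P alpha Q delta i :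
    pointed_pgroup p P alpha -> maximal_local_below p Q delta P alpha -> alpha i ->
  exists c, fixed Q c /\ i = gtrace Q P c.
Proof.
move=> [[sPG [i0 prim_i0 def_alpha]] pP] [locQ leQP maxQ] alpha_i.
have algP := fixed_elt_subalg F sPG.
have alpha_prim k : alpha k -> sub_primitive (fixed P) k.
  by rewrite def_alpha; apply: sub_conj_primitive algP prim_i0.
(* The elements of alpha are conjugate, hence share their vertices. *)
suffices [i1 [alpha1 [c [fc def_i1]]]] :
    exists i1, alpha i1 /\ exists c, fixed Q c /\ i1 = gtrace Q P c.
  have [sQP _] := leQP.
  have [A [B [fA fB _ _ ->]]] : sub_conj (fixed P) i1 i.
    rewrite def_alpha in alpha1 alpha_i.
    exact (sub_conj_trans algP (sub_conj_sym alpha1) alpha_i).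
  exists (A * c * B); split.
    have algQ := fixed_elt_subalg F (subset_trans sQP sPG).
    by do !apply: (subalgM algQ) => //; apply: fixed_eltS sQP _.
  by rewrite def_i1 -[A * _ * B]/(A *m _ *m B) gtraceMl // gtraceMr.
clear i alpha_i; case: leQP => sQP [i [j [alpha_i delta_j ij ji]]].
exists i; split=> //.
have [[[sQG [j0 prim_j0 def_delta]] pQ] nz_delta] := locQ.
have algQ := fixed_elt_subalg F sQG.
have prim_j : sub_primitive (fixed Q) j.
  by rewrite def_delta in delta_j; apply: sub_conj_primitive algQ prim_j0 delta_j.
have prim_i := alpha_prim i alpha_i; have [[fi ii] _ _] := prim_i.
have [[fj jj] _ _] := prim_j.
have [R [e [a [b [sRP [prim_e nz_e] [ie ei] [fa fb] def_i]]]]] :=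
  primitive_vertex pP sPG prim_i.
have sRG := subset_trans sRP sPG; have algR := fixed_elt_subalg F sRG.
have [[fe ee] _ _] := prim_e.
have faeb : fixed R (a * e * b) by do !apply: (subalgM algR).
pose X (B : {set gT}) := j * gconj (repr B) (a * e * b) * j.
pose K (B : {set gT}) := (B \in rcosets R P) && (Q \subset (R :^ repr B)%g).
have fgX (B : {set gT}) : K B -> fixed Q (gconj (repr B) (a * e * b)).
  case/andP=> /(repr_rcosets_in sRP) PB sQB.
  apply: (@fixed_eltS _ _ _ Q (R :^ repr B)%G) => //.
  by apply: fixed_elt_conj; rewrite ?(subsetP sPG).
have fX (B : {set gT}) : K B -> sub_corner (fixed Q) j (X B).
  by move/fgX; apply: sub_corner_sandwich.
(* The Brauer image of the relative trace involves only the cosets in [K], so the sum of the [X B]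
   has the same Brauer image as j = j i j. That image is a nonzero idempotent, hence the sum is not
   nilpotent, although it may differ from j. *)
have [B KB nnB] : exists2 B : {set gT}, K B & ~ mx_nilp (X B).
  apply: (primitive_sum_nilp (r := index_enum _) algQ prim_j) => //.
  pose br : {linear 'M[F]_#|G| -> 'M[F]_#|G|} := @brauer_op F gT G Q #|G| aG.
  have brM A B : fixed Q A -> fixed Q B -> br (A * B) = br A * br B.
    exact: brauer_mapM.
  have br_map A : br A = brauer_map Q A by [].
  have br_i : br i = \sum_(B | K B) br (gconj (repr B) (a * e * b)).
    by rewrite {1}def_i /= (brauer_op_gtrace charF).
  clearbody br; have fiQ : fixed Q i := fixed_eltS sQP fi.
  have brX : br (\sum_(B | K B) X B) = br j.
    have -> : br j = br j * br i * br j.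
      by rewrite -!brM //; [rewrite [j * i]ji jj | apply: (subalgM algQ)].
    rewrite linear_sum br_i mulr_sumr mulr_suml; apply: eq_bigr => B /fgX fB.
    by rewrite /X (brM _ _ (subalgM algQ fj fB) fj) (brM _ _ fj fB).
  case=> k Xk0; case/negP: (nz_delta j delta_j); apply/eqP; rewrite -br_map.
  have idem_br : br j * br j = br j by rewrite -brM // jj.
  apply: (idem_nilpF idem_br); exists k; rewrite -brX.
  have brXk A l : fixed Q A -> br (A ^+ l.+1) = br A ^+ l.+1.
    move=> fA; elim: l => [|l IHl]; first by rewrite !expr1.
    by rewrite exprS brM ?IHl -?exprS //; apply: subalgX.
  rewrite -brXk ?Xk0 ?linear0 //; apply: (subalg_sum algQ) => B /fX[].
  by [].
case/andP: KB => RB sQB; have PB := repr_rcosets_in sRP RB.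
set g := repr B in sQB PB nnB; have Gg := subsetP sPG g PB.
have sQRg : Q \subset (R :^ g)%G by [].
have fQ A : fixed R A -> fixed Q (gconj g A).
  by move=> fA; apply: (fixed_eltS sQRg); apply: fixed_elt_conj.
have gM A1 A2 : gconj g (A1 * A2) = gconj g A1 * gconj g A2 by apply: gconjM.
have [j' [conj_j ej je]] : exists j', [/\ sub_conj (fixed Q) j j',
    gconj g e * j' = j' & j' * gconj g e = j'].
  apply: (sub_conj_below algQ prim_j _ (fQ a fa) (fQ b fb)).
    by split; [apply: fQ | rewrite -gM ee].
  by move: nnB; rewrite /X -/g !gM !mulrA.
have pR := pgroupS sRP pP.
have iPg : gconj g i = i by case/(fixed_eltP _ sPG): fi => _; apply.
have [||defR _] := maxQ (R :^ g)%G _ (local_point_gconj sRG pR Gg prim_e nz_e).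
- split; first by rewrite conj_subG.
  exists i, (gconj g e); split=> //.
  + exact: sub_conj_refl (fixed_elt_subalg F (conj_subG Gg sRG)).
  + by rewrite -[_ *m _]/(_ * _) -[in LHS](iPg) -gM [i * e]ie.
  by rewrite -[_ *m _]/(_ * _) -[in LHS](iPg) -gM [e * i]ei.
- split=> //; exists (gconj g e), j'; split=> //.
    exact: sub_conj_refl (fixed_elt_subalg F (conj_subG Gg sRG)).
  by rewrite def_delta in delta_j *; apply: sub_conj_trans delta_j conj_j.
exists (gconj g (a * e * b)); rewrite -defR; split; first exact: fixed_elt_conj.
by rewrite [LHS]def_i gtrace_conj.
Qed.

End MaximalLocal.

(** * Free summands over a p-group *)

Section FreeSummands.

Variables (F : fieldType) (p : nat) (charF : p \in [pchar F]).
Variables (sT : finGroupType) (S : {group sT}).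
Hypothesis pS : p.-group S.
Local Notation aS := (regular_repr F S).
Local Notation regS := (Representation (regular_repr F S)).
Implicit Types X Y Z : representation F S.

Lemma pgroup_fixed_row n (rV : mx_representation F S n) (U : 'M[F]_n) :
    {in S, forall x, (U *m rV x <= U)%MS} -> U != 0 ->
  exists w : 'rV[F]_n, [/\ w != 0, (w <= U)%MS & {in S, forall x, w *m rV x = w}].
Proof.
move=> /mxmoduleP modU U0.
have rU0 : (0 < \rank U)%N by rewrite lt0n mxrank_eq0.
have fix0 := rfix_pgroup_pchar charF (submod_repr modU) rU0 pS (subxx S).
exists (val_submod (nz_row (rfix_mx (submod_repr modU) S))); split.
- by rewrite val_submod_eq0 nz_row_eq0.
- exact: val_submodP.
move=> x Sx; rewrite -(val_submodJ modU) //; congr val_submod.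
exact: (rfix_mxP _ (nz_row_sub _)).
Qed.

Definition norm_mx n (rV : mx_representation F S n) : 'M[F]_n := \sum_(x in S) rV x.

Lemma norm_mxJ n (rV : mx_representation F S n) x : x \in S ->
  rV x *m norm_mx rV = norm_mx rV.
Proof.
move=> Sx; rewrite /norm_mx mulmx_sumr (reindex_inj (mulgI x^-1%g)) /=.
apply: eq_big => [y|y Sy]; first by rewrite groupMl ?groupV.
by rewrite -repr_mxM // mulKVg.
Qed.

Lemma rank_norm_rsim n1 n2 (rX : mx_representation F S n1) (rY : mx_representation F S n2) :
  mx_rsim rX rY -> \rank (norm_mx rX) = \rank (norm_mx rY).
Proof.
suffices le m1 m2 (rZ : mx_representation F S m1) (rW : mx_representation F S m2) :
    mx_rsim rZ rW -> (\rank (norm_mx rZ) <= \rank (norm_mx rW))%N.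
  by move=> simXY; apply/eqP; rewrite eqn_leq !le //; apply: mx_rsim_sym.
case/mx_rsim_def=> B [B' _ homB].
have -> : norm_mx rZ = B *m norm_mx rW *m B'.
  by rewrite /norm_mx mulmx_sumr mulmx_suml; apply: eq_bigr => x /homB.
by rewrite (leq_trans (mxrankM_maxl _ _)) // mxrankM_maxr.
Qed.

Lemma rank_norm_dadd X Y :
  \rank (norm_mx (dadd_grepr X Y)) = (\rank (norm_mx X) + \rank (norm_mx Y))%N.
Proof.
rewrite -rank_diag_block_mx /norm_mx /=; congr (\rank _).
elim/big_rec3: _ => [|x A B C _ ->]; first by rewrite block_mx_const.
by rewrite add_block_mx !addr0.
Qed.

Lemma rank_norm_regular : \rank (norm_mx regS) = 1%N.
Proof.
have -> : norm_mx regS = const_mx 1.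
  apply/matrixP=> i j; rewrite summxE mxE.
  rewrite (bigD1 ((enum_val i)^-1 * enum_val j)%g) ?groupM ?groupV ?enum_valP //=.
  rewrite !mxE mulKVg gring_valK !eqxx big1 ?addr0 // => x /andP[Sx nx].
  rewrite !mxE eqxx /=; case: eqP => // def_j; case/eqP: nx.
  by rewrite def_j gring_indexK ?groupM ?enum_valP // mulKg.
apply/eqP; rewrite eqn_leq; apply/andP; split.
  have -> : const_mx 1 = (const_mx 1 : 'M[F]_(#|S|, 1)) *m (const_mx 1 : 'M[F]_(1, #|S|)).
    by apply/matrixP=> i j; rewrite !mxE big_ord1 !mxE mulr1.
  by rewrite (leq_trans (mxrankM_maxr _ _)) ?rank_leq_row.
rewrite lt0n mxrank_eq0; apply/eqP=> /matrixP/(_ (gring_index S 1) (gring_index S 1)).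
by rewrite !mxE; apply/eqP; rewrite oner_eq0.
Qed.

Lemma rank_norm_muln X k : \rank (norm_mx (muln_grepr X k)) = (k * \rank (norm_mx X))%N.
Proof.
rewrite /muln_grepr; elim: k => [|k IHk]; last by rewrite big_ord_recl rank_norm_dadd IHk.
by rewrite big_ord0; apply/eqP; rewrite -leqn0 rank_leq_row.
Qed.

Lemma rsim_daddr X Y Z : mx_rsim Y Z -> mx_rsim (dadd_grepr X Y) (dadd_grepr X Z).
Proof.
case: Y => nY rY; case: Z => nZ rZ /= [B /= eqn freeB homB].
exists (block_mx 1%:M 0 0 B) => /=; first by rewrite eqn.
  by rewrite /row_free rank_diag_block_mx mxrank1 (eqP freeB).
move=> x Sx; rewrite !mulmx_block !mul0mx !mulmx0 !addr0 !add0r mulmx1 mul1mx.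
by rewrite homB.
Qed.

Lemma rsim_daddA X Y Z :
  mx_rsim (dadd_grepr X (dadd_grepr Y Z)) (dadd_grepr (dadd_grepr X Y) Z).
Proof.
case: X Y Z => [nX rX] [nY rY] [nZ rZ].
exists (block_mx (row_mx 1%:M 0) 0 (col_mx (row_mx 0 1%:M) 0) (col_mx 0 1%:M)) => /=.
- by rewrite addnA.
- apply/row_freeP; exists
    (block_mx (col_mx 1%:M 0) (row_mx (col_mx 0 1%:M) 0) 0 (row_mx 0 1%:M)).
  rewrite mulmx_block mul_row_col mul_mx_row mul_row_col mul_col_mx mul_row_col !mul_col_row.
  rewrite mul_row_col add_block_mx !mul_mx_row !mulmx0 !mul0mx !mulmx1 ?mulmx0 ?addr0 ?add0r.
  rewrite ?row_mx0 ?col_mx0 ?addr0 -?scalar_mx_block //.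
move=> x Sx; rewrite !mulmx_block !mul_mx_row !mul_block_col !mul_col_mx !mul_row_block.
rewrite !mulmx0 !mul0mx !mulmx1 !mul1mx !addr0 !add0r.
by rewrite ?row_mx0 ?col_mx0 ?mul0mx ?mul1mx ?mulmx0 ?addr0 ?add0r mul_mx_row mulmx0 mulmx1.
Qed.

(** A nonzero entry f N v of the norm N defines homomorphisms [B1] from FS to M and [B2] back. A
    nonzero kernel of [B1 *m B2] would contain an S-fixed row, a nonzero multiple of the all-ones
    row, whose image has at 1 that multiple of f N v. So the composite is invertible, and M is the
    sum of the image of [B1] and the kernel of [B2]. *)
Lemma regular_summand n (rM : mx_representation F S n) : norm_mx rM != 0 ->
  exists Y : representation F S, mx_rsim rM (dadd_grepr regS Y).
Proof.
move=> N0; have [[a b] Nab] : exists ab : 'I_n * 'I_n, norm_mx rM ab.1 ab.2 != 0.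
  apply: contrapT => noab; case/eqP: N0; apply/matrixP=> a b; rewrite mxE.
  by apply/eqP; apply: contrapT => /negP nab; apply: noab; exists (a, b).
pose f : 'rV[F]_n := delta_mx 0 a; pose v : 'cV[F]_n := delta_mx b 0.
have fNv : (f *m norm_mx rM *m v) 0 0 != 0.
  by rewrite -rowE -colE !mxE.
pose B1 : 'M[F]_(#|S|, n) := \matrix_i (f *m rM (enum_val i)).
pose B2 : 'M[F]_(n, #|S|) := (\matrix_t (rM (enum_val t)^-1%g *m v)^T)^T.
have colB2 t : col t B2 = rM (enum_val t)^-1%g *m v by rewrite -tr_row rowK trmxK.
have hom1 : {in S, forall x, aS x *m B1 = B1 *m rM x}.
  move=> x Sx; apply/row_matrixP=> i; rewrite !row_mul !rowK -rowE rowK.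
  by rewrite gring_indexK ?groupM ?enum_valP // -mulmxA repr_mxM ?enum_valP.
have colaS x t : x \in S ->
    col t (aS x) = delta_mx (gring_index S (enum_val t * x^-1)%g) 0.
  move=> Sx; apply/matrixP=> i j; rewrite !mxE ord1 !eqxx andbT /=.
  rewrite -(inj_eq (can_inj (@gring_valK _ S))) gring_indexK ?groupM ?enum_valP //.
  rewrite -[i == _](inj_eq (can_inj (@gring_valK _ S))) gring_indexK ?groupM ?groupV ?enum_valP //.
  by rewrite -(inj_eq (mulIg x^-1%g)) mulgK eq_sym.
have hom2 : {in S, forall x, rM x *m B2 = B2 *m aS x}.
  move=> x Sx; apply: trmx_inj; apply/row_matrixP=> t; rewrite -!tr_col; congr (_^T).
  rewrite [LHS]colE -mulmxA -colE [RHS]colE -mulmxA -colE colaS // -colE !colB2.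
  rewrite gring_indexK ?groupM ?groupV ?enum_valP // invMg invgK mulmxA.
  by rewrite repr_mxM ?groupV ?enum_valP.
pose C := B1 *m B2.
have homC : {in S, forall x, aS x *m C = C *m aS x}.
  by move=> x Sx; rewrite mulmxA hom1 // -!mulmxA hom2.
have freeC : row_free C.
  rewrite -kermx_eq0; apply/negPn/negP=> K0.
  have [|w [w0 wK fixw]] := pgroup_fixed_row (rV := aS) _ K0.
    move=> x Sx; rewrite sub_kermx -mulmxA homC // mulmxA mulmx_ker mul0mx //.
  pose c := w 0 (gring_index S 1).
  have wE : w = c *: const_mx 1.
    apply/rowP=> t; rewrite !mxE mulr1; have St : enum_val t \in S by apply: enum_valP.
    have := congr1 (col t) (fixw _ St); rewrite colE -mulmxA -colE colaS // mulgV.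
    by move/matrixP/(_ 0 0); rewrite -colE !mxE => <-.
  have wB1 : w *m B1 = c *: (f *m norm_mx rM).
    rewrite wE -scalemxAl; congr (_ *: _).
    rewrite /norm_mx mulmx_sumr (big_enum_val (fun x => f *m rM x)) /=.
    apply/rowP=> l; rewrite mxE summxE; apply: eq_bigr => i _.
    by rewrite mxE mul1r mxE.
  move: wK; rewrite sub_kermx mulmxA wB1 => /eqP/(congr1 (col (gring_index S 1))).
  rewrite colE -mulmxA -colE colB2 gring_indexK ?group1 // invg1 repr_mx1 mul1mx.
  rewrite -scalemxAl linear0 => /matrixP/(_ 0 0); rewrite [LHS]mxE [RHS]mxE => /eqP.
  rewrite mulf_eq0 (negPf fNv) orbF => /eqP c0.
  by case/eqP: w0; rewrite wE c0 scale0r.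
have unitC : C \in unitmx by rewrite -row_free_unit.
have free1 : row_free B1.
  by apply/row_freeP; exists (B2 *m invmx C); rewrite mulmxA mulmxV.
have modU : mxmodule rM <<B1>>%MS.
  apply/mxmoduleP=> x Sx; rewrite (eqmxMr _ (genmxE _)) genmxE -hom1 //.
  exact: submxMl.
have modK : mxmodule rM (kermx B2).
  apply/mxmoduleP=> x Sx; rewrite sub_kermx -mulmxA hom2 // mulmxA.
  by rewrite mulmx_ker mul0mx.
have modT : mxmodule rM 1%:M := mxmodule1 rM.
exists (Representation (submod_repr modK)).
apply: mx_rsim_trans (mx_rsim_sym (rsim_submod1 modT _)) _ => //.
apply: (mx_rsim_dadd (modU := modU) (modV := modK)); last exact: mx_rsim_refl.
- apply/eqmxP; rewrite submx1 /=; apply/row_subP=> i; move: (row i _) => u.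
  pose z := u *m B2 *m invmx C *m B1.
  rewrite -(subrK z u) addrC addmx_sub_adds ?genmxE ?submxMl // sub_kermx mulmxBl.
  by rewrite /z -(mulmxA _ B1) mulmxKV ?subrr.
- apply/mxdirect_addsP/eqP/rowV0P=> u; rewrite sub_capmx genmxE => /andP[/submxP[z ->]].
  rewrite sub_kermx -mulmxA -/C => zC0.
  suffices -> : z = 0 by rewrite mul0mx.
  by apply/eqP; rewrite -(mulmx_free_eq0 _ freeC).
apply: mx_rsim_sym; exists (in_submod <<B1>>%MS B1).
- by rewrite genmxE; apply/esym/eqP.
- rewrite /row_free mxrank_in_submod ?genmxE //; exact/eqP/eqP.
move=> x Sx /=; rewrite -in_submodJ ?genmxE // -hom1 //.
by rewrite in_submodE [in RHS]in_submodE mulmxA.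
Qed.

Lemma free_summands n (rM : mx_representation F S n) :
  exists Y : representation F S,
    mx_rsim rM (dadd_grepr (muln_grepr regS (\rank (norm_mx rM))) Y).
Proof.
move defk: (\rank _) => k; elim: k n rM defk => [|k IHk] n rM defk.
  exists (Representation rM); rewrite /muln_grepr big_ord0.
  (* The empty sum has degree 0, so the block sum with it is [rM] up to the index shift by 0. *)
  exists 1%:M => //=; first by rewrite row_free_unit unitmx1.
  move=> x Sx; rewrite mulmx1 mul1mx; apply/matrixP=> i j.
  have ri : rshift 0 i = i :> 'I_n by apply: val_inj.
  have rj : rshift 0 j = j :> 'I_n by apply: val_inj.
  by rewrite -[in RHS]ri -[in RHS]rj [RHS]block_mxEdr.
have [|Y simMY] := regular_summand (rM := rM); first by rewrite -mxrank_eq0 defk.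
have rankY : \rank (norm_mx Y) = k.
  have := rank_norm_rsim simMY; rewrite rank_norm_dadd rank_norm_regular defk.
  by rewrite add1n => -[].
have [Z simYZ] := IHk _ Y rankY; exists Z.
apply: mx_rsim_trans simMY _; apply: mx_rsim_trans (rsim_daddr _ simYZ) _.
by rewrite [muln_grepr regS k.+1]/muln_grepr big_ord_recl; apply: rsim_daddA.
Qed.

Lemma nat_max_eq (A : set nat) m : A m -> (forall k, A k -> (k <= m)%N) -> nat_max A = m.
Proof.
move=> Am leA; rewrite /nat_max; case: xgetP => [k _ [Ak lek]|/(_ m)].
  by apply/eqP; rewrite eqn_leq leA //= lek.
by case; split.
Qed.

(** The rank of the norm is additive over direct sums and equals 1 on FS, so it bounds the number of
    free summands; [free_summands] attains the bound. *)
Lemma summand_mult_regular M : summand_mult regS M = \rank (norm_mx M).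
Proof.
apply: nat_max_eq; first exact: free_summands.
move=> k [Y simMY]; rewrite (rank_norm_rsim simMY) rank_norm_dadd rank_norm_muln.
by rewrite rank_norm_regular muln1 leq_addr.
Qed.

End FreeSummands.

(** * Brauer characters determine simple modules *)

Section DiagonalizableEigenvalues.

Variable F : closedFieldType.

Lemma char_poly_uconj n (P D : 'M[F]_n) : P \in unitmx ->
  char_poly (invmx P *m D *m P) = char_poly D.
Proof.
move=> uP; rewrite /char_poly.
have -> : char_poly_mx (invmx P *m D *m P)
    = map_mx polyC (invmx P) *m char_poly_mx D *m map_mx polyC P.
  rewrite /char_poly_mx mulmxBr mulmxBl !map_mxM; congr (_ - _).
  by rewrite scalar_mxC -mulmxA -map_mxM mulVmx // map_mx1 mulmx1.
rewrite !det_mulmx mulrC mulrA -det_mulmx -map_mxM mulmxV //.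
by rewrite map_mx1 det1 mul1r.
Qed.

Lemma eigenvalues_diag n (d : 'rV[F]_n) (P : 'M[F]_n) : P \in unitmx ->
  perm_eq (eigenvalues (invmx P *m diag_mx d *m P)) [seq d 0 i | i <- enum 'I_n].
Proof.
move=> uP; apply: prod_XsubC_eq; rewrite /eigenvalues.
case: closed_field_poly_normal => rs /=.
rewrite char_poly_uconj // (monicP (char_poly_monic _)) scale1r => <-.
rewrite char_poly_trig ?diag_mx_is_trig // big_map big_enum /=.
by apply: eq_bigr => i _; rewrite !mxE eqxx.
Qed.

(** The minimal polynomial divides X^m - 1, which is separable because m is nonzero in F. *)
Lemma finite_order_diag n (A : 'M[F]_n) m : m%:R != 0 :> F -> A ^+ m = 1 ->
  exists P d, P \in unitmx /\ A = invmx P *m diag_mx d *m P.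
Proof.
case: n A => [|n] A m0 Am.
  by exists 1%:M, 0; rewrite unitmx1; split=> //; apply/matrixP=> -[].
have [rs def_rs] := closed_field_poly_normal ('X^m - 1 : {poly F}).
have m_gt0 : (0 < m)%N by case: m m0 {Am def_rs}; rewrite ?eqxx.
rewrite -{1}(expr1n _ m) in def_rs.
have lc1 : lead_coef ('X^m - 1 : {poly F}) = 1.
  by apply/monicP; rewrite -[1]polyC1 monicXnsubC.
rewrite expr1n lc1 scale1r in def_rs.
have /diagonalizableP : exists2 rs, uniq rs & mxminpoly A %| \prod_(x <- rs) ('X - x%:P).
  exists rs; first by rewrite -separable_prod_XsubC -def_rs cyclotomic.separable_Xn_sub_1.
  rewrite -def_rs; apply: mxminpoly_min.
  by rewrite rmorphB rmorphXn /= horner_mx_X rmorph1 Am subrr.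
case=> P uP /(diagonalizable_forLR uP)[d defA].
by exists P, d; split=> //; rewrite defA mxpoly.conjVmx.
Qed.

Lemma diag_conjX n (P : 'M[F]_n) (d : 'rV[F]_n) k : P \in unitmx ->
  (invmx P *m diag_mx d *m P) ^+ k = invmx P *m diag_mx (\row_i d 0 i ^+ k) *m P.
Proof.
move=> uP; elim: k => [|k IHk].
  rewrite expr0 (_ : diag_mx _ = 1%:M) ?mulmx1 ?mulVmx //.
  by apply/matrixP=> i j; rewrite !mxE expr0.
rewrite exprS IHk -mulmxE -!mulmxA mulKVmx //; congr (_ *m _); rewrite mulmxA.
congr (_ *m _); apply/matrixP=> i j; rewrite mul_diag_mx !mxE exprS.
by case: eqP => [->|_]; rewrite ?mulr1n // mulr0n mulr0.
Qed.

Lemma nilp_mxtrace n (A : 'M[F]_n) : mx_nilp A -> \tr A = 0.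
Proof.
case: n A => [|n] A [k Ak0]; first by rewrite /mxtrace big_ord0.
have [rs def_p] := closed_field_poly_normal (char_poly A).
rewrite (monicP (char_poly_monic A)) scale1r in def_p.
have rs0 z : z \in rs -> z = 0.
  move=> rsz; have /eigenvalueP[v vA v0] : eigenvalue A z.
    by rewrite eigenvalue_root_char def_p root_prod_XsubC.
  have vAk l : v *m A ^+ l = z ^+ l *: v.
    elim: l => [|l IHl]; first by rewrite !expr0 mulmx1 scale1r.
    by rewrite exprSr -mulmxE mulmxA IHl -scalemxAl vA scalerA -exprSr.
  have := vAk k.+1; rewrite Ak0 mulmx0 => /esym/eqP.
  by rewrite scaler_eq0 (negPf v0) orbF expf_eq0 => /andP[_ /eqP].
have def_Xn : char_poly A = 'X^(size rs).
  rewrite def_p (eq_big_seq (fun _ => 'X)) => [|z /rs0->]; last by rewrite subr0.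
  by rewrite big_const_seq count_predT iter_mulr_1.
have := char_poly_trace A isT; rewrite def_Xn coefXn.
have := size_char_poly A; rewrite def_Xn size_polyXn => -[->].
by rewrite /= ltn_eqF // => /esym/eqP; rewrite oppr_eq0 => /eqP.
Qed.

End DiagonalizableEigenvalues.

(** Fourier inversion on the m-th roots of unity: the sum over k < m of w^-k times the k-th power
    sum is m times the multiplicity of w. *)
Lemma power_sums_perm_eq (s t : seq algC) m : (0 < m)%N ->
    {in s ++ t, forall z, z ^+ m = 1} ->
    (forall k, \sum_(z <- s) z ^+ k = \sum_(z <- t) z ^+ k) ->
  perm_eq s t.
Proof.
move=> m_gt0 root1 eq_sums; apply/allP=> w st_w /=; apply/eqP.
have count_sum (r : seq algC) : {subset r <= s ++ t} ->
    \sum_(k < m) w ^- k * \sum_(z <- r) z ^+ k = m%:R * (count_mem w r)%:R.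
  move=> sub_r; under eq_bigr => k _ do rewrite mulr_sumr.
  rewrite exchange_big /= -sum1_count natr_sum mulr_sumr big_mkcond [RHS]big_mkcond /=.
  rewrite big_seq [RHS]big_seq; apply: eq_bigr => z /sub_r/root1 zm.
  have w0 : w != 0.
    apply/eqP=> w0; have := root1 w st_w; rewrite w0 expr0n gtn_eqF // => /esym/eqP.
    by rewrite oner_eq0.
  under eq_bigr => k _ do rewrite -exprVn -exprMn.
  have [->|zw] := eqVneq z w.
    by rewrite mulVf //; under eq_bigr => k _ do rewrite expr1n; rewrite sumr_const card_ord mulr1.
  apply/eqP; have: (w^-1 * z - 1) * \sum_(k < m) (w^-1 * z) ^+ k == 0.
    by rewrite -subrX1 exprMn exprVn root1 // zm invr1 mulr1 subrr.
  rewrite mulf_eq0 subr_eq0 => /orP[/eqP wz|//].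
  by case/eqP: zw; rewrite -[z]mul1r -(divff w0) -mulrA wz mulr1.
have eq_count : m%:R * (count_mem w s)%:R = m%:R * (count_mem w t)%:R :> algC.
  rewrite -!count_sum.
  - by apply: eq_bigr => k _; rewrite eq_sums.
  - by move=> z tz; rewrite mem_cat tz orbT.
  - by move=> z sz; rewrite mem_cat sz.
apply/eqP; rewrite -(Num.Theory.eqr_nat algC); apply/eqP; apply: mulfI eq_count.
by rewrite Num.Theory.pnatr_eq0 -lt0n.
Qed.

Section BrauerCharacterTraces.

Variables (F : closedFieldType) (p : nat) (lam : root_lift F).
Hypothesis charF : p \in [pchar F].
Variables (gT : finGroupType) (L : {group gT}).

Lemma lift_rootX m y k : (0 < m)%N -> y ^+ m = 1 -> lam (y ^+ k) = lam y ^+ k.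
Proof.
move=> m_gt0 ym; elim: k => [|k IHk]; first by rewrite !expr0 lift_root1.
rewrite !exprS (lift_rootM lam m_gt0) ?IHk //.
by rewrite -exprM mulnC exprM ym expr1n.
Qed.

Lemma repr_mx_exp n (rV : mx_representation F L n) x k : x \in L ->
  rV (x ^+ k)%g = rV x ^+ k.
Proof.
move=> Lx; elim: k => [|k IHk]; first by rewrite expg0 repr_mx1.
by rewrite expgS exprS repr_mxM ?groupX // IHk.
Qed.

Lemma p'elt_order_neq0 (x : gT) : p^'.-elt x -> #[x]%:R != 0 :> F.
Proof.
move=> p'x; rewrite -(dvdn_pcharf charF); apply: contraL p'x => p_x.
have pr_p := pcharf_prime charF.
rewrite /p_elt p'natE // negbK; exact: p_x.
Qed.

(** Diagonalizing rV x once yields a single list for all powers of x, so the values of the Brauer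
    character on the powers are the power sums of the lifted eigenvalues. *)
Lemma brauer_char_eigen n (rV : mx_representation F L n) x : x \in L -> p^'.-elt x ->
  exists2 d : seq F, {in d, forall z, z ^+ #[x] = 1} /\ \tr (rV x) = \sum_(z <- d) z &
    forall k, brauer_char p lam rV (x ^+ k)%g = \sum_(z <- d) lam z ^+ k.
Proof.
move=> Lx p'x; have m_gt0 := order_gt0 x.
have Am : rV x ^+ #[x] = 1 by rewrite -repr_mx_exp // expg_order repr_mx1.
have [P [d [uP defA]]] := finite_order_diag (p'elt_order_neq0 p'x) Am.
have dm i : d 0 i ^+ #[x] = 1.
  have := Am; rewrite defA diag_conjX // => /(congr1 (fun B => P *m B *m invmx P)).
  rewrite !mulmxA mulmxV // mul1mx mulmxK // [_ *m 1](mulmx1 P) mulmxV //.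
  by move/matrixP/(_ i i); rewrite !mxE eqxx.
exists [seq d 0 i | i <- enum 'I_n]; first split.
- by move=> _ /mapP[i _ ->].
- rewrite defA mxtrace_mulC mulmxA mulmxV // mul1mx mxtrace_diag.
  by rewrite big_map big_enum.
move=> k; rewrite ffunE groupX //= p_eltX // repr_mx_exp // defA diag_conjX //.
rewrite (perm_big _ (eigenvalues_diag _ uP)) /= !big_map.
by apply: eq_bigr => i _; rewrite mxE (lift_rootX _ m_gt0).
Qed.

(** Power sums determine the lifted eigenvalues with multiplicity, and the lift is injective on
    roots of unity of a given order, so the eigenvalues in F agree as well. *)
Lemma brauer_char_trace_p' n1 n2 (rV : mx_representation F L n1)
    (rW : mx_representation F L n2) x :
  brauer_char p lam rV = brauer_char p lam rW -> x \in L -> p^'.-elt x ->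
  \tr (rV x) = \tr (rW x).
Proof.
move=> eqVW Lx p'x; have m_gt0 := order_gt0 x.
have [d [d1 ->] dsum] := brauer_char_eigen rV Lx p'x.
have [e [e1 ->] esum] := brauer_char_eigen rW Lx p'x.
suffices /(perm_big _)-> : perm_eq d e by [].
have de1 z : z \in d ++ e -> z ^+ #[x] = 1 by rewrite mem_cat => /orP[/d1|/e1].
have perm_lam : perm_eq (map lam d) (map lam e).
  apply: (@power_sums_perm_eq _ _ #[x]) => // [z|k].
    rewrite -map_cat => /mapP[y /de1 ym ->].
    by rewrite -(lift_rootX _ m_gt0) // ym lift_root1.
  by rewrite !big_map -dsum -esum eqVW.
apply/allP=> z dez /=; apply/eqP.
have count_lam r : {subset r <= d ++ e} -> count_mem z r = count_mem (lam z) (map lam r).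
  move=> sub_r; rewrite count_map; apply: eq_in_count => y /sub_r/de1 ym /=.
  apply/eqP/eqP=> [->//|]; exact: (lift_root_inj m_gt0 ym (de1 z dez)).
rewrite !count_lam; first exact: (seq.permP perm_lam).
  by move=> y ey; rewrite mem_cat ey orbT.
by move=> y dy; rewrite mem_cat dy.
Qed.

(** Write x = u v with u the p-part. In characteristic p the matrix of u minus 1 is nilpotent and
    commutes with that of v, so x and v differ by a nilpotent matrix, of trace 0. *)
Lemma mxtrace_p'part n (rV : mx_representation F L n) x : x \in L ->
  \tr (rV x) = \tr (rV x.`_p^'%g).
Proof.
move=> Lx; have pr_p := pcharf_prime charF.
have Lxp pi : (x.`_pi)%g \in L by rewrite groupX.
set u := (x.`_p)%g; set v := (x.`_p^')%g.
have cuv : commute u v by apply: commuteX2.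
have Lu : u \in L by apply: Lxp.
have Lv : v \in L by apply: Lxp.
have -> : rV x = (rV u - 1) * rV v + rV v.
  by rewrite mulrBl mul1r subrK -[_ * _]/(_ *m _) -repr_mxM // /u /v consttC.
rewrite mxtraceD nilp_mxtrace ?add0r //.
have [k ou] : exists k, #[u] = (p ^ k)%N.
  by have /p_natP[k ->] : p.-nat #[u] := p_elt_constt _ _; exists k.
case: n rV => [|n] rV; first by exists 0%N; apply/matrixP=> -[].
have u1 : (rV u - 1) ^+ (p ^ k) = 0.
  have pk : ([pchar {poly F}]).-nat (p ^ k)%N.
    by rewrite (eq_pnat _ (pchar_poly _)) pnatX pnatE ?charF.
  (* Additivity of the p^k-th power is used in the commutative ring of polynomials and then
     evaluated at [rV u]. *)
  have := congr1 (horner_mx (rV u)) (exprDn_pchar ('X - 1) 1 pk).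
  rewrite subrK expr1n rmorphD !rmorphXn rmorphB /= horner_mx_X rmorph1.
  by rewrite -repr_mx_exp // -ou expg_order repr_mx1 => /esym/(canRL (addrK _)) ->; rewrite subrr.
exists (p ^ k).-1; rewrite prednK ?expn_gt0 ?prime_gt0 //.
have cAB : GRing.comm (rV u - 1) (rV v).
  rewrite /GRing.comm mulrBl mulrBr mul1r mulr1; congr (_ - _).
  by rewrite -![_ * _]/(_ *m _) -!repr_mxM // cuv.
by rewrite exprMn_comm // u1 mul0r.
Qed.

Lemma brauer_char_trace n1 n2 (rV : mx_representation F L n1)
    (rW : mx_representation F L n2) :
  brauer_char p lam rV = brauer_char p lam rW ->
  {in L, forall x, \tr (rV x) = \tr (rW x)}.
Proof.
move=> eqVW x Lx; rewrite (mxtrace_p'part rV Lx) (mxtrace_p'part rW Lx).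
by apply: brauer_char_trace_p' => //; [rewrite groupX | apply: p_elt_constt].
Qed.

End BrauerCharacterTraces.

Section TracesDetermineSimples.

Variables (F : closedFieldType) (gT : finGroupType) (L : {group gT}).
Local Notation aL := (regular_repr F L).
Local Notation FL := (group_ring F L).

Lemma gring_opZ n (rV : mx_representation F L n) c x : x \in L ->
  gring_op rV (c *: aL x) = c *: rV x.
Proof. by move=> Lx; rewrite linearZ /= gring_opG. Qed.

Lemma irr_gring_full n (rV : mx_representation F L n) : mx_irreducible rV ->
  forall A : 'M[F]_n, exists2 u, (u \in FL)%MS & gring_op rV u = A.
Proof.
move/group_closure_closed_field/mx_abs_irrP=> [_ [a_ defA]] A.
exists (\sum_(x in L) a_ x A *: aL x).
  by rewrite linear_sum summx_sub // => x Lx; rewrite linearZ scalemx_sub ?envelop_mx_id.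
rewrite linear_sum [RHS]defA; apply: eq_bigr => x Lx.
by rewrite linearZ /= gring_opG.
Qed.

Lemma trace_form_nondeg n (A : 'M[F]_n) : (forall B, \tr (A *m B) = 0) -> A = 0.
Proof.
move=> A0; apply/matrixP=> i j; rewrite mxE; have := A0 (delta_mx j i).
rewrite /mxtrace (bigD1 i) //= mxE (bigD1 j) //= mxE !eqxx mulr1.
rewrite big1 ?addr0 => [|l /negPf nlj]; last by rewrite mxE nlj mulr0.
rewrite big1 ?addr0 // => l /negPf nli; rewrite mxE big1 // => k _.
by rewrite mxE nli andbF mulr0.
Qed.

(** By Burnside's theorem FL maps onto all matrices, so equal traces and nondegeneracy of the trace
    form show that whatever V kills, W kills. Elements a and u_i of FL acting on V as matrix units
    E_00 and E_0i then give rows w a u_i that transform under L like the standard basis of V. *)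
Lemma trace_rsim n1 n2 (rV : mx_representation F L n1) (rW : mx_representation F L n2) :
  mx_irreducible rV -> mx_irreducible rW ->
  {in L, forall x, \tr (rV x) = \tr (rW x)} -> mx_rsim rV rW.
Proof.
move=> irrV irrW trVW.
have tr_op u : (u \in FL)%MS -> \tr (gring_op rV u) = \tr (gring_op rW u).
  case/envelop_mxP=> c ->; rewrite !linear_sum /=.
  apply: eq_bigr => x Lx; rewrite !gring_opZ //.
  by rewrite !mxtraceZ trVW.
have opVM u v : (v \in FL)%MS -> gring_op rV (u *m v) = gring_op rV u *m gring_op rV v.
  by move=> FLv; rewrite gring_opM.
have opWM u v : (v \in FL)%MS -> gring_op rW (u *m v) = gring_op rW u *m gring_op rW v.
  by move=> FLv; rewrite gring_opM.
have ker u : (u \in FL)%MS -> gring_op rV u = 0 -> gring_op rW u = 0.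
  move=> FLu Vu0; apply: trace_form_nondeg => B.
  have [y FLy <-] := irr_gring_full irrW B.
  by rewrite -opWM // -tr_op ?envelop_mxM // opVM // Vu0 mul0mx mxtrace0.
have [n_gt0 _] := proj1 (mx_irrP _) irrV; pose i0 : 'I_n1 := Ordinal n_gt0.
have [a FLa Va] := irr_gring_full irrV (delta_mx i0 i0).
have Wa0 : gring_op rW a != 0.
  apply: contra_eq_neq (tr_op a FLa) => ->; rewrite Va mxtrace0.
  rewrite /mxtrace (bigD1 i0) //= mxE !eqxx big1 ?addr0 ?oner_eq0 // => j /negPf nj.
  by rewrite mxE nj.
have [w w0] : exists w : 'rV_n2, w *m gring_op rW a != 0.
  apply: contrapT => no_w; case/eqP: Wa0; apply/row_matrixP=> i; rewrite row0 rowE.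
  by apply/eqP; apply: contrapT => /negP nz; apply: no_w; exists (delta_mx 0 i).
have /boolp.choice[u uP] : forall i : 'I_n1, exists ui : 'M[F]_#|L|,
    (ui \in FL)%MS /\ gring_op rV ui = delta_mx i0 i.
  by move=> i; have [ui ? ?] := irr_gring_full irrV (delta_mx i0 i); exists ui.
pose B : 'M[F]_(n1, n2) := \matrix_i (w *m gring_op rW (a *m u i)).
have homB : {in L, forall x, rV x *m B = B *m rW x}.
  move=> x Lx; apply/row_matrixP=> i; rewrite !row_mul rowK.
  (* This is the relation E_0i x = sum_j x_ij E_0j, valid on V and therefore, after multiplication
     by a, on W. *)
  pose y := \sum_j rV x i j *: u j - u i *m aL x.
  have FLux : (u i *m aL x \in FL)%MS.
    by rewrite envelop_mxM ?envelop_mx_id //; case: (uP i).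
  have FLy : (y \in FL)%MS.
    rewrite linearB /= addmx_sub ?eqmx_opp // linear_sum summx_sub // => j _.
    by rewrite linearZ scalemx_sub //; case: (uP j).
  have Vy0 : gring_op rV y = 0.
    rewrite linearB linear_sum /= opVM ?envelop_mx_id //.
    rewrite [gring_op rV (aL x)]gring_opG //; have [_ ->] := uP i.
    apply/eqP; rewrite subr_eq0; apply/eqP/matrixP=> b c.
    rewrite summxE [RHS]mxE (bigD1 c) //= [RHS](bigD1 i) //=.
    rewrite linearZ /= (proj2 (uP c)) !mxE !eqxx andbT mulrC; congr (_ + _).
    rewrite !big1 // => l /negPf nl; first by rewrite mxE nl andbF mul0r.
    by rewrite linearZ /= (proj2 (uP l)) !mxE (eq_sym c) nl andbF mulr0.
  have := ker _ (envelop_mxM FLa FLy); rewrite opVM // Vy0 mulmx0 => /(_ erefl).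
  rewrite opWM // linearB linear_sum /= => /(congr1 (mulmx w)).
  rewrite mulmx0 mulmxBr mulmxBr => /eqP; rewrite subr_eq0 => /eqP.
  rewrite opWM ?envelop_mx_id // [gring_op rW (aL x)]gring_opG // => yE.
  rewrite -mulmxA opWM; last by case: (uP i).
  rewrite -mulmxA -yE mulmx_sum_row !mulmx_sumr; apply: eq_bigr => j _.
  by rewrite linearZ /= rowK mxE opWM -?scalemxAr //; case: (uP j).
have B0 : B != 0.
  apply: contraNneq w0 => B0; have [FLu0 Vu0] := uP i0.
  have := congr1 (row i0) B0; rewrite rowK row0 => <-; apply/eqP; congr (_ *m _).
  apply/eqP; rewrite -subr_eq0 -linearB; apply/eqP/ker.
    by rewrite linearB /= addmx_sub ?eqmx_opp ?envelop_mxM.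
  by rewrite linearB /= opVM // Va Vu0 mul_delta_mx subrr.
have freeB : row_free B.
  rewrite -kermx_eq0; apply/negPn/negP=> K0.
  have modK : mxmodule rV (kermx B).
    apply/mxmoduleP=> x Lx; rewrite sub_kermx -mulmxA homB // mulmxA.
    by rewrite mulmx_ker mul0mx.
  have fullK := (proj2 (proj1 (mx_irrP _) irrV)) _ modK K0.
  case/eqP: B0; have [K' K'K] := row_fullP fullK.
  by rewrite -[B]mul1mx -K'K -mulmxA mulmx_ker mulmx0.
have fullB : row_full B.
  have modB : mxmodule rW <<B>>%MS.
    apply/mxmoduleP=> x Lx; rewrite (eqmxMr _ (genmxE _)) genmxE -homB //.
    exact: submxMl.
  have nzB : <<B>>%MS != 0 by rewrite (eqmx_eq0 (genmxE B)).
  have := (proj2 (proj1 (mx_irrP _) irrW)) _ modB nzB.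
  by rewrite /row_full genmxE.
exists B; [by rewrite -(eqP freeB) (eqP fullB) | exact: freeB | exact: homB].
Qed.

Lemma brauer_char_rsim p (lam : root_lift F) n1 n2 (rV : mx_representation F L n1)
    (rW : mx_representation F L n2) : p \in [pchar F] ->
  mx_irreducible rV -> mx_irreducible rW ->
  brauer_char p lam rV = brauer_char p lam rW -> mx_rsim rV rW.
Proof.
by move=> charF irrV irrW eqVW; apply: trace_rsim => //; apply: brauer_char_trace eqVW.
Qed.

End TracesDetermineSimples.

(** * Projective covers and induction *)

Section FrobeniusReciprocity.

Variables (F : fieldType) (gT : finGroupType) (L K : {group gT}).
Hypothesis sKL : K \subset L.
Variables (n : nat) (rN : mx_representation F K n).
Variables (m : nat) (rV : mx_representation F L m).

(** Frobenius reciprocity: c is the block of C at the trivial coset K. The block at the coset of t_j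
    is rV t_j times c, so c = 0 would force C = 0. *)
Lemma ind_hom_restrict C : mx_hom (ind_repr sKL rN) rV C -> C != 0 ->
  exists c : 'M[F]_(m, n), [/\ c != 0 & {in K, forall x, c *m rN x = rV x *m c}].
Proof.
move=> homC C0.
have blockE g j : g \in L ->
    \sum_i submxrow C i *m (if ((ind_rep i)^-1 * g * ind_rep j)%g \in K
                  then rN ((ind_rep i)^-1 * g * ind_rep j)%g else 0)
    = rV g *m submxrow C j.
  move=> Lg; rewrite mul_submxrow -homC // -[C in RHS]submxrowK /= /ind_mx.
  by rewrite mul_mxrow_mxblock mxrowK.
have K_coset : (K : {set gT}) \in lcosets K L by apply/lcosetsP; exists 1%g; rewrite ?lcoset1.
pose i0 := enum_rank_in K_coset (K : {set gT}).
have i0E : enum_val i0 = K by rewrite enum_rankK_in.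
have t0 : ind_rep i0 = 1%g by rewrite /ind_rep i0E repr_group.
have single g j l : g \in L -> ((ind_rep l)^-1 * g * ind_rep j)%g \in K ->
    submxrow C l *m rN ((ind_rep l)^-1 * g * ind_rep j)%g = rV g *m submxrow C j.
  move=> Lg Kl; rewrite -blockE // (bigD1 l) //= Kl big1 ?addr0 // => i nil.
  case: ifP => [Ki|_]; last exact: mulmx0.
  case/eqP: nil; apply: enum_val_inj.
  move: Ki Kl; rewrite -!mulgA !ind_rep_eq => /eqP e1 /eqP e2.
  exact: etrans (esym e1) e2.
pose c : 'M[F]_(m, n) := submxrow C i0.
exists c; split; last first.
  move=> x Kx; have Lx := subsetP sKL x Kx.
  by have := single x i0 i0 Lx; rewrite t0 invg1 mul1g mulg1 => H; apply: H.
apply: contra_neq C0 => c0; apply/mxrowP=> j; rewrite submxrow0.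
have Lj := ind_rep_in sKL j.
have := single (ind_rep j) i0 j Lj; rewrite t0 mulg1 mulVg group1 => H; move: (H isT).
by rewrite repr_mx1 mulmx1 => ->; rewrite -/c c0 mulmx0.
Qed.

End FrobeniusReciprocity.

Section ProjectiveCovers.

Variables (F : fieldType) (gT : finGroupType).
Implicit Types L K : {group gT}.

(* An essential epimorphism onto a simple module kills the kernel of any
   nonzero map, since that kernel is a proper submodule. *)
Lemma essential_kernel L n m (rE : mx_representation F L n)
    (rV : mx_representation F L m) B (h : nat) (rW : gT -> 'M[F]_h) (c : 'M[F]_(h, n)) :
    essential_epi rE rV B -> mx_irreducible rV -> c != 0 ->
    {in L, forall x, c *m rE x = rW x *m c} ->
  forall v : 'cV[F]_n, c *m v = 0 -> B *m v = 0.
Proof.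
move=> [[homB freeB] essB] irrV c0 homc.
pose D := (row_base (kermx c^T))^T.
have cD0 : c *m D = 0.
  apply: trmx_inj; rewrite trmx_mul trmxK trmx0; apply/sub_kermxP.
  by rewrite eq_row_base.
have sub_D (k : nat) (A : 'M[F]_(n, k)) : c *m A = 0 -> exists Z, A = D *m Z.
  move=> cA0; have : (A^T <= row_base (kermx c^T))%MS.
    by rewrite eq_row_base sub_kermx -trmx_mul cA0 trmx0.
  by case/submxP=> Z AZ; exists Z^T; rewrite -[A]trmxK AZ trmx_mul.
have [D' D'D] : exists D', D' *m D = 1%:M.
  have /row_freeP[D' DD'] := row_base_free (kermx c^T); exists D'^T.
  by rewrite -trmx_mul DD' trmx1.
have ED x : x \in L -> rE x *m D = D *m (D' *m rE x *m D).
  move=> Lx; have [Z EZ] : exists Z, rE x *m D = D *m Z.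
    by apply: sub_D; rewrite mulmxA homc // -mulmxA cD0 mulmx0.
  by rewrite -(mulmxA D') EZ (mulmxA D') D'D mul1mx.
have rX_repr : mx_repr L (fun x => D' *m rE x *m D).
  split=> [|x y Lx Ly]; first by rewrite repr_mx1 mulmx1.
  by rewrite repr_mxM // mulmxA -(mulmxA _ _ D) ED // !mulmxA.
pose rX := MxRepresentation rX_repr.
have homD : mx_hom rX rE D by move=> x Lx; rewrite ED.
suffices BD0 : B *m D = 0.
  by move=> v /sub_D[Z ->]; rewrite mulmxA BD0 mul0mx.
apply: contrapT => /eqP BD0; case/eqP: c0.
have freeBD : row_free (B *m D).
  rewrite -kermx_eq0; apply/negPn/negP=> K0.
  have modK : mxmodule rV (kermx (B *m D)).
    apply/mxmoduleP=> x Lx; rewrite sub_kermx -mulmxA (mulmxA _ B) -homB //.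
    by rewrite -(mulmxA B) -homD // !mulmxA -(mulmxA _ B D) mulmx_ker !mul0mx.
  have fullK := (proj2 (proj1 (mx_irrP _) irrV)) _ modK K0.
  case/eqP: BD0; have [K' K'K] := row_fullP fullK.
  by rewrite -[B *m D]mul1mx -K'K -mulmxA mulmx_ker mulmx0.
have /row_freeP[Z DZ] := essB _ rX D homD freeBD.
by rewrite -[c]mulmx1 -DZ mulmxA cD0 mul0mx.
Qed.

Section Twist.

Variables (L L' : {group gT}) (x : gT).
Hypothesis defL' : L' :=: (L :^ x)%g.

Lemma twist_mem y : y \in L' -> (y ^ x^-1)%g \in L.
Proof. by rewrite defL' mem_conjg. Qed.

Lemma twist_repr_subproof n (rV : mx_representation F L n) :
  mx_repr L' (fun y => rV (y ^ x^-1)%g).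
Proof.
split=> [|y z Ly Lz]; first by rewrite conj1g repr_mx1.
by rewrite conjMg repr_mxM ?twist_mem.
Qed.
(** The target group [L'] is a variable tied to L^x by an equation because it is instantiated by the
    centralizer of Q^x, which is only provably equal to the conjugate of that of Q. *)
Definition twist_repr n (rV : mx_representation F L n) : mx_representation F L' n :=
  MxRepresentation (twist_repr_subproof rV).

End Twist.

Lemma twist_hom L L' x (defL' : L' :=: (L :^ x)%g) n m (rV : mx_representation F L n)
    (rW : mx_representation F L m) B :
  mx_hom rV rW B -> mx_hom (twist_repr defL' rV) (twist_repr defL' rW) B.
Proof. by move=> homB y Ly /=; apply/homB/(twist_mem defL'). Qed.

Lemma twist_irr L L' x (defL' : L' :=: (L :^ x)%g) n (rV : mx_representation F L n) :
  mx_irreducible rV -> mx_irreducible (twist_repr defL' rV).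
Proof.
move=> irrV; apply/mx_irrP; have [n_gt0 irr] := proj1 (mx_irrP _) irrV; split=> // U modU.
apply: irr; apply/mxmoduleP=> z Lz; have Lzx : (z ^ x)%g \in L' by rewrite defL' memJ_conjg.
by have := mxmoduleP modU _ Lzx; rewrite /= conjgK.
Qed.

Lemma twist_hom_back L L' x (defL' : L' :=: (L :^ x)%g) (defL : L :=: (L' :^ x^-1)%g)
    n m (rV : mx_representation F L n) (rW : mx_representation F L' m) B :
  mx_hom rV (twist_repr defL rW) B <-> mx_hom (twist_repr defL' rV) rW B.
Proof.
split=> homB y Ly /=.
  by have := homB _ (twist_mem defL' Ly); rewrite /= invgK conjgKV.
by have := homB _ (twist_mem defL Ly); rewrite /= invgK conjgK.
Qed.

(** Serves to change the representative of a generalized piece: a cover is known for one pair only,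
    and [proj_module] is meaningful for a conjugate pair once some cover exists there. *)
Lemma proj_cover_twist L L' x (defL' : L' :=: (L :^ x)%g) n m m'
    (rP : mx_representation F L n) (rV : mx_representation F L m)
    (rV' : mx_representation F L' m') :
  proj_cover rP rV -> mx_rsim rV' (twist_repr defL' rV) ->
  proj_cover (twist_repr defL' rP) rV'.
Proof.
move=> [projP [E [[homE freeE] essE]]] [B eqm freeB homB].
have defL : L :=: (L' :^ x^-1)%g by rewrite defL' conjsgK.
have back k l (rX : mx_representation F L' k) (rY : mx_representation F L' l) C :
    mx_hom rX rY C -> mx_hom (twist_repr defL rX) (twist_repr defL rY) C.
  exact: twist_hom.
have fullB : row_full B by rewrite /row_full (eqP freeB) eqm.
split.
  move=> m1 m2 rX rY C1 C2 [homC1 freeC1] homC2.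
  have [D homD CD] := projP _ _ _ _ C1 C2 (conj (back _ _ _ _ _ homC1) freeC1)
     (proj2 (twist_hom_back defL' defL rP rY C2) homC2).
  by exists D => //; apply: (proj1 (twist_hom_back defL' defL rP rX D)).
have homBE : mx_hom (twist_repr defL' rP) rV' (B *m E).
  by move=> y Ly; rewrite -mulmxA (twist_hom defL' homE Ly) mulmxA -homB // -mulmxA.
exists (B *m E); split; first split=> //.
  by rewrite /row_free mxrankMfree.
move=> k rX D homD freeBED.
apply: (essE _ (twist_repr defL rX) D).
  move=> z Lz /=; rewrite invgK; have Lzx : (z ^ x)%g \in L' by rewrite defL' memJ_conjg.
  by rewrite homD //= conjgK.
move: freeBED; rewrite -mulmxA /row_free eqmxMfull // eqm; exact.
Qed.

End ProjectiveCovers.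

Section ChosenModules.

Variables (F : closedFieldType) (p : nat) (lam : root_lift F).
Hypothesis charF : p \in [pchar F].
Variables (gT : finGroupType).
Implicit Types (L : {group gT}) (xi : {ffun gT -> algC}).

Lemma simple_moduleP L xi : irr_brauer p lam L xi ->
  mx_irreducible (simple_module p lam L xi) /\
  brauer_char p lam (simple_module p lam L xi) = xi.
Proof.
rewrite /simple_module => -[V PV]; case: xgetP => [W _ //|noV].
by case: (noV V PV).
Qed.

Lemma simple_module_grepr0 L xi : ~ irr_brauer p lam L xi ->
  simple_module p lam L xi = grepr0.
Proof.
rewrite /simple_module => no_xi; case: xgetP => [W _ PW|//].
by case: no_xi; exists W.
Qed.

Lemma proj_moduleP L xi (E : representation F L) :
  proj_cover E (simple_module p lam L xi) ->
  proj_cover (proj_module p lam L xi) (simple_module p lam L xi).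
Proof.
rewrite /proj_module => covE; case: xgetP => [W _ //|noE].
by case: (noE E covE).
Qed.

(** The default value has degree 0, so a positive degree certifies that the choice of a cover
    succeeded. *)
Lemma proj_module_pos L xi : (0 < rdegree (proj_module p lam L xi))%N ->
  proj_cover (proj_module p lam L xi) (simple_module p lam L xi).
Proof.
by rewrite /proj_module; case: xgetP.
Qed.

Lemma irr_degree_gt0 L n (rV : mx_representation F L n) : mx_irreducible rV -> (0 < n)%N.
Proof. by move=> irrV; have [] := proj1 (mx_irrP _) irrV. Qed.

Lemma brauer_char1 L n (rV : mx_representation F L n) : brauer_char p lam rV 1%g = n%:R.
Proof.
rewrite ffunE group1 p_elt1 /= repr_mx1.
have perm1 := eigenvalues_diag (const_mx 1 : 'rV[F]_n) (unitmx1 F n).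
rewrite diag_const_mx mulmx1 mulVmx ?unitmx1 // in perm1.
rewrite (perm_big _ perm1) /= big_map (eq_bigr (fun _ => 1)) => [|i _]; last first.
  by rewrite mxE lift_root1.
by rewrite big_enum sumr_const card_ord.
Qed.

End ChosenModules.

(** * From the correspondence of local points and pieces to simple modules *)

Section LocalPointsAndPieces.

Variables (F : closedFieldType) (p : nat) (lam : root_lift F).
Hypothesis charF : p \in [pchar F].
Variables (gT : finGroupType) (G : {group gT}).
Local Notation aG := (regular_repr F G).
Local Notation fixed := (@fixed_elt F gT G).
Implicit Types (P Q : {group gT}) (T : piece p lam G).

Lemma brauer_op_hom Q n m (h : gT -> 'M[F]_n) (k : gT -> 'M[F]_m) (B : 'M[F]_(m, n))
    (A : 'M[F]_#|G|) :
  {in 'C_G(Q), forall x, B *m h x = k x *m B} ->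
  B *m brauer_op Q h A = brauer_op Q k A *m B.
Proof.
move=> homB; rewrite /brauer_op mulmx_sumr mulmx_suml.
by apply: eq_bigr => x Cx; rewrite -scalemxAr -scalemxAl homB.
Qed.

(** The ideal generated by b = br(j) is nonzero, so E(phi) is not the default and covers V. The
    vector v0 matching b generates E(phi) and is fixed by b; its image in V is therefore nonzero and
    fixed by b. *)
Lemma left_ideal_cover T (j : 'M[F]_#|G|) :
    fixed (piece_group T) j -> j *m j = j -> brauer_map (piece_group T) j != 0 ->
    left_ideal_rsim (subsetIl G 'C(piece_group T))
      (proj_module p lam 'C_G(piece_group T)%G (piece_char T))
      (brauer_map (piece_group T) j) ->
  let V := simple_module p lam 'C_G(piece_group T)%G (piece_char T) in
  (exists E : representation F 'C_G(piece_group T)%G, proj_cover E V) /\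
  brauer_op (piece_group T) V j != 0.
Proof.
set Q := piece_group T; set E := proj_module _ _ _ _.
move=> fj jj b0 [f [injf homf imf]] V; have pQ : p.-group Q := piece_pgroup T.
have sQG : Q \subset G := piece_sub T; set b := brauer_map Q j in b0 homf imf.
have [v0 fv0] : exists v, f v = b.
  apply/imf; exists 1%:M; last by rewrite mul1mx.
  exact: envelop_mx1.
have E_gt0 : (0 < rdegree E)%N.
  rewrite ltnNge; apply: contra_neqN b0 => E_le0; rewrite -fv0.
  rewrite (_ : v0 = 0) ?linear0 //; apply/matrixP=> i.
  by have := leq_trans (leq_ltn_trans (leq0n i) (ltn_ord i)) E_le0.
have covE : proj_cover E V := proj_module_pos E_gt0.
split; first by exists E.
have [irrV _] : mx_irreducible V /\ _ := simple_moduleP (piece_irr T).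
have [_ [B [[homB freeB] _]]] := covE.
have bb : b *m b = b by rewrite -(brauer_mapM charF) // jj.
have jv0 : brauer_op Q E j *m v0 = v0.
  have bbE : b *m b = \sum_(x in 'C_G(Q)) gcoef j x *: (aG x *m b).
    rewrite {1}/b brauer_mapE /brauer_op mulmx_suml.
    by apply: eq_bigr => x _; rewrite -scalemxAl.
  apply: injf; rewrite fv0 -[RHS]bb bbE /brauer_op mulmx_suml linear_sum.
  by apply: eq_bigr => x Cx; rewrite -scalemxAl linearZ /= homf // fv0.
have homj : B *m brauer_op Q E j = brauer_op Q V j *m B by apply: brauer_op_hom.
have Bv0 : B *m v0 != 0.
  apply: contraTneq (irr_degree_gt0 irrV) => Bv0; rewrite -leqNgt.
  have B0 : B = 0.
    apply: mulmx_colP => v; have /imf[X] : exists v', f v' = f v by exists v.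
    case/envelop_mxP=> a -> fv.
    have -> : v = \sum_(x in 'C_G(Q)) a x *: (E x *m v0).
      apply: injf; rewrite fv mulmx_suml linear_sum; apply: eq_bigr => x Cx.
      by rewrite linearZ /= homf // fv0 -scalemxAl.
    rewrite mulmx_sumr big1 // => x Cx.
    by rewrite -scalemxAr mulmxA homB // -mulmxA Bv0 mulmx0 scaler0.
  by move: freeB; rewrite B0 /row_free mxrank0 eq_sym => /eqP->.
apply: contra_neq Bv0 => Vj0.
by rewrite -[v0]jv0 mulmxA homj Vj0 !mul0mx.
Qed.

Lemma piece_conj_simple T T' x : x \in G ->
    piece_group T' :=: (piece_group T :^ x)%g ->
    piece_char T' = conj_char (piece_char T) x ->
  let V := simple_module p lam 'C_G(piece_group T)%G (piece_char T) in
  let V' := simple_module p lam 'C_G(piece_group T')%G (piece_char T') in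
  exists defC : 'C_G(piece_group T')%G :=: ('C_G(piece_group T) :^ x)%g,
    mx_rsim V' (twist_repr defC V).
Proof.
move=> Gx defQ' defphi' V V'.
have defC : 'C_G(piece_group T')%G :=: ('C_G(piece_group T) :^ x)%g.
  by rewrite /= conjIg (conjGid Gx) -centJ defQ'.
exists defC; have [irrV chiV] := simple_moduleP (piece_irr T).
have [irrV' chiV'] := simple_moduleP (piece_irr T').
apply: (brauer_char_rsim (lam := lam)) charF irrV' (twist_irr defC irrV) _.
rewrite chiV' defphi' -{1}chiV; apply/ffunP=> y; rewrite !ffunE.
have -> : (y \in 'C_G(piece_group T')%G) = ((y ^ x^-1)%g \in 'C_G(piece_group T)%G).
  by rewrite defC mem_conjg.
by rewrite p_eltJ.
Qed.

End LocalPointsAndPieces.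

(** * The module of a generalized piece *)

Section PairModule.

Variables (F : closedFieldType) (p : nat) (lam : root_lift F).
Hypothesis charF : p \in [pchar F].
Variables (gT : finGroupType) (G : {group gT}) (r : piece_pair p lam G).
Local Notation P := (pair_group r).
Local Notation Q := (piece_group (pair_piece r)).
Local Notation Pbar := ('N_P(Q) / Q)%G.
Local Notation to := (Pbar_act r).
Local Notation aG := (regular_repr F G).
Local Notation fixed := (@fixed_elt F gT G).

Lemma Pbar_actE k n : k \in 'C_G(Q) -> n \in 'N_P(Q) -> to k (coset Q n) = (k ^ n)%g.
Proof.
move=> Ck Nn; have [_ NQn] := setIP Nn; have [_ CQk] := setIP Ck.
rewrite /= actbyE ?mem_quotient //; apply: (modactE (to := 'J%act)) => //.
by rewrite setTI afixJ.
Qed.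

Variables (n : nat) (rV : mx_representation F (sdprod_group to) n).
Local Notation W := (fun k => rV (sdpair1 to k)).
Local Notation T := (fun s => rV (sdpair2 to s)).

Lemma pair_sdpair1M : {in 'C_G(Q) &, {morph W : x y / (x * y)%g >-> x *m y}}.
Proof. by move=> x y Cx Cy; rewrite /= morphM // repr_mxM ?inE. Qed.

Lemma pair_sdpair1_1 : W 1%g = 1%:M.
Proof. by rewrite /= (morph1 (sdpair1_morphism to)) repr_mx1. Qed.

Lemma pair_sdpair2V s : s \in Pbar -> T s *m T s^-1%g = 1%:M /\ T s^-1%g *m T s = 1%:M.
Proof.
move=> Ss; rewrite -!repr_mxM ?inE // -!morphM ?groupV // mulgV mulVg.
by rewrite (morph1 (sdpair2_morphism to)) repr_mx1.
Qed.

Lemma brauer_op_gconj_norm A y : (A \in group_ring F G)%MS -> y \in 'N_P(Q) ->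
  brauer_op Q W (gconj y A) = T (coset Q y)^-1%g *m brauer_op Q W A *m T (coset Q y).
Proof.
move=> FA Ny; have [Py NQy] := setIP Ny; have Gy := subsetP (pair_sub r) y Py.
have -> : brauer_op Q W (gconj y A) = brauer_op (Q :^ y)%G W (gconj y A).
  by apply: eq_bigl => k; rewrite /= (normP NQy).
rewrite brauer_op_conj // /brauer_op mulmx_sumr mulmx_suml.
apply: eq_bigr => k Ck; rewrite -scalemxAr -scalemxAl; congr (_ *: _).
rewrite -Pbar_actE // sdpair_act ?mem_quotient // conjgE mulgA.
by rewrite !repr_mxM ?inE // morphV ?mem_quotient.
Qed.

(** With the trace taken from Q itself, a surviving coset Q y satisfies Q <= Q^y, that is, y
    normalizes Q; such cosets are exactly the elements of Pbar seen as sets. *)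
Lemma brauer_op_gtrace_norm a : fixed Q a ->
  brauer_op Q W (gtrace Q P a) =
  \sum_(s in Pbar) T s^-1%g *m brauer_op Q W a *m T s.
Proof.
move=> fa; have sQP : Q \subset P := pair_le r; have [FGa _] := fa.
rewrite (brauer_op_gtrace charF) ?(piece_pgroup (pair_piece r)) ?(pair_sub r) //.
rewrite (reindex_onto (fun s : coset_of Q => s : {set gT}) (fun B => coset Q (repr B))) /=.
  apply: eq_big => [s|s]; rewrite coset_reprK eqxx andbT.
    apply/andP/idP=> [[/(repr_rcosets_in sQP) Ps _]|].
      rewrite -[s]coset_reprK mem_quotient // inE Ps repr_coset_norm //.
    case/morphimP=> y NQy /setIP[Py _] ->; split.
      by apply/rcosetsP; exists y; rewrite //= val_coset.
    by rewrite (normP (repr_coset_norm _)).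
  case/andP=> /(repr_rcosets_in sQP) Ps _.
  by rewrite brauer_op_gconj_norm ?coset_reprK // inE Ps repr_coset_norm.
move=> B /andP[/rcosetsP[y Py ->] sQ].
have NQ : repr (Q :* y) \in 'N(Q).
  by apply/normP/esym/eqP; rewrite eqEcard sQ cardJg leqnn.
by rewrite val_coset //= rcoset_repr.
Qed.

Lemma brauer_op_commute A s : fixed P A -> s \in Pbar ->
  brauer_op Q W A *m T s = T s *m brauer_op Q W A.
Proof.
move=> /(fixed_eltP _ (pair_sub r))[FA fA] /morphimP[y NQy Ny ->].
have [Py _] := setIP Ny; have Sy : coset Q y \in Pbar by apply: mem_quotient.
rewrite -[in RHS](fA y Py) brauer_op_gconj_norm // !mulmxA.
by rewrite (proj1 (pair_sdpair2V Sy)) mul1mx.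
Qed.

Lemma brauer_op_norm A : fixed P A ->
  brauer_op Q W A *m norm_mx (sdprod_res rV) = norm_mx (sdprod_res rV) *m brauer_op Q W A.
Proof.
move=> fA; rewrite /norm_mx mulmx_sumr mulmx_suml; apply: eq_bigr => s Ss.
exact: brauer_op_commute.
Qed.

Lemma Pbar_pgroup : p.-group Pbar.
Proof. by rewrite quotient_pgroup // (pgroupS (subsetIl _ _)) ?(pair_pgroup r). Qed.

(* A vector fixed by Pbar generates V already over FC_G(Q), and the relative
   trace of a acts on it as norm_mx times a. *)
Lemma norm_image_simple (w u : 'cV[F]_n) : mx_irreducible rV ->
    norm_mx (sdprod_res rV) *m w != 0 ->
  exists2 x, fixed P x &
    brauer_op Q W x *m (norm_mx (sdprod_res rV) *m w) = norm_mx (sdprod_res rV) *m u.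
Proof.
set N := norm_mx _ => irrV Nw0; have sQP : Q \subset P := pair_le r.
have sQG : Q \subset G := piece_sub (pair_piece r).
have TN s : s \in Pbar -> T s *m (N *m w) = N *m w.
  by move=> Ss; rewrite mulmxA; congr (_ *m w); apply: (norm_mxJ (sdprod_res rV)).
have [A defA] : exists A : 'M[F]_n, A *m (N *m w) = u.
  have [row0 r0] : exists v : 'rV[F]_n, v *m (N *m w) = 1%:M.
    move: (N *m w) Nw0 => y y0; have [a ya] : exists a, y a 0 != 0.
      apply: contrapT => no_a; case/eqP: y0; apply/colP=> a; rewrite mxE.
      by apply/eqP; apply: contrapT => /negP ya; apply: no_a; exists a.
    exists ((y a 0)^-1 *: delta_mx 0 a); rewrite -scalemxAl -rowE.
    by apply/matrixP=> b c; rewrite !ord1 !mxE mulVf.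
  by exists (u *m row0); rewrite -mulmxA r0 mulmx1.
have [a defu] : exists a : gT -> F,
    u = (\sum_(k in 'C_G(Q)) a k *: W k) *m (N *m w).
  rewrite -{u}defA; have [x FLx <-] := irr_gring_full irrV A.
  case/envelop_mxP: FLx => c ->.
  have -> : gring_op rV (\sum_(g in sdprod_group to) c g *: regular_repr F _ g)
      = \sum_(g in sdprod_group to) c g *: rV g.
    by rewrite linear_sum; apply: eq_bigr => g Lg; apply: gring_opZ.
  rewrite mulmx_suml.
  apply: (big_ind (fun v => exists a : gT -> F,
     v = (\sum_(k in 'C_G(Q)) a k *: W k) *m (N *m w))).
  - exists (fun _ => 0); rewrite big1 ?mul0mx // => k _; exact: scale0r.
  - move=> _ _ [a1 ->] [a2 ->]; exists (fun k => a1 k + a2 k).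
    by rewrite -mulmxDl -big_split; congr (_ *m _); apply: eq_bigr => k _; rewrite scalerDl.
  move=> g _.
  (* Every element of the semidirect product is k s with k in C_G(Q) and s in Pbar, and s fixes
     [N *m w], so only k is felt. *)
  have /mulsgP[_ _ /morphimP[k _ Ck ->] /morphimP[s _ Ss ->] ->] :
    g \in ((sdpair1 to @* 'C_G(Q)) * (sdpair2 to @* Pbar))%g by rewrite im_sdpair inE.
  exists (fun l => if l == k then c (sdpair1 to k * sdpair2 to s)%g else 0).
  rewrite (bigD1 k) //= eqxx big1 ?addr0 => [|l /andP[_ /negPf->]]; last exact: scale0r.
  rewrite -!scalemxAl; congr (_ *: _).
  by rewrite repr_mxM ?inE // -mulmxA TN.
pose a0 := \sum_(k in 'C_G(Q)) a k *: aG k.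
have fa0 : fixed Q a0.
  apply/fixed_eltP=> //; split.
    rewrite linear_sum summx_sub // => k /setIP[Gk _].
    by rewrite linearZ scalemx_sub ?group_ringG.
  move=> y Qy; rewrite linear_sum; apply: eq_bigr => k /setIP[Gk Ck].
  rewrite /= gconjZ gconjG ?(subsetP sQG y) //.
  by rewrite conjgE (centP Ck y Qy) mulKg.
have a0E : brauer_op Q W a0 = \sum_(k in 'C_G(Q)) a k *: W k.
  apply: eq_bigr => k Ck; have /setIP[Gk _] := Ck; congr (_ *: _).
  rewrite /a0 gcoef_sum (bigD1 k) //= gcoefZ gcoefG // eqxx mulr1.
  rewrite big1 ?addr0 // => l /andP[/setIP[Gl _] /negPf nlk].
  by rewrite gcoefZ gcoefG // nlk mulr0.
exists (gtrace Q P a0).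
  exact: (gtrace_fixed sQP (pair_sub r)).
rewrite brauer_op_gtrace_norm // mulmx_suml [in RHS]/N [in RHS]/norm_mx [RHS]mulmx_suml.
rewrite [RHS](reindex_inj invg_inj) /=; apply: eq_big => [s|s Ss]; first by rewrite groupV.
by rewrite -!mulmxA TN // a0E -defu.
Qed.

(* A vector fixed by the p-group Pbar in the row space of a relative trace is
   a multiple of norm_mx. *)
Lemma brauer_op_norm_neq0 i c : fixed P i -> i *m i = i -> fixed Q c ->
    i = gtrace Q P c -> brauer_op Q W i != 0 ->
  brauer_op Q W i *m norm_mx (sdprod_res rV) != 0.
Proof.
set N := norm_mx _ => fi ii fc def_i i0.
have sQP : Q \subset P := pair_le r.
have rho_ii : brauer_op Q W i *m brauer_op Q W i = brauer_op Q W i.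
  rewrite -(brauer_opM charF (piece_pgroup _) (piece_sub _) pair_sdpair1M) ?ii //;
    exact: fixed_eltS sQP fi.
have [|w [w0 /submxP[u def_w] fixw]] :=
    pgroup_fixed_row charF Pbar_pgroup (rV := sdprod_res rV) _ i0.
  by move=> s Ss; rewrite [_ *m _](brauer_op_commute fi Ss) submxMl.
have wi : w *m brauer_op Q W i = w by rewrite def_w -mulmxA rho_ii.
have wN : w = w *m brauer_op Q W c *m N.
  rewrite -{1}wi {1}def_i brauer_op_gtrace_norm // mulmx_sumr mulmx_sumr.
  apply: eq_bigr => s Ss; rewrite !mulmxA; congr (_ *m _ *m _).
  by apply: fixw; rewrite groupV.
apply: contra_neq w0; rewrite (brauer_op_norm fi) => Ni0.
by rewrite -wi {1}wN -mulmxA Ni0 mulmx0.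
Qed.

End PairModule.

(** * The multiplicity of a pair and the multiplicity of the point *)

Section PairMultiplicity.

Variables (F : closedFieldType) (p : nat) (lam : root_lift F).
Hypothesis charF : p \in [pchar F].
Variables (gT : finGroupType) (G : {group gT}).
Local Notation fixed := (@fixed_elt F gT G).

Section OnePair.

Variable r : piece_pair p lam G.
Local Notation P := (pair_group r).
Local Notation Q := (piece_group (pair_piece r)).
Local Notation phi := (piece_char (pair_piece r)).
Local Notation Pbar := ('N_P(Q) / Q)%G.
Local Notation to := (Pbar_act r).
Local Notation xi := (sdprod_brauer p lam to phi).
Local Notation Vxi := (simple_module p lam (sdprod_group to) xi).
Local Notation Vphi := (simple_module p lam 'C_G(Q)%G phi).
Local Notation Ephi := (proj_module p lam 'C_G(Q)%G phi).

Lemma pair_multE : pair_mult r = \rank (norm_mx (sdprod_res Vxi)).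
Proof. exact: (summand_mult_regular charF (Pbar_pgroup r)). Qed.

(** If xi were not an irreducible Brauer character, its simple module would be the default of degree
    0, where the norm has rank 0. *)
Lemma pair_mult_irr : pair_mult r != 0%N -> irr_brauer p lam (sdprod_group to) xi.
Proof.
rewrite pair_multE; apply: contra_neqP => /simple_module_grepr0 V0.
by apply/eqP; rewrite -leqn0 (leq_trans (rank_leq_row _)) // V0.
Qed.

(** Were xi the default character 0, irreducibility would give a simple module whose degree, the
    value of xi at 1, is 0. *)
Lemma sdprod_brauerP : irr_brauer p lam (sdprod_group to) xi ->
  mx_rsim (proj_module p lam (sdprod_group to) xi) (sdprod_ind to Ephi).
Proof.
rewrite /sdprod_brauer; case: xgetP => [eta _ [] //|_ [V [irrV chiV0]]].
have := brauer_char1 p lam V; rewrite chiV0 ffunE => /esym/eqP.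
by rewrite Num.Theory.pnatr_eq0 -leqn0 leqNgt (irr_degree_gt0 irrV).
Qed.

(** Inducing E(phi) gives E(xi), so reciprocity yields a nonzero c from E(phi) to V(xi), and ker c
    lies in the kernel of the cover E(phi) -> V(phi). If br(A) kills V(xi), it maps E(phi) into ker
    c, and so kills V(phi). *)
Lemma brauer_op_sdprod (A : 'M[F]_#|G|) :
    (exists E : representation F 'C_G(Q)%G, proj_cover E Vphi) ->
    irr_brauer p lam (sdprod_group to) xi ->
    brauer_op Q Vphi A != 0 -> brauer_op Q (fun k => Vxi (sdpair1 to k)) A != 0.
Proof.
move=> [E covE] irr_xi; have {E covE}covE := proj_moduleP covE.
have [irrV _] := simple_moduleP irr_xi.
have [irrVphi _] := simple_moduleP (piece_irr (pair_piece r)).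
have [_ [B essB]] := covE; have [[homB freeB] _] := essB.
have simE := sdprod_brauerP irr_xi.
have E_gt0 : (0 < rdegree Ephi)%N.
  apply: leq_trans (irr_degree_gt0 irrVphi) _.
  by rewrite -(eqP freeB) rank_leq_col.
have Exi_gt0 : (0 < rdegree (proj_module p lam (sdprod_group to) xi))%N.
  rewrite (mxrank_rsim simE) sum_nat_const card_ord muln_gt0 E_gt0 andbT card_gt0.
  apply/set0Pn; exists (1 *: (sdpair1 to @* 'C_G(Q)))%g.
  by apply/lcosetsP; exists 1%g; rewrite ?inE.
have [_ [B1 [[homB1 freeB1] _]]] := proj_module_pos Exi_gt0.
have B1_0 : B1 != 0.
  rewrite -mxrank_eq0 (eqP freeB1) -lt0n; exact: irr_degree_gt0 irrV.
have [C _ freeC homC] := simE.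
have homB1C : mx_hom (sdprod_ind to Ephi) Vxi (B1 *m C).
  by move=> g Lg; rewrite -mulmxA -homC // mulmxA homB1 // mulmxA.
have B1C_0 : B1 *m C != 0 by rewrite (mulmx_free_eq0 _ freeC).
have [c [c0 homc]] := ind_hom_restrict homB1C B1C_0.
have homcE : {in 'C_G(Q), forall k, c *m Ephi k = Vxi (sdpair1 to k) *m c}.
  move=> k Ck; rewrite -homc ?mem_morphim //=.
  by rewrite (invmE (injm_sdpair1 to)).
have kerc := essential_kernel essB irrVphi c0 homcE.
apply: contra_neq => WA0; have [B' BB'] := row_freeP freeB.
rewrite -[LHS]mulmx1 -BB' mulmxA; suffices -> : brauer_op Q Vphi A *m B = 0 by rewrite mul0mx.
rewrite -(brauer_op_hom (h := Ephi)) //; apply: mulmx_colP => v; rewrite -mulmxA.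
by apply: kerc; rewrite mulmxA (brauer_op_hom A homcE) WA0 !mul0mx.
Qed.

Lemma point_mult_pair (alpha : set 'M[F]_#|G|) i c :
    pointed_pgroup p P alpha -> alpha i -> fixed Q c -> i = gtrace Q P c ->
    (exists E : representation F 'C_G(Q)%G, proj_cover E Vphi) ->
    brauer_op Q Vphi i != 0 -> pair_mult r != 0%N ->
  point_mult alpha = pair_mult r.
Proof.
move=> [[sPG [i0 prim_i0 def_alpha]] pP] alpha_i fc def_i covE Vi0 /pair_mult_irr irr_xi.
have algP := fixed_elt_subalg F sPG; have sQP : Q \subset P := pair_le r.
have conj_i0 : sub_conj (fixed P) i0 i by rewrite def_alpha in alpha_i.
have prim_i := sub_conj_primitive algP prim_i0 conj_i0.
have [[fi ii] _ _] := prim_i.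
have [irrV _] := simple_moduleP irr_xi.
have Wi0 := brauer_op_sdprod covE irr_xi Vi0.
have WiN := brauer_op_norm_neq0 charF fi ii fc def_i Wi0.
pose rho : {linear 'M[F]_#|G| -> 'M[F]_(rdegree Vxi)} :=
  @brauer_op F gT G Q _ (fun k => Vxi (sdpair1 to k)).
have alphaE x : alpha x <-> sub_conj (fixed P) i x.
  rewrite def_alpha; split=> [conj_x|conj_x].
    exact (sub_conj_trans algP (sub_conj_sym conj_i0) conj_x).
  exact (sub_conj_trans algP conj_i0 conj_x).
have [||||le_rank [s [[Us orth] conj_s size_s]]] :=
  @simple_image_multP F #|G| (fixed P) algP _ rho (norm_mx (sdprod_res Vxi)) _ _ _ _ i prim_i WiN.
- by apply: brauer_op1; apply: pair_sdpair1_1.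
- move=> x y fx fy; apply: (brauer_opM charF) (piece_pgroup _) (piece_sub _) _ _ _.
  + exact: pair_sdpair1M.
  + exact: fixed_eltS sQP fx.
  + exact: fixed_eltS sQP fy.
- by move=> x fx; apply: brauer_op_norm.
- by move=> w u; apply: norm_image_simple.
rewrite pair_multE; apply: nat_max_eq.
  by exists s; split=> // x /conj_s/alphaE.
move=> k [t [Ut <- alpha_t orth_t]]; apply: le_rank => //.
by move=> x /alpha_t/alphaE.
Qed.

End OnePair.
End PairMultiplicity.

Theorem proposition3p12 (F : closedFieldType) (p : nat) (charF : p \in [pchar F])
    (lam : root_lift F) (gT : finGroupType) (G : {group gT})
    (P : {group gT}) (alpha : set 'M[F]_#|G|) (X : gen_piece p lam G) :
  pointed_pgroup p P alpha ->
  substantive X ->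
  corresponding P alpha X ->
  point_mult alpha = gp_mult X.
Proof.
move=> ppP subX [r [delta [Xr defP [locQ _ simE] maxQ]]].
set T := pair_piece r in locQ simE maxQ.
have [r' Xr' mult_r'] : exists2 r', gp_pairs X r' & pair_mult r' = gp_mult X.
  rewrite /gp_mult; case: xgetP => [m _ //|/(_ (pair_mult r)) []].
  by exists r.
have [_ [i [j [alpha_i delta_j ij ji]]]] : pointed_le (piece_group T) delta P alpha.
  by case: maxQ.
have [[[sQG [j0 prim_j0 def_delta]] pQ] nz_delta] := locQ.
have algQ := fixed_elt_subalg F sQG.
have [[fj jj] _ _] : sub_primitive (@fixed_elt F gT G (piece_group T)) j.
  by rewrite def_delta in delta_j; apply: sub_conj_primitive algQ prim_j0 delta_j.
have [c [fc def_i]] := maximal_local_relative_trace charF ppP maxQ alpha_i.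
have sQP : piece_group T \subset P by rewrite -defP (pair_le r).
have sPG : P \subset G by case: ppP => -[].
have fi : fixed_elt P i by rewrite def_i; apply: gtrace_fixed.
have [[E covE] Vj0] := left_ideal_cover charF fj jj (nz_delta j delta_j) (simE j delta_j).
set V := simple_module _ _ _ _ in covE Vj0.
have Vi0 : brauer_op (piece_group T) V i != 0.
  (* Since j = i j, the action of br(j) factors through that of br(i). *)
  apply: contra_neq Vj0 => Vi0; rewrite -ij (brauer_opM charF) //.
  - by rewrite Vi0 mul0mx.
  - by move=> x y Cx Cy; apply: repr_mxM.
  exact: fixed_eltS sQP fi.
have [x [Px defP' defQ' defphi']] : exists x, [/\ x \in P, P = pair_group r',
    piece_group (pair_piece r') :=: (piece_group T :^ x)%g &
    piece_char (pair_piece r') = conj_char (piece_char T) x].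
  have [r0 defX] := gp_class X; rewrite defX in Xr Xr'.
  have [eqP1 [x1 [Px1 defQ1 defphi1]]] := Xr.
  have [eqP2 [x2 [Px2 defQ2 defphi2]]] := Xr'.
  have eqP1' : pair_group r0 = P by rewrite eqP1.
  rewrite eqP1' in Px1 Px2 eqP2.
  exists (x1^-1 * x2)%g; split; rewrite ?groupM ?groupV //.
    by rewrite defQ1 -conjsgM mulKVg.
  rewrite /T defphi1 defphi2; apply/ffunP=> y; rewrite !ffunE.
  by rewrite invMg invgK -conjgM mulgK.
rewrite -mult_r'; have Gx := subsetP sPG x Px.
have [defC simV] := piece_conj_simple charF Gx defQ' defphi'.
have defQ'' : piece_group (pair_piece r') = (piece_group T :^ x)%G by apply: val_inj.
have gix : gconj x i = i by case/(fixed_eltP _ sPG): fi => _; apply.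
move: ppP; rewrite defP' => ppP.
(* As x lies in P, conjugation by x fixes i while moving c from Q to Q^x, so the same i is a
   relative trace for the pair [r']. *)
apply: (point_mult_pair charF ppP alpha_i (c := gconj x c)).
- by rewrite defQ''; apply: fixed_elt_conj.
- by rewrite defQ'' -defP' gtrace_conj.
- by exists (Representation (twist_repr defC E)); apply: proj_cover_twist covE simV.
- have [B eqn freeB homB] := simV; have /row_fullP[B' B'B] : row_full B.
    by rewrite /row_full (eqP freeB) eqn.
  pose h y := V (y ^ x^-1)%g; have hom_h : {in 'C_G(piece_group (pair_piece r')),
      forall y, B *m h y = simple_module p lam 'C_G(piece_group (pair_piece r'))%G
        (piece_char (pair_piece r')) y *m B} by move=> y /homB.
  apply: contra_neq Vi0 => V'i0; have := brauer_op_hom i hom_h.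
  rewrite V'i0 mul0mx => /(congr1 (mulmx B')).
  rewrite mulmxA B'B mul1mx mulmx0 defQ'' -{1}gix brauer_op_conj //; last by case: fi.
  by move=> hi0; rewrite -[RHS]hi0; apply: eq_bigr => y _; rewrite /h conjgK.
by rewrite mult_r'.
Qed.
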